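(* Let $\lambda,\mu,\nu$ be partitions. In $\mathrm{Rep}(\mathbf{O})$, the multiplicity of the simple object $V_\nu$ in $V_\lambda\otimes V_\mu$ is $$\sum_{\alpha,\beta,\gamma}c^\lambda_{\alpha,\beta}\,c^\mu_{\beta,\gamma}\,c^\nu_{\alpha,\gamma},$$ where the sum is over all partitions $\alpha,\beta,\gamma$.
   Context: Everything is over $\mathbf{C}$. $\mathbf{V}=\mathbf{C}^\infty$ has basis $e_1,e_2,\dots$ and symmetric form $\omega(\sum a_ie_i,\sum b_je_j)=\sum_{k\ge1}(a_{2k-1}b_{2k}+a_{2k}b_{2k-1})$; $\mathbf{O}(\infty)\subset\mathbf{GL}(\infty)=\bigcup_d\mathbf{GL}(d)$ is its stabilizer. $\mathrm{Rep}(\mathbf{O})$ is the category of algebraic representations of $\mathbf{O}(\infty)$: subquotients of finite direct sums of the $T_n=\mathbf{V}^{\otimes n}$. All its objects have finite length; multiplicity means multiplicity as a composition factor (the category is not semi-simple). $T_{[n]}\subset T_n$ is the intersection of the kernels of all maps $T_n\to T_{n-2}$ applying $\omega$ to two tensor factors, and for a partition $\lambda$ of $n$, $V_\lambda=\mathrm{Hom}_{S_n}(\mathbf{M}_\lambda,T_{[n]})$, where $\mathbf{M}_\lambda$ is the irreducible representation of $S_n$ attached to $\lambda$ (with $(n)$ trivial, $(1^n)$ sign). The $V_\lambda$ are the simple objects of $\mathrm{Rep}(\mathbf{O})$. $c^\lambda_{\alpha,\beta}$ is the Littlewood–Richardson coefficient (multiplicity of the Schur functor $\mathbf{S}_\lambda$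 in $\mathbf{S}_\alpha\otimes\mathbf{S}_\beta$). *)

(* Defs.v *)
From HB Require Import structures.
From mathcomp Require Import all_boot all_order all_fingroup all_algebra.
From mathcomp Require Import complex finmap monalg.
From mathcomp Require Import boolp classical_sets functions cardinality fsbigop.
From mathcomp Require Import reals.

Set Implicit Arguments.
Unset Strict Implicit.
Unset Printing Implicit Defensive.

Import GRing.Theory.

Local Open Scope ring_scope.
Local Open Scope quotient_scope.

Section Subspaces.
Variables (K : fieldType) (U : lmodType K).

Record subspace (S : submodClosed U) :=
  Subspace { subspace_val :> U; _ : subspace_val \in S }.

HB.instance Definition _ (S : submodClosed U) :=
  [isSub for @subspace_val S].
HB.instance Definition _ (S : submodClosed U) := [Choice of subspace S by <:].
HB.instance Definition _ (S : submodClosed U) :=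
  [SubChoice_isSubLmodule of subspace S by <:].

Definition lspan_pred (E : set U) : {pred U} := fun x =>
  `[< forall S : submodClosed U, (forall y, E y -> y \in S) -> x \in S >].

Fact lspan_closed E : submod_closed (lspan_pred E).
Proof.
split=> [|a x y /asboolP hx /asboolP hy]; apply/asboolP => S ES.
  exact: rpred0.
by rewrite rpredD ?rpredZ ?hx ?hy.
Qed.

HB.instance Definition _ E :=
  GRing.isSubmodClosed.Build K U (lspan_pred E) (lspan_closed E).

Definition lspan (E : set U) : submodClosed U := lspan_pred E.

Lemma lspan_gen (E : set U) y : E y -> y \in lspan E.
Proof. by move=> Ey; apply/asboolP => S; apply. Qed.

Lemma lspan_min (E : set U) (S : submodClosed U) x :
  (forall y, E y -> y \in S) -> x \in lspan E -> x \in S.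
Proof. by move=> ES /asboolP; apply. Qed.

(* Quotient.quot expects a zmodClosed predicate; submodClosed only records
   closure under addition and scaling. *)
Definition zpred (S : submodClosed U) : {pred U} := fun x => x \in S.

Fact zpred_closed S : zmod_closed (zpred S).
Proof.
split=> [|x y xS yS]; first exact: rpred0.
by rewrite /zpred unfold_in -scaleN1r rpredD ?rpredZ.
Qed.

HB.instance Definition _ S :=
  GRing.isZmodClosed.Build U (zpred S) (zpred_closed S).

Definition all_pred : {pred U} := fun _ => true.

Fact all_closed : submod_closed all_pred.
Proof. by []. Qed.

HB.instance Definition _ := GRing.isSubmodClosed.Build K U all_pred all_closed.

Definition all_of : submodClosed U := all_pred.

Definition quotient (S : submodClosed U) := Quotient.quot (zpred S).

Section Quotient.
Variable S : submodClosed U.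

HB.instance Definition _ := GRing.Zmodule.on (quotient S).

Definition quot_proj (x : U) : quotient S := \pi_(Quotient.quot (zpred S)) x.

Lemma quot_projE x y : (quot_proj x = quot_proj y) <-> (x - y \in S).
Proof.
split=> [/eqP|xyS]; first by rewrite /quot_proj -Quotient.idealrBE.
by apply/eqP; rewrite /quot_proj -Quotient.idealrBE.
Qed.

Lemma quot_projK (x : quotient S) : quot_proj (generic_quotient.repr (x : Quotient.quot (zpred S))) = x.
Proof. exact: reprK. Qed.

Fact quot_projB : zmod_morphism quot_proj.
Proof. by move=> x y; rewrite /quot_proj raddfB. Qed.

Definition quot_scale a (x : quotient S) : quotient S :=
  quot_proj (a *: generic_quotient.repr (x : Quotient.quot (zpred S))).

Lemma quot_scaleE a x : quot_scale a (quot_proj x) = quot_proj (a *: x).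
Proof.
apply/quot_projE; rewrite -scalerBr rpredZ //; apply/quot_projE.
exact: quot_projK.
Qed.

Fact quot_scaleA a b x : quot_scale a (quot_scale b x) = quot_scale (a * b) x.
Proof. by rewrite -(quot_projK x) !quot_scaleE scalerA. Qed.

Fact quot_scale1 : left_id 1 quot_scale.
Proof. by move=> x; rewrite -(quot_projK x) quot_scaleE scale1r. Qed.

Let quot_projD x y : quot_proj (x + y) = quot_proj x + quot_proj y.
Proof. by rewrite /quot_proj raddfD. Qed.

Fact quot_scaleDr : right_distributive quot_scale +%R.
Proof.
move=> a x y; rewrite -(quot_projK x) -(quot_projK y) -quot_projD.
by rewrite !quot_scaleE -quot_projD scalerDr.
Qed.

Fact quot_scaleDl x : {morph quot_scale^~ x : a b / a + b}.
Proof.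
by move=> a b; rewrite -(quot_projK x) !quot_scaleE -quot_projD scalerDl.
Qed.

HB.instance Definition _ := GRing.Zmodule_isLmodule.Build K (quotient S)
  quot_scaleA quot_scale1 quot_scaleDr quot_scaleDl.

Fact quot_proj_linear : linear quot_proj.
Proof. by move=> a x y; rewrite quot_projD -quot_scaleE. Qed.

HB.instance Definition _ :=
  GRing.isLinear.Build K U (quotient S) *:%R quot_proj quot_proj_linear.

End Quotient.
End Subspaces.

Section Kernel.
Variables (K : fieldType) (U W : lmodType K) (h : {linear U -> W}).

Definition ker_pred : {pred U} := fun x => h x == 0.

Fact ker_closed : submod_closed ker_pred.
Proof.
split=> [|a x y /eqP x0 /eqP y0]; first exact/eqP/linear0.
by apply/eqP; rewrite linearP x0 y0 scaler0 addr0.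
Qed.

HB.instance Definition _ := GRing.isSubmodClosed.Build K U ker_pred ker_closed.

Definition kernel : submodClosed U := ker_pred.

Lemma kerE x : (x \in kernel) = (h x == 0).
Proof. by []. Qed.

End Kernel.

(* {malg K[I]} is the K-vector space with basis << i >>, i : I. *)
Section FreeModules.
Variable K : fieldType.

Definition lext (I : choiceType) (W : lmodType K) (f : I -> W)
  (x : {malg K[I]}) : W := \sum_(i <- msupp x) x@_i *: f i.

Section LinearExtension.
Variables (I : choiceType) (W : lmodType K) (f : I -> W).

Lemma lextEw (d : {fset I}) x :
  (msupp x `<=` d)%fset -> lext f x = \sum_(i <- d) x@_i *: f i.
Proof.
move=> xd; rewrite /lext; apply: big_fset_incl => // i _ /mcoeff_outdom ->.
by rewrite scale0r.
Qed.

Fact lext_linear : linear (lext f).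
Proof.
move=> a x y; pose d := (msupp x `|` msupp y `|` msupp (a *: x + y))%fset.
have sx : (msupp x `<=` d)%fset.
  by rewrite /d -fsetUA fsubsetUl.
have sy : (msupp y `<=` d)%fset.
  by rewrite /d (fsetUC (msupp x)) -fsetUA fsubsetUl.
have sz : (msupp (a *: x + y) `<=` d)%fset by rewrite /d fsubsetUr.
rewrite (lextEw sx) (lextEw sy) (lextEw sz) scaler_sumr -big_split /=.
by apply: eq_bigr => i _; rewrite mcoeffD mcoeffZ scalerDl scalerA.
Qed.

HB.instance Definition _ :=
  GRing.isLinear.Build K {malg K[I]} W *:%R (lext f) lext_linear.

Lemma lextU i : lext f << i >> = f i.
Proof.
rewrite (lextEw (d := [fset i]%fset)) ?msuppU_le //.
by rewrite big_seq_fset1 mcoeffUU scale1r.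
Qed.

End LinearExtension.

Lemma malg_sumU (I : choiceType) (x : {malg K[I]}) : x = lext (fun i => << i >>) x.
Proof.
rewrite [LHS]monalgE /lext; apply: eq_bigr => i _.
by apply/malgP => k; rewrite mcoeffZ !mcoeffU mulr_natr.
Qed.

Lemma malg_linear_eq (I : choiceType) (W : lmodType K)
    (f g : {linear {malg K[I]} -> W}) :
  (forall i, f << i >> = g << i >>) -> f =1 g.
Proof.
move=> fg x; rewrite (malg_sumU x) /lext !linear_sum /=.
by apply: eq_bigr => i _; rewrite !linearZ /= fg.
Qed.

End FreeModules.

(* The tensor power K^(I) ^⊗n, on the basis of words i : 'I_n -> I, the word i
   standing for << i 0 >> ⊗ ... ⊗ << i n.-1 >>. *)
Section TensorPowers.
Variable K : fieldType.

Definition tpow (I : choiceType) (n : nat) := {malg K[{ffun 'I_n -> I}]}.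

(* The pure tensor v 0 ⊗ ... ⊗ v n.-1; the sum has finite support. *)
Definition tens (I : choiceType) n (v : 'I_n -> {malg K[I]}) : tpow I n :=
  \sum_(j \in [set: {ffun 'I_n -> I}]) (\prod_(k < n) (v k)@_(j k)) *: << j >>.

Lemma mcoeff_tens (I : choiceType) n (v : 'I_n -> {malg K[I]}) j :
  (tens v)@_j = \prod_(k < n) (v k)@_(j k).
Proof.
pose S : {fset I} := (\bigcup_(k <- enum 'I_n) msupp (v k))%fset.
pose F (f : {ffun 'I_n -> S}) : {ffun 'I_n -> I} := [ffun k => val (f k)].
pose D : {fset {ffun 'I_n -> I}} := [fset i in codom F]%fset.
have DP (i : {ffun 'I_n -> I}) : i \notin D -> \prod_(k < n) (v k)@_(i k) = 0.
  move=> iD; apply/eqP; apply: contraNT iD => /prodf_neq0 h.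
  have hS k : i k \in S.
    apply/bigfcupP; exists k; first by rewrite mem_enum.
    by rewrite -mcoeff_neq0 h.
  rewrite inE /=; apply/codomP; exists [ffun k => [` hS k]%fset].
  by apply/ffunP => k; rewrite !ffunE.
rewrite /tens (fsbigTE D); last by move=> i /DP ->; rewrite scale0r.
rewrite raddf_sum /=; under eq_bigr do rewrite mcoeffZ mcoeffU.
case: (boolP (j \in D)) => jD.
  rewrite (big_fsetD1 j) //= eqxx mulr1 [X in _ + X]big_seq_cond.
  rewrite [X in _ + X]big1 ?addr0 // => i.
  by rewrite andbT !inE => /andP[/negPf -> _]; rewrite mulr0.
rewrite (DP _ jD) big_seq_cond big1 // => i; rewrite andbT => iD.
by case: eqP => [ij|_]; [move: jD; rewrite -ij iD | rewrite mulr0].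
Qed.

Section Multilinear.
Variables (I : choiceType) (n : nat).
Implicit Types (v : 'I_n -> {malg K[I]}) (k : 'I_n).

Definition upd v k x : 'I_n -> {malg K[I]} := fun l => if l == k then x else v l.

Definition multilinear_map (W : lmodType K) (F : ('I_n -> {malg K[I]}) -> W) :=
  forall v k, linear (fun x => F (upd v k x)).

Lemma multilinear_eq (W : lmodType K) (F G : ('I_n -> {malg K[I]}) -> W) :
  multilinear_map F -> multilinear_map G ->
  (forall i : 'I_n -> I, F (fun k => << i k >>) = G (fun k => << i k >>)) ->
  F =1 G.
Proof.
move=> linF linG FG.
have main (s : seq 'I_n) : forall v,
    (forall k, k \notin s -> exists i, v k = << i >>) -> F v = G v.
  elim: s => [|k s IH] v vs.
    have /choice[i vi] : forall k, exists i, v k = << i >> by move=> k; apply: vs.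
    by rewrite (_ : v = fun k => << i k >>) //; apply/funext.
  have -> : v = upd v k (v k) by apply/funext => l; rewrite /upd; case: eqP => [->|].
  pose f := HB.pack_for {linear {malg K[I]} -> W} (fun x => F (upd v k x))
    (GRing.isLinear.Build K _ W *:%R _ (linF v k)).
  pose g := HB.pack_for {linear {malg K[I]} -> W} (fun x => G (upd v k x))
    (GRing.isLinear.Build K _ W *:%R _ (linG v k)).
  apply: (@malg_linear_eq K I W f g) => i /=.
  apply: IH => l ls; rewrite /upd; case: eqP => [_|/eqP lk]; first by exists i.
  by apply: vs; rewrite inE negb_or lk.
by move=> v; apply: (main (enum 'I_n)) => k; rewrite mem_enum.
Qed.

Lemma prod_upd v k x (j : 'I_n -> I) :
  \prod_l (upd v k x l)@_(j l) = x@_(j k) * \prod_(l | l != k) (v l)@_(j l).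
Proof.
rewrite (bigD1 k) //= /upd eqxx; congr (_ * _).
by apply: eq_bigr => l /negPf ->.
Qed.

Lemma tens_multilinear : multilinear_map (@tens I n).
Proof.
move=> v k a x y; apply/malgP => j.
rewrite mcoeffD mcoeffZ !mcoeff_tens !prod_upd.
by rewrite mcoeffD mcoeffZ mulrDl mulrA.
Qed.

End Multilinear.

Lemma tensU (I : choiceType) n (i : 'I_n -> I) :
  tens (fun k => << i k >>) = << [ffun k => i k] >>.
Proof.
apply/malgP => j; rewrite mcoeff_tens mcoeffU.
under eq_bigr do rewrite mcoeffU.
case: eqP => [<-|ij].
  by rewrite big1 // => k _; rewrite ffunE eqxx.
have [k /eqP ijk] : exists k, i k <> j k.
  apply: contra_notP ij => /forallNP h; apply/ffunP => k.
  by rewrite ffunE; apply: contrapT; apply: h.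
by rewrite (bigD1 k) //= (negPf ijk) mul0r.
Qed.

Section TensorMap.
Variables (I J : choiceType) (g : {malg K[I]} -> {malg K[J]}) (n : nat).

(* g ⊗ ... ⊗ g *)
Definition tmap : tpow I n -> tpow J n :=
  lext (fun i : {ffun 'I_n -> I} => tens (fun k => g << i k >>)).

HB.instance Definition _ := GRing.Linear.copy tmap
  (lext (fun i : {ffun 'I_n -> I} => tens (fun k => g << i k >>))).

Lemma tmapU i : tmap << i >> = tens (fun k => g << i k >>).
Proof. exact: lextU. Qed.

End TensorMap.

Section SymmetricAction.
Variables (I : choiceType) (n : nat) (s : 'S_n).

(* A left action for the product of 'S_n, which composes left to right. *)
Definition sact : tpow I n -> tpow I n :=
  lext (fun i : {ffun 'I_n -> I} => << [ffun k => i (s k)] >>).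

HB.instance Definition _ := GRing.Linear.copy sact
  (lext (fun i : {ffun 'I_n -> I} => (<< [ffun k => i (s k)] >> : tpow I n))).

Lemma sactU i : sact << i >> = << [ffun k => i (s k)] >>.
Proof. exact: lextU. Qed.

Lemma sact_tens v : sact (tens v) = tens (v \o s).
Proof.
move: v; apply: multilinear_eq => [v k a x y|v k a x y|i].
- by rewrite tens_multilinear linearP.
- have updE z : upd v k z \o s = upd (v \o s) (s^-1 k)%g z.
    apply/funext => l; rewrite /upd /=.
    by rewrite -{1}(permKV s k) (inj_eq perm_inj).
  by rewrite !updE tens_multilinear.
- rewrite tensU sactU /comp tensU; congr << _ >>.
  by apply/ffunP => k; rewrite !ffunE.
Qed.

End SymmetricAction.

Lemma sact_tmap (I J : choiceType) (g : {malg K[I]} -> {malg K[J]}) n (s : 'S_n) x :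
  sact s (tmap g x) = tmap g (sact s x).
Proof.
move: x; apply: (@malg_linear_eq K _ _ (sact s \o @tmap I J g n) (@tmap I J g n \o sact s)) => i /=.
rewrite tmapU sact_tens sactU tmapU; congr tens.
by apply/funext => k /=; rewrite ffunE.
Qed.

End TensorPowers.

(* A category of vector spaces with chosen bases. Identities and composition
   are not recorded: subobjects and isomorphisms of functors on the category
   only involve the operators attached to its morphisms. *)
Record basedCat (K : fieldType) := BasedCat {
  bc_ob : Type;
  bc_basis : bc_ob -> choiceType;
  bc_hom : bc_ob -> bc_ob -> Type;
  bc_map : forall X Y, bc_hom X Y ->
    {linear {malg K[bc_basis X]} -> {malg K[bc_basis Y]}} }.

(* Functors from such a category to K-vector spaces. When the category has a
   single object with automorphism group G, these are the linear
   representations of G. *)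
Record functor (K : fieldType) (D : basedCat K) := Functor {
  fob :> bc_ob D -> lmodType K;
  fmap : forall X Y, bc_hom X Y -> {linear fob X -> fob Y} }.

Arguments fmap {K D} f {X Y} _.

Section Functors.
Variables (K : fieldType) (D : basedCat K).
Implicit Types F G : functor D.

Record subfunctor F := Subfunctor {
  sfob :> forall X, submodClosed (F X);
  sf_stable : forall X Y (h : bc_hom X Y) (x : F X),
    x \in sfob X -> fmap F h x \in sfob Y }.

Definition sfle F (A B : subfunctor F) :=
  forall X (x : F X), x \in A X -> x \in B X.

(* For A contained in B: the quotient B / A is simple. *)
Definition simple_factor F (A B : subfunctor F) :=
  [/\ sfle A B, ~ sfle B A &
      forall C : subfunctor F, sfle A C -> sfle C B -> sfle C A \/ sfle B C].

(* For A contained in B: the quotient B / A is isomorphic to G. *)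
Definition factor_iso F (A B : subfunctor F) G :=
  exists f : forall X, F X -> G X,
  [/\ forall X a, {in B X &, forall x y, f X (a *: x + y) = a *: f X x + f X y},
      forall X Y (h : bc_hom X Y),
        {in B X, forall x, f Y (fmap F h x) = fmap G h (f X x)},
      forall X, {in B X, forall x, (f X x == 0) = (x \in A X)} &
      forall X (z : G X), exists2 x, x \in B X & f X x = z].

Definition composition_series F (l : nat) (A : nat -> subfunctor F) :=
  [/\ forall X (x : F X), x \in A 0%N X -> x = 0,
      forall X (x : F X), x \in A l X &
      forall k, (k < l)%N -> simple_factor (A k) (A k.+1)].

Definition factor_count F (l : nat) (A : nat -> subfunctor F) G : nat :=
  #|[set k : 'I_l | `[< factor_iso (A k) (A k.+1) G >]]|.

(* F has finite length, and G occurs m times among its composition factors. *)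
Definition multiplicity F G (m : nat) :=
  (exists l A, @composition_series F l A) /\
  forall l A, @composition_series F l A -> factor_count l A G = m.

End Functors.

Section TensorProduct.
Variable K : fieldType.

Definition bilin_rel (U W : lmodType K) (z : {malg K[(U * W)%type]}) :=
  (exists a u1 u2 w,
     z = << (a *: u1 + u2, w) >> - (a *: << (u1, w) >> + << (u2, w) >>)) \/
  (exists a u w1 w2,
     z = << (u, a *: w1 + w2) >> - (a *: << (u, w1) >> + << (u, w2) >>)).

Definition tprod (U W : lmodType K) : lmodType K :=
  quotient (lspan (@bilin_rel U W)).

Definition ptens (U W : lmodType K) (u : U) (w : W) : tprod U W :=
  quot_proj _ << (u, w) >>.

Lemma ptens_linearl (U W : lmodType K) (w : W) : linear (fun u : U => ptens u w).
Proof.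
move=> a x y; rewrite /ptens -linearP; apply/quot_projE.
by apply: lspan_gen; left; exists a, x, y, w.
Qed.

Lemma ptens_linearr (U W : lmodType K) (u : U) : linear (fun w : W => ptens u w).
Proof.
move=> a x y; rewrite /ptens -linearP; apply/quot_projE.
by apply: lspan_gen; right; exists a, u, x, y.
Qed.

Section Map.
Variables (U U' W W' : lmodType K).
Variables (f : {linear U -> U'}) (g : {linear W -> W'}).

Let fg (p : U * W) : tprod U' W' := ptens (f p.1) (g p.2).

Let rel0 x : x \in lspan (@bilin_rel U W) -> lext fg x = 0.
Proof.
move=> xR; apply/eqP; rewrite -(kerE (lext fg)).
apply: lspan_min xR => y yR; rewrite kerE; apply/eqP.
case: yR => [[a [u1 [u2 [w ->]]]]|[a [u [w1 [w2 ->]]]]].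
  rewrite linearB /= linearP /= !lextU /fg /=.
  by rewrite linearP ptens_linearl subrr.
rewrite linearB /= linearP /= !lextU /fg /=.
by rewrite linearP ptens_linearr subrr.
Qed.

(* f ⊗ g *)
Definition tprod_map (x : tprod U W) : tprod U' W' :=
  lext (fun p : U * W => ptens (f p.1) (g p.2)) (generic_quotient.repr (x : Quotient.quot _)).

Lemma tprod_mapE x : tprod_map (quot_proj _ x) = lext fg x.
Proof.
apply/eqP; rewrite -subr_eq0 -linearB; apply/eqP; apply: rel0.
by apply/quot_projE; apply: quot_projK.
Qed.

Fact tprod_map_linear : linear tprod_map.
Proof.
move=> a x y; rewrite -(quot_projK x) -(quot_projK y) -linearP.
by rewrite !tprod_mapE linearP.
Qed.

HB.instance Definition _ :=
  GRing.isLinear.Build K (tprod U W) (tprod U' W') *:%R tprod_map tprod_map_linear.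

Lemma tprod_map_ptens u w : tprod_map (ptens u w) = ptens (f u) (g w).
Proof. by rewrite tprod_mapE lextU. Qed.

End Map.

Section Functors.
Variable D : basedCat K.

Definition tensor (F G : functor D) : functor D :=
  @Functor K D (fun X => tprod (F X) (G X))
    (fun X Y h => tprod_map (fmap F h) (fmap G h)).

Definition zero_functor : functor D :=
  @Functor K D (fun _ => 'rV[K]_0) (fun _ _ _ => idfun).

Section DirectSum.
Variables F G : functor D.

Definition dsum_map X Y (h : bc_hom X Y) (x : (F X * G X)%type) :=
  (fmap F h x.1, fmap G h x.2).

Fact dsum_map_linear X Y h : linear (@dsum_map X Y h).
Proof. by move=> a x y; rewrite /dsum_map !linearP. Qed.

HB.instance Definition _ X Y h := GRing.isLinear.Build K _ _ *:%R
  (@dsum_map X Y h) (@dsum_map_linear X Y h).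

Definition dsum : functor D :=
  @Functor K D (fun X => (F X * G X)%type) (fun X Y h => @dsum_map X Y h).

End DirectSum.

Definition tensor_power (n : nat) : functor D :=
  @Functor K D (fun X => tpow K (bc_basis X) n)
    (fun X Y h => @tmap K _ _ (bc_map h) n).

Definition full_subfunctor (F : functor D) : subfunctor F :=
  @Subfunctor K D F (fun X => all_of (F X)) (fun _ _ _ _ _ => isT).

End Functors.
End TensorProduct.

Record intpart := IntPart {
  parts :> seq nat; _ : sorted geq parts && (0%N \notin parts) }.

HB.instance Definition _ := [isSub for parts].
HB.instance Definition _ := [Choice of intpart by <:].

(* The irreducible representation of 'S_n attached to a partition la of n:
   the left ideal generated by a Young symmetrizer in the group algebra, the
   boxes of the diagram of la being numbered row by row. *)
Section Specht.
Variables (K : fieldType) (la : intpart).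
Notation n := (sumn la).
Notation galg := {ffun 'S_n -> K^o}.

Definition gmul (x y : galg) : galg :=
  [ffun t => \sum_(s : 'S_n) x s * y (s^-1 * t)%g].

(* left multiplication by s *)
Definition gact (s : 'S_n) (x : galg) : galg := [ffun t => x (s^-1 * t)%g].

Definition row_sum : galg :=
  [ffun s : 'S_n =>
     [forall k : 'I_n, reshape_index la (s k) == reshape_index la k]%:R].

Definition col_sum : galg :=
  [ffun s : 'S_n =>
     if [forall k : 'I_n, reshape_offset la (s k) == reshape_offset la k]
     then (-1) ^+ odd_perm s else 0].

Definition specht_pred : {pred galg} :=
  fun x => `[< exists y, x = gmul y (gmul row_sum col_sum) >].

Fact specht_closed : submod_closed specht_pred.
Proof.
split=> [|a _ _ /asboolP[x ->] /asboolP[y ->]]; apply/asboolP.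
  by exists 0; apply/ffunP => t; rewrite !ffunE big1 // => s _; rewrite ffunE mul0r.
exists (a *: x + y); apply/ffunP => t; rewrite !ffunE scaler_sumr -big_split /=.
by apply: eq_bigr => s _; rewrite !ffunE mulrDl -mulrA.
Qed.

HB.instance Definition _ :=
  GRing.isSubmodClosed.Build K galg specht_pred specht_closed.

Definition specht := subspace specht_pred.

Fact gact_specht s (x : specht) : gact s (val x) \in specht_pred.
Proof.
case: x => _ /= /asboolP[y ->]; apply/asboolP; exists (gact s y).
apply/ffunP => t; rewrite !ffunE [RHS](reindex_inj (mulgI s)) /=.
by apply: eq_bigr => r _; rewrite !ffunE mulKg invMg mulgA.
Qed.

Definition specht_act s (x : specht) : specht := Subspace (gact_specht s x).

End Specht.

Lemma scaleDACA (K : fieldType) (U : lmodType K) (a b : K) (x y z t : U) :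
  a *: (b *: x + y) + (b *: z + t) = b *: (a *: x + z) + (a *: y + t).
Proof. by rewrite !scalerDr !scalerA mulrC addrACA. Qed.

(* The functor X |-> Hom_{S_n}(M_la, A X), for a subfunctor A of the n-th tensor
   power, where n = |la|. *)
Section SpechtHom.
Variables (K : fieldType) (D : basedCat K) (la : intpart).
Notation n := (sumn la).
Variable A : subfunctor (tensor_power D n).

Section Space.
Variable X : bc_ob D.
Notation hom := (specht K la -> tpow K (bc_basis X) n).

Definition hom_pred : {pred hom} := fun f =>
  `[< [/\ linear f,
          forall s m, f (specht_act s m) = sact s (f m) &
          forall m, f m \in A X] >].

Fact hom_closed : submod_closed hom_pred.
Proof.
split=> [|a f g /asboolP[f1 f2 f3] /asboolP[g1 g2 g3]]; apply/asboolP.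
  split=> [b x y|s m|m]; rewrite ?linear0 ?scaler0 ?addr0 //; exact: rpred0.
have fgE m : (a *: f + g) m = a *: f m + g m by [].
split=> [b x y|s m|m]; rewrite !fgE.
- by rewrite f1 g1 scaleDACA.
- by rewrite f2 g2 linearP.
- by rewrite rpredD // rpredZ.
Qed.

HB.instance Definition _ := GRing.isSubmodClosed.Build K hom hom_pred hom_closed.

End Space.

Section Map.
Variables (X Y : bc_ob D) (h : bc_hom X Y).

Fact hom_map_subproof (f : subspace (@hom_pred X)) :
  (fun m => tmap (bc_map h) (val f m)) \in @hom_pred Y.
Proof.
case: f => f /= /asboolP[f1 f2 f3]; apply/asboolP; split=> [a x y|s m|m].
- by rewrite f1 linearP.
- by rewrite f2 sact_tmap.
- exact: (@sf_stable K D _ A X Y h _ (f3 m)).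
Qed.

Definition hom_map f : subspace (@hom_pred Y) := Subspace (hom_map_subproof f).

Fact hom_map_linear : linear hom_map.
Proof.
by move=> a f g; apply/val_inj/funext => m /=; rewrite linearP.
Qed.

HB.instance Definition _ := GRing.isLinear.Build K
  (subspace (@hom_pred X)) (subspace (@hom_pred Y)) *:%R hom_map hom_map_linear.

End Map.

Definition specht_hom : functor D :=
  @Functor K D (fun X => subspace (@hom_pred X)) (fun X Y h => @hom_map X Y h).

End SpechtHom.

(* The category of finite-dimensional vector spaces, through its skeleton
   K^0, K^1, K^2, ... *)
Section LittlewoodRichardson.
Variable K : fieldType.

Definition Vec : basedCat K :=
  @BasedCat K nat (fun d => 'I_d)
    (fun d e => {linear {malg K['I_d]} -> {malg K['I_e]}}) (fun d e h => h).

Definition schur (la : intpart) : functor Vec :=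
  specht_hom (full_subfunctor (tensor_power Vec (sumn la))).

(* The Littlewood-Richardson coefficient: the multiplicity of S_la in
   S_al ⊗ S_be. This tensor product has finite length, so that the default
   value 0 of xget is not used. *)
Definition LR (la al be : intpart) : nat :=
  xget 0%N [set m | multiplicity (tensor (schur al) (schur be)) (schur la) m].

End LittlewoodRichardson.

Section Orthogonal.
Variable K : fieldType.
Notation V := {malg K[nat]}.

(* With the basis e_1, e_2, ... of V, << i >> is e_(i+1); the sum has finite
   support. *)
Definition omega (x y : V) : K :=
  \sum_(k \in [set: nat]) (x@_k.*2 * y@_k.*2.+1 + x@_k.*2.+1 * y@_k.*2).

Lemma omegaE N (x y : V) : (forall i, (N <= i)%N -> x@_i = 0) ->
  omega x y = \sum_(k < N) (x@_k.*2 * y@_k.*2.+1 + x@_k.*2.+1 * y@_k.*2).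
Proof.
move=> xN; rewrite /omega (fsbigTE [fset k in iota 0 N]%fset) => [|k kN].
  rewrite -(big_mkord xpredT
    (fun k => x@_k.*2 * y@_k.*2.+1 + x@_k.*2.+1 * y@_k.*2)) /index_iota subn0.
  apply: perm_big; rewrite uniq_perm ?iota_uniq ?enum_fset_uniq // => k.
  by rewrite inE.
have Nk : (N <= k)%N.
  by rewrite leqNgt; apply: contraNN kN => kN; rewrite inE /= mem_iota add0n.
have N2 : (N <= k.*2)%N by rewrite -addnn (leq_trans Nk) ?leq_addr.
by rewrite (xN _ N2) (xN _ (leqW N2)) !mul0r addr0.
Qed.

Lemma malg_bound (x : V) : exists N, forall i, (N <= i)%N -> x@_i = 0.
Proof.
exists (\max_(i <- msupp x) i).+1%N => i ib; apply: mcoeff_outdom.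
by apply: contraL ib => ix; rewrite -ltnNge ltnS (leq_bigmax_seq _ ix).
Qed.

Lemma omegaC x y : omega x y = omega y x.
Proof.
rewrite /omega; apply: eq_fsbigr => k _.
by rewrite addrC (mulrC x@_k.*2) (mulrC x@_k.*2.+1).
Qed.

Lemma omega_linearl (y : V) a x x' :
  omega (a *: x + x') y = a * omega x y + omega x' y.
Proof.
have [N xN] := malg_bound x; have [N' xN'] := malg_bound x'.
pose M := maxn N N'.
have xM i : (M <= i)%N -> x@_i = 0 by rewrite geq_max => /andP[/xN].
have xM' i : (M <= i)%N -> x'@_i = 0 by rewrite geq_max => /andP[_ /xN'].
rewrite (omegaE y xM) (omegaE y xM') (@omegaE M) => [|i Mi]; last first.
  by rewrite mcoeffD mcoeffZ xM // xM' // mulr0 addr0.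
rewrite mulr_sumr -big_split /=; apply: eq_bigr => k _.
by rewrite !mcoeffD !mcoeffZ !mulrDl mulrDr !mulrA addrACA.
Qed.

Lemma omega_linearr (y : V) a x x' :
  omega y (a *: x + x') = a * omega y x + omega y x'.
Proof. by rewrite !(omegaC y) omega_linearl. Qed.

(* Membership in the union of the GL(d). *)
Definition in_GLinf (g : {linear V -> V}) :=
  bijective g /\ exists d,
    (forall i, (d <= i)%N -> g << i >> = << i >>) /\
    (forall i j, (i < d)%N -> (d <= j)%N -> (g << i >>)@_j = 0).

Record Oinf := OinfElt {
  oinf_map : {linear V -> V};
  oinf_GLinf : in_GLinf oinf_map;
  oinf_omega : forall x y, omega (oinf_map x) (oinf_map y) = omega x y }.

(* The group O(oo) acting on V, as a category with one object; the objects of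
   Rep(O) are among the functors on it. *)
Definition Ocat : basedCat K :=
  @BasedCat K unit (fun _ => nat) (fun _ _ => Oinf) (fun _ _ g => oinf_map g).

Section Contraction.
Variables (n : nat) (p : 'I_n.+2) (q : 'I_n.+1).

(* omega applied to the distinct tensor factors p and lift p q *)
Definition contract : tpow K nat n.+2 -> tpow K nat n :=
  lext (fun i : {ffun 'I_n.+2 -> nat} =>
    omega << i p >> << i (lift p q) >> *:
      (<< [ffun k => i (lift p (lift q k))] >> : tpow K nat n)).

HB.instance Definition _ := GRing.Linear.copy contract
  (lext (fun i : {ffun 'I_n.+2 -> nat} =>
    omega << i p >> << i (lift p q) >> *:
      (<< [ffun k => i (lift p (lift q k))] >> : tpow K nat n))).

Lemma contractU i : contract << i >> =
  omega << i p >> << i (lift p q) >> *: << [ffun k => i (lift p (lift q k))] >>.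
Proof. exact: lextU. Qed.

Lemma contract_tens (v : 'I_n.+2 -> V) : contract (tens v) =
  omega (v p) (v (lift p q)) *: tens (fun k => v (lift p (lift q k))).
Proof.
move: v; apply: multilinear_eq => [v k a x y|v k a x y|i].
- by rewrite tens_multilinear linearP.
- case: (unliftP p k) => [k' ->|->]; last first.
    have pE z : upd v p z p = z by rewrite /upd eqxx.
    have lE z l : upd v p z (lift p l) = v (lift p l).
      by rewrite /upd eq_sym (negPf (neq_lift _ _)).
    have tE z : (fun k => upd v p z (lift p (lift q k))) =
                (fun k => v (lift p (lift q k))).
      by apply/funext => l; rewrite lE.
    by rewrite !pE !lE !tE omega_linearl scalerDl scalerA.
  have pE z : upd v (lift p k') z p = v p.
    by rewrite /upd (negPf (neq_lift _ _)).
  case: (unliftP q k') => [k'' ->|->]; last first.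
    have qE z : upd v (lift p q) z (lift p q) = z by rewrite /upd eqxx.
    have tE z : (fun k => upd v (lift p q) z (lift p (lift q k))) =
                (fun k => v (lift p (lift q k))).
      apply/funext => l; rewrite /upd (inj_eq lift_inj) eq_sym.
      by rewrite (negPf (neq_lift _ _)).
    have pE' z : upd v (lift p q) z p = v p.
      by rewrite /upd (negPf (neq_lift _ _)).
    by rewrite !pE' !qE !tE omega_linearr scalerDl scalerA.
  pose w k := v (lift p (lift q k)).
  have pE' z : upd v (lift p (lift q k'')) z p = v p.
    by rewrite /upd (negPf (neq_lift _ _)).
  have qE z : upd v (lift p (lift q k'')) z (lift p q) = v (lift p q).
    by rewrite /upd (inj_eq lift_inj) (negPf (neq_lift _ _)).
  have tE z : (fun k => upd v (lift p (lift q k'')) z (lift p (lift q k))) =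
              upd w k'' z.
    by apply/funext => l; rewrite /upd !(inj_eq lift_inj).
  rewrite !pE' !qE !tE tens_multilinear scalerDr !scalerA.
  by rewrite mulrC.
- rewrite tensU contractU tensU !ffunE; congr (_ *: << _ >>).
  by apply/ffunP => k; rewrite !ffunE.
Qed.

Lemma contract_tmap (g : Oinf) x :
  contract (tmap (oinf_map g) x) = tmap (oinf_map g) (contract x).
Proof.
move: x; apply: (@malg_linear_eq K _ _ (contract \o @tmap K _ _ (oinf_map g) n.+2)
  (@tmap K _ _ (oinf_map g) n \o contract)) => i /=.
rewrite tmapU contract_tens oinf_omega contractU linearZ /= tmapU.
by congr (_ *: tens _); apply/funext => k; rewrite ffunE.
Qed.

End Contraction.

(* T_[n] *)
Definition traceless_pred (n : nat) : {pred tpow K nat n} :=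
  match n return {pred tpow K nat n} with
  | m.+2 => fun x => [forall p, forall q, contract p q x == 0]
  | _ => fun _ => true
  end.

Lemma traceless_predP n (x : tpow K nat n.+2) :
  reflect (forall p q, contract p q x = 0) (x \in @traceless_pred n.+2).
Proof.
apply: (iffP forallP) => x0 p; last by apply/forallP => q; apply/eqP.
by move=> q; apply/eqP; move: q; apply/forallP.
Qed.

Fact traceless_closed n : submod_closed (@traceless_pred n).
Proof.
case: n => [|[|n]]; [by split| by split|].
split=> [|a x y /traceless_predP x0 /traceless_predP y0].
  by apply/traceless_predP => p q; rewrite linear0.
by apply/traceless_predP => p q; rewrite linearP /= x0 y0 scaler0 addr0.
Qed.

HB.instance Definition _ n := GRing.isSubmodClosed.Build K (tpow K nat n)
  (@traceless_pred n) (@traceless_closed n).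

Fact traceless_stable n (g : Oinf) (x : tpow K nat n) :
  x \in @traceless_pred n -> tmap (oinf_map g) x \in @traceless_pred n.
Proof.
case: n x => [|[|n]] x; [by move=> _; exact: isT|by move=> _; exact: isT|].
move=> /traceless_predP x0; apply/traceless_predP => p q.
by rewrite contract_tmap x0 (linear0 (@tmap K nat nat (oinf_map g) n)).
Qed.

Definition traceless (n : nat) : subfunctor (tensor_power Ocat n) :=
  @Subfunctor K Ocat (tensor_power Ocat n) (fun _ => @traceless_pred n)
    (fun _ _ g x => @traceless_stable n g x).

(* V_la *)
Definition Osimple (la : intpart) : functor Ocat := specht_hom (traceless (sumn la)).

Fixpoint dsum_powers (s : seq nat) : functor Ocat :=
  if s is n :: s' then dsum (tensor_power Ocat n) (dsum_powers s')
  else zero_functor Ocat.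

(* The objects of Rep(O): subquotients B / A of finite direct sums of tensor
   powers of V. This class is closed under subobjects and quotients, so
   composition series in Rep(O) are composition series of representations. *)
Definition in_RepO (F : functor Ocat) :=
  exists s (A B : subfunctor (dsum_powers s)), sfle A B /\ factor_iso A B F.

Definition RepO_multiplicity (F G : functor Ocat) (m : nat) :=
  [/\ in_RepO F, in_RepO G & multiplicity F G m].

End Orthogonal.

(* Main.v *)
(* V_nu is realised in the tensor power T_N, N = |nu|, as the traceless tensors
   fixed by the Young idempotent of nu. V_la (x) V_mu embeds in T_(n+m) and is
   filtered by the kernels of the contractions of k pairs made of a left and a
   right tensor factor; on the k-th layer these contractions take traceless
   values in T_(n+m-2k). Two facts about traceless tensors give the
   multiplicities without Jordan-Hoelder or semisimplicity: the group
   polarizes, i.e. some combination of its elements maps a tensor to the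
   multilinear tensor in fresh isotropic letters carrying prescribed
   coefficients, and a subrepresentation is recovered from these multilinear
   tensors (a Casimir element of Lie O(oo) turns letters into fresh ones). So
   the multiplicity of V_nu is the dimension of a space of functions on
   symmetric groups, and by a trace computation it equals, with p = n - k and
   q = m - k,
     1/(p! k! q!) sum_(a, b, c) chi_la(a x b) chi_mu(c x b) chi_nu(a x c)
   over a in S_p, b in S_k, c in S_q. The same method for polynomial functors
   expresses the Littlewood-Richardson coefficients by characters, and the
   completeness of the characters of the symmetric groups identifies the two
   sides. *)
From HB Require Import structures.
Require Import Defs.
From mathcomp Require Import all_boot all_order all_fingroup all_algebra.
From mathcomp Require Import boolp zify ring.

Set Implicit Arguments.
Unset Strict Implicit.
Unset Printing Implicit Defensive.

Import GRing.Theory.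

Local Open Scope ring_scope.

(** * Traces and group algebras *)

(** Tensors multilinear in n distinct letters form a copy of the group algebra A of S_n:
    permutations of the positions act on the left, permutations of the letters on the right. The
    Young idempotent e of nu, acting on the left, cuts out V_nu, whose multilinear part is eA;
    requiring invariance under e on the right as well leaves eAe, which is a line. Hence the space
    of right e-fixed multilinear vectors grows by one dimension at each factor V_nu and stays the
    same at every other factor, along any composition series. A layer is detected only by all its
    contractions together, so these vectors are families indexed by a finite set J, and a tensor has
    to be recovered from all members of the family at once. Layers of different degrees do not
    interfere, because polarization in degree n annihilates the tensor powers of lower degree. The
    conditions on the families are invariance under idempotents and under a finite group, so the
    dimension is read off from the trace of an averaging operator in the basis of permutations; this
    is the origin of the characters. *)

Lemma vspace_of_pred (K : fieldType) (V : vectType K) (W : V -> Prop) :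
  W 0 -> (forall a x y, W x -> W y -> W (a *: x + y)) ->
  exists U : {vspace V}, forall v, (v \in U) <-> W v.
Proof.
move=> W0 WD.
(* A subspace of largest dimension inside [W] contains every vector of [W]: otherwise adding the
   line of that vector would enlarge it. *)
pose P (d : nat) := `[< exists U : {vspace V}, \dim U = d /\ forall v, v \in U -> W v >].
have exP : exists d, P d.
  exists 0%N; apply/asboolP; exists 0%VS; rewrite dimv0; split=> // v.
  by rewrite memv0 => /eqP ->.
have ubP d : P d -> (d <= \dim {:V})%N.
  by move=> /asboolP[U [<- _]]; apply/dimvS/subvf.
case: (ex_maxnP exP ubP) => d /asboolP[U [dU UW]] dmax.
exists U => v; split; first exact: UW.
move=> Wv; apply: contraT => vU.
have : P (\dim (U + <[v]>)).
  apply/asboolP; exists (U + <[v]>)%VS; split=> // x /memv_addP[u uU [w /vlineP[a ->] ->]].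
  by rewrite addrC; apply: WD => //; apply: UW.
move/dmax; rewrite -dU => le.
have sU : (U <= U + <[v]>)%VS by exact: addvSl.
have /eqP eU : U == (U + <[v]>)%VS.
  by rewrite -(geq_leqif (dimv_leqif_eq sU)).
have vUv : v \in (U + <[v]>)%VS by apply: (subvP (addvSr _ _)); apply: memv_line.
by rewrite eU vUv in vU.
Qed.

Section Trace.
Variables (K : fieldType) (T : finType).
Notation V := {ffun T -> K^o}.

Definition fdelta (t : T) : V := [ffun u => (u == t)%:R].

Lemma fdelta_sum (v : V) : v = \sum_t v t *: fdelta t.
Proof.
apply/ffunP => u; rewrite sum_ffunE (bigD1 u) //= big1 => [|t tu].
  by rewrite !ffunE eqxx addr0 /GRing.scale /= mulr1.
by rewrite !ffunE eq_sym (negPf tu) scaler0.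
Qed.

(** [B] factors as V -> [U] -> V, and the trace of this composite is that of the opposite one on
    [U], which is multiplication by [a]. In this form dimensions of fixed spaces become sums over
    permutations. *)
Lemma trace_dim (U : {vspace V}) (B : V -> V) (a : K) :
  linear B -> (forall v, B v \in U) -> (forall v, v \in U -> B v = a *: v) ->
  \sum_t B (fdelta t) t = a * (\dim U)%:R.
Proof.
move=> linB BU Bid.
pose f := HB.pack_for {linear V -> V} B (GRing.isLinear.Build K V V *:%R B linB).
pose X := vbasis U.
have XU i : X`_i \in U.
  case: (ltnP i (size X)) => hi; last by rewrite nth_default ?mem0v.
  exact/vbasis_mem/mem_nth.
have -> : \sum_t B (fdelta t) t = \sum_(i < \dim U) \sum_t coord X i (B (fdelta t)) * X`_i t.
  rewrite exchange_big; apply: eq_bigr => t _.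
  by rewrite {1}(coord_vbasis (BU (fdelta t))) sum_ffunE; apply: eq_bigr => i _; rewrite ffunE.
rewrite (eq_bigr (fun=> a)) ?sumr_const ?card_ord ?mulr_natr // => i _.
have -> : \sum_t coord X i (B (fdelta t)) * X`_i t = coord X i (f (\sum_t X`_i t *: fdelta t)).
  by rewrite !linear_sum; apply: eq_bigr => t _; rewrite !linearZ /= mulrC.
rewrite -fdelta_sum /= Bid // linearZ /= coord_free ?eqxx ?[_ *: _]mulr1 //.
  by rewrite mulr1.
exact: (basis_free (vbasisP U)).
Qed.

End Trace.

Section GroupAlgebra.
Variables (K : fieldType) (n : nat).
Notation A := {ffun 'S_n -> K^o}.
Implicit Types (x y z : A) (s t : 'S_n).

Definition gm x y : A := [ffun t => \sum_(s : 'S_n) x s * y (s^-1 * t)%g].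

Lemma gm_linearl y : linear (fun x => gm x y).
Proof.
move=> a u v; apply/ffunP => t; rewrite !ffunE scaler_sumr -big_split /=.
by apply: eq_bigr => s _; rewrite !ffunE mulrDl -mulrA.
Qed.

Lemma gm_linearr x : linear (gm x).
Proof.
move=> a u v; apply/ffunP => t; rewrite !ffunE scaler_sumr -big_split /=.
by apply: eq_bigr => s _; rewrite !ffunE mulrDr mulrCA.
Qed.

Lemma gm_deltal s y t : gm (fdelta K s) y t = y (s^-1 * t)%g.
Proof.
rewrite ffunE (bigD1 s) //= ffunE eqxx mul1r big1 ?addr0 // => u us.
by rewrite ffunE (negPf us) mul0r.
Qed.

Lemma gm_deltar s x t : gm x (fdelta K s) t = x (t * s^-1)%g.
Proof.
rewrite ffunE (bigD1 (t * s^-1)%g) //= ffunE invMg invgK mulgKV eqxx mulr1.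
rewrite big1 ?addr0 // => u /eqP us; rewrite ffunE.
by case: eqP => [us'|]; rewrite ?mulr0 //; case: us; rewrite -us' invMg invgK mulKVg.
Qed.

Lemma gm_delta s t : gm (fdelta K s) (fdelta K t) = fdelta K (s * t)%g.
Proof.
apply/ffunP => u; rewrite gm_deltal !ffunE; congr ((nat_of_bool _)%:R).
by apply/eqP/eqP => [<-|->]; rewrite ?mulKVg ?mulKg.
Qed.

Lemma gmA x y z : gm x (gm y z) = gm (gm x y) z.
Proof.
apply/ffunP => t; rewrite !ffunE.
under eq_bigr do rewrite ffunE mulr_sumr.
under [RHS]eq_bigr do rewrite ffunE mulr_suml.
rewrite [RHS]exchange_big /=; apply: eq_bigr => s _.
rewrite [RHS](reindex_inj (mulgI s)) /=; apply: eq_bigr => u _.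
by rewrite mulKg invMg -!mulgA mulrA.
Qed.

Lemma gm1l x : gm (fdelta K 1%g) x = x.
Proof. by apply/ffunP => t; rewrite gm_deltal invg1 mul1g. Qed.

Lemma gm1r x : gm x (fdelta K 1%g) = x.
Proof. by apply/ffunP => t; rewrite gm_deltar invg1 mulg1. Qed.

Lemma gmZl a x y : gm (a *: x) y = a *: gm x y.
Proof. by have := gm_linearl y a x 0; rewrite addr0 => ->; rewrite -[RHS]addr0; congr (_ + _); apply/ffunP => t; rewrite ffunE big1 ?ffunE // => s _; rewrite ffunE mul0r. Qed.

Lemma gmZr a x y : gm x (a *: y) = a *: gm x y.
Proof. by have := gm_linearr x a y 0; rewrite addr0 => ->; rewrite -[RHS]addr0; congr (_ + _); apply/ffunP => t; rewrite ffunE big1 ?ffunE // => s _; rewrite ffunE mulr0. Qed.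

Lemma gm0l y : gm 0 y = 0 :> A.
Proof. by rewrite -[X in gm X](scale0r 0) gmZl scale0r. Qed.

Lemma gm0r x : gm x 0 = 0 :> A.
Proof. by rewrite -[X in gm _ X](scale0r 0) gmZr scale0r. Qed.

Lemma gm_suml I (r : seq I) (P : pred I) (F : I -> A) y :
  gm (\sum_(i <- r | P i) F i) y = \sum_(i <- r | P i) gm (F i) y.
Proof.
elim/big_rec2: _ => [|i u v _ <-]; first exact: gm0l.
by have := gm_linearl y 1 (F i) v; rewrite !scale1r.
Qed.

Lemma gm_sumr I (r : seq I) (P : pred I) (F : I -> A) x :
  gm x (\sum_(i <- r | P i) F i) = \sum_(i <- r | P i) gm x (F i).
Proof.
elim/big_rec2: _ => [|i u v _ <-]; first exact: gm0r.
by have := gm_linearr x 1 (F i) v; rewrite !scale1r.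
Qed.

Lemma gm_expand x y : gm x y = \sum_s x s *: gm (fdelta K s) y.
Proof. by rewrite {1}(fdelta_sum x) gm_suml; apply: eq_bigr => s _; rewrite gmZl. Qed.

Lemma gm_expandr x y : gm x y = \sum_s y s *: gm x (fdelta K s).
Proof. by rewrite {1}(fdelta_sum y) gm_sumr; apply: eq_bigr => s _; rewrite gmZr. Qed.

Lemma gm_tr x y : gm x y 1%g = gm y x 1%g.
Proof.
rewrite !ffunE (reindex_inj invg_inj) /=; apply: eq_bigr => s _.
by rewrite !mulg1 invgK mulrC.
Qed.

(** For an idempotent [y] this is the trace of v |-> s^-1 v y, hence the character at s^-1 of the
    left ideal generated by [y]. *)
Definition chi y s : K := \sum_(u : 'S_n) y (u^-1 * s * u)%g.

Lemma chiJ y s t : chi y (t^-1 * s * t)%g = chi y s.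
Proof.
rewrite /chi [RHS](reindex_inj (mulgI t)) /=; apply: eq_bigr => u _.
by rewrite invMg !mulgA.
Qed.

Lemma trace_gm x y :
  \sum_s gm (gm x (fdelta K s)) y s = \sum_s x s * chi y s^-1%g.
Proof.
transitivity (\sum_s \sum_u x u * y (s^-1 * u^-1 * s)%g).
  apply: eq_bigr => s _; rewrite ffunE (reindex_inj (mulIg s)) /=.
  by apply: eq_bigr => u _; rewrite gm_deltar mulgK invMg.
by rewrite exchange_big; apply: eq_bigr => u _; rewrite /chi mulr_sumr.
Qed.

(** A class function pairs equally with all conjugates of [x], and [chi x] is the sum of these n!
    conjugates. *)
Lemma chi_pairing (f : 'S_n -> K) x : (forall s t, f (t^-1 * s * t)%g = f s) ->
  n`!%:R * (\sum_s x s * f s^-1%g) = \sum_s chi x s * f s^-1%g.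
Proof.
move=> fJ; under [RHS]eq_bigr do rewrite mulr_suml; rewrite exchange_big /=.
transitivity (\sum_(t : 'S_n) \sum_s x s * f s^-1%g).
  by rewrite sumr_const mulr_natl -card_Sn; congr (_ *+ _); apply: eq_card.
apply: eq_bigr => t _; rewrite (reindex_inj (conjg_inj t)) /=.
by apply: eq_bigr => s _; rewrite -(fJ s^-1%g t) -conjVg /conjg !mulgA.
Qed.

End GroupAlgebra.

(** * Young symmetrizers and characters *)

(** The counts are the column lengths of the diagram; the difference of two consecutive ones is the
    multiplicity of a part. *)
Lemma intpart_eq_count (la mu : intpart) :
  (forall j, count (fun v => (j < v)%N) la = count (fun v => (j < v)%N) mu) ->
  la = mu.
Proof.
case: la mu => [la pla] [mu pmu] /= cE.
have /andP[sla nla] := pla; have /andP[smu nmu] := pmu.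
apply: val_inj => /=; apply: (@sorted_eq _ geq) => //=.
- by move=> x y z /= xy yz; apply: leq_trans xy.
- by move=> x y /andP[xy yx]; apply/anti_leq/andP; split.
apply/allP => /= v _; apply/eqP; case: v => [|v].
  by rewrite (count_memPn nla) (count_memPn nmu).
have E s : count (fun w => (v < w)%N) s = (count_mem v.+1 s + count (fun w => (v.+1 < w)%N) s)%N.
  by elim: s => //= w s ->; case: (ltngtP v.+1 w) => /=; lia.
by have := cE v; rewrite !E cE => /addIn.
Qed.

(** Induction removing an element of largest value. As the values are distinct, the largest is at
    least the number of remaining elements; equality of the sums makes it equal to that number,
    which then bounds all values. *)
Lemma sum_inj_ge (T : finType) (R : {set T}) (g : T -> nat) :
  {in R &, injective g} ->
  (\sum_(j < #|R|) j <= \sum_(k in R) g k)%N /\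
  (\sum_(j < #|R|) j = \sum_(k in R) g k -> forall k, k \in R -> g k < #|R|)%N.
Proof.
move: {2}#|R| (erefl #|R|) => m; elim: m R => [|m IH] R cR gI.
  by rewrite cR big_ord0; split=> // _ k kR; move: (card0_eq cR k); rewrite kR.
have [k0 k0R] : exists k0, k0 \in R by apply/card_gt0P; rewrite cR.
case: (arg_maxnP g k0R) => k1 k1R0 kmax.
have k1R : k1 \in R by exact: k1R0.
have cR' : #|R :\ k1| = m by move: cR; rewrite (cardsD1 k1) k1R; case.
have gI' : {in R :\ k1 &, injective g}.
  by move=> x y /setD1P[_ xR] /setD1P[_ yR]; apply: gI.
have [le1 _] := IH _ cR' gI'.
have gm : (m <= g k1)%N.
  pose f (k : T) : 'I_(g k1).+1 := inord (g k).
  have fI : {in R &, injective f}.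
    move=> x y xR yR /(congr1 val) /=.
    rewrite (inordK (m := g x)) ?ltnS; last exact: kmax.
    by rewrite (inordK (m := g y)) ?ltnS; [apply: gI | apply: kmax].
  rewrite -ltnS; have := card_in_imset fI; rewrite cR => <-; rewrite -[X in (_ <= X)%N](card_ord (g k1).+1); apply: max_card.
rewrite cR big_ord_recr /= (big_setD1 k1) //=; rewrite cR' in le1; move: le1; set a := (\sum_(i < m) i)%N; set b := (\sum_(i in R :\ k1) g i)%N => le1; split; first lia.
move=> eq k kR; have : (g k <= g k1)%N by apply: kmax.
lia.
Qed.

Lemma sum_inj_eq (T : finType) (R : {set T}) (g : T -> nat) :
  {in R &, injective g} -> (forall k, k \in R -> g k < #|R|)%N ->
  (\sum_(k in R) g k = \sum_(j < #|R|) j)%N.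
Proof.
move=> gI glt; pose s := [seq g k | k <- enum R].
have sU : uniq s.
  rewrite map_inj_in_uniq ?enum_uniq // => x y; rewrite !mem_enum; exact: gI.
have ss : {subset s <= iota 0 #|R|}.
  by move=> _ /mapP[k kR ->]; rewrite mem_iota /= glt // -mem_enum.
have [|_ sE] := uniq_min_size sU ss; first by rewrite size_iota size_map cardE.
rewrite -(big_mkord xpredT (fun j => j)) /index_iota subn0.
rewrite -(perm_big _ (uniq_perm sU (iota_uniq _ _) sE)).
by rewrite big_map big_enum.
Qed.

(** * Rows and columns of Young diagrams *)

Section Numbering.
Variables (n : nat).
Implicit Types (la mu : intpart).

Definition boxrow la (k : 'I_n) : nat := reshape_index la k.
Definition boxcol la (k : 'I_n) : nat := reshape_offset la k.

Lemma box_in la k : n = sumn la -> (boxcol la k < nth 0 la (boxrow la k))%N.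
Proof. by move=> nE; apply: reshape_offsetP; rewrite -nE. Qed.

Lemma boxrow_lt la k : n = sumn la -> (boxrow la k < size la)%N.
Proof. by move=> nE; apply: reshape_indexP; rewrite -nE. Qed.

Lemma box_inj la k l : boxrow la k = boxrow la l -> boxcol la k = boxcol la l -> k = l.
Proof.
move=> rE cE; apply: val_inj => /=.
rewrite -[LHS](reshape_indexK la) -[RHS](reshape_indexK la).
by rewrite -![reshape_index _ _]/(boxrow la _) -![reshape_offset _ _]/(boxcol la _) rE cE.
Qed.

Lemma box_surj la i j : n = sumn la -> (j < nth 0 la i)%N ->
  exists2 k, boxrow la k = i & boxcol la k = j.
Proof.
move=> nE ij; have lt := flatten_indexP ij; rewrite -nE in lt.
exists (Ordinal lt); first exact: flatten_indexKl.
exact: flatten_indexKr.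
Qed.

Lemma card_row la i : n = sumn la -> #|[set k | boxrow la k == i]| = nth 0%N la i.
Proof.
move=> nE; rewrite -[RHS]card_ord.
pose f (k : 'I_n) : option 'I_(nth 0 la i) := insub (boxcol la k).
transitivity #|[set f k | k in [set k | boxrow la k == i]]|.
  rewrite card_in_imset //.
  move=> k l; rewrite !inE => /eqP ki /eqP li; rewrite /f.
  have := box_in k nE; rewrite ki => hk; have := box_in l nE; rewrite li => hl.
  by rewrite !insubT => -[]; apply: box_inj; rewrite ki.
rewrite -[RHS](card_imset predT (@Some_inj _)).
apply: eq_card => o; apply/imsetP/imsetP => [[k]|[j _ ->]].
  rewrite !inE => /eqP ki ->; have := box_in k nE; rewrite ki => hk.
  by exists (Ordinal hk) => //; rewrite /f insubT.
have [k kr kc] := box_surj nE (ltn_ord j).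
by exists k; rewrite ?inE ?kr // /f kc valK.
Qed.

(** When this fails, two boxes of one row of [la] are sent to one column of [mu], and their
    transposition shows that the product of the row and column symmetrizers around [x] vanishes. *)
Definition cross_inj la mu (x : 'S_n) :=
  forall k l, boxrow la k = boxrow la l -> boxcol mu (x k) = boxcol mu (x l) -> k = l.

(** The sum of the column indices plays the part of the dominance order. In a row of length r the
    boxes of [la] have column indices 0, ..., r - 1, the least sum of r distinct numbers, while [x]
    sends them to distinct columns of [mu]. *)
Lemma sum_col_le la mu x : n = sumn la -> cross_inj la mu x ->
  (\sum_k boxcol la k <= \sum_k boxcol mu k)%N /\
  (\sum_k boxcol la k = \sum_k boxcol mu k ->
     forall k, boxcol mu (x k) < nth 0 la (boxrow la k))%N.
Proof.
move=> nE xI.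
pose rw k : 'I_(size la) := Ordinal (boxrow_lt k nE).
have splitE F : (\sum_k F k = \sum_(i < size la) \sum_(k in [set k | boxrow la k == i]) F k)%N.
  rewrite (partition_big rw xpredT) //=; apply: eq_bigr => i _.
  by apply: eq_bigl => k; rewrite inE -val_eqE.
have sub F i : {in [set k | boxrow la k == i] &, injective F} ->
    (\sum_(j < nth 0%N la i) j <= \sum_(k in [set k | boxrow la k == i]) F k)%N /\
    (\sum_(j < nth 0%N la i) j = \sum_(k in [set k | boxrow la k == i]) F k ->
     forall k, boxrow la k = i -> F k < nth 0%N la i)%N.
  move=> /sum_inj_ge; rewrite card_row // => -[le eq]; split=> // /eq h k ki.
  by apply: h; rewrite inE ki.
have gE i : (\sum_(k in [set k | boxrow la k == i]) boxcol la k = \sum_(j < nth 0%N la i) j)%N.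
  rewrite -card_row //; apply: sum_inj_eq => [k l|k]; rewrite !inE.
    by move=> /eqP ki /eqP li; apply: box_inj; rewrite ki.
  by rewrite card_row // => /eqP <-; apply: box_in.
have gI i : {in [set k | boxrow la k == i] &, injective (fun k => boxcol mu (x k))}.
  by move=> k l; rewrite !inE => /eqP ki /eqP li; apply: xI; rewrite ki.
have mE : (\sum_k boxcol mu k = \sum_k boxcol mu (x k))%N by apply: reindex_inj; apply: perm_inj.
have le : forall i : 'I_(size la), true ->
    (\sum_(k in [set k | boxrow la k == i]) boxcol la k <= \sum_(k in [set k | boxrow la k == i]) boxcol mu (x k)
     ?= iff (\sum_(k in [set k | boxrow la k == i]) boxcol la k == \sum_(k in [set k | boxrow la k == i]) boxcol mu (x k)))%N.
  by move=> i _; apply: leqif_eq; rewrite gE; apply: (sub _ _ (gI i)).1.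
have [tot eqv] := leqif_sum le.
rewrite mE [X in (X <= _)%N](splitE (boxcol la)) [X in (_ <= X)%N](splitE (fun k => boxcol mu (x k))).
split=> // /eqP; rewrite (splitE (boxcol la)) (splitE (fun k => boxcol mu (x k))) eqv => /forallP h k.
by apply: (sub _ _ (gI _)).2 => //; rewrite -gE; apply/eqP/(h (rw k)).
Qed.

Lemma count_nthE la j :
  count (fun v => j < v)%N la = #|[set i : 'I_(size la) | (j < nth 0 la i)%N]|.
Proof.
by rewrite -sum1_count (big_nth 0%N) big_mkord sum1_card; apply: eq_card => i; rewrite inE.
Qed.

Lemma count_col_le la (g : 'I_n -> nat) j : n = sumn la ->
  (forall k l, boxrow la k = boxrow la l -> g k = g l -> k = l) ->
  (forall k, g k < nth 0 la (boxrow la k))%N ->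
  (#|[set k | g k == j]| <= count (fun v => j < v)%N la)%N.
Proof.
move=> nE gI glt; pose rw k : 'I_(size la) := Ordinal (boxrow_lt k nE).
rewrite count_nthE -(@card_in_imset _ _ rw) => [|k l]; last first.
  by rewrite !inE => /eqP kj /eqP lj /(congr1 val) /= h; apply: gI => //; rewrite kj.
apply/subset_leq_card/subsetP => i /imsetP[k]; rewrite !inE => /eqP <- -> /=.
exact: glt.
Qed.

Lemma count_col_ge la j : n = sumn la ->
  (count (fun v => j < v)%N la <= #|[set k | boxcol la k == j]|)%N.
Proof.
move=> nE; pose rw k : 'I_(size la) := Ordinal (boxrow_lt k nE).
rewrite count_nthE; apply: leq_trans (leq_imset_card rw _).
apply/subset_leq_card/subsetP => i; rewrite inE => /(box_surj nE)[k ki kj].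
by apply/imsetP; exists k; rewrite ?inE ?kj //; apply: val_inj; rewrite /= ki.
Qed.

(** The inequalities of [sum_col_le] in both directions are equalities, so each permutation keeps
    the boxes of a row within the width of that row. Counting boxes column by column then bounds the
    column lengths of each diagram by those of the other. *)
Lemma cross_inj_eq la mu x y : n = sumn la -> n = sumn mu ->
  cross_inj la mu x -> cross_inj mu la y -> la = mu.
Proof.
move=> nla nmu xI yI; have [le1 eq1] := sum_col_le nla xI.
have [le2 eq2] := sum_col_le nmu yI.
have sE : (\sum_k boxcol la k = \sum_k boxcol mu k)%N by apply/anti_leq/andP.
have aux (l m : intpart) (z : 'S_n) j : n = sumn l -> n = sumn m -> cross_inj l m z ->
    (forall k, boxcol m (z k) < nth 0 l (boxrow l k))%N ->
    (count (fun v => j < v)%N m <= count (fun v => j < v)%N l)%N.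
  move=> nl nm zI zlt; apply: leq_trans (count_col_ge j nm) _.
  apply: leq_trans (count_col_le j nl zI zlt).
  rewrite -(card_preimset _ (@perm_inj _ z)); apply: subset_leq_card.
  by apply/subsetP => k; rewrite !inE.
apply: intpart_eq_count => j; apply/anti_leq/andP; split.
  exact: (aux _ _ y _ nmu nla yI (eq2 (esym sE))).
exact: (aux _ _ x _ nla nmu xI (eq1 sE)).
Qed.

(** The equality case of [sum_col_le] provides a box in the row of k and the column of x k; moving k
    to this box is the row permutation p. *)
Lemma cross_inj_factor la x : n = sumn la -> cross_inj la la x ->
  exists p q : 'S_n, [/\ x = (p * q)%g, (forall k, boxrow la (p k) = boxrow la k) &
    forall k, boxcol la (q k) = boxcol la k].
Proof.
move=> nE xI; have [_ /(_ erefl) xlt] := sum_col_le nE xI.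
have /fin_all_exists2[f fr fc] : forall k, exists2 l, boxrow la l = boxrow la k & boxcol la l = boxcol la (x k).
  by move=> k; apply: box_surj.
have fI : injective f by move=> k l E; apply: xI; [rewrite -(fr k) E fr | rewrite -(fc k) E fc].
exists (perm fI), ((perm fI)^-1 * x)%g; split=> [|k|k]; first by rewrite mulKVg.
  by rewrite permE fr.
by rewrite permM -{2}(permKV (perm fI) k) permE fc.
Qed.

End Numbering.

Section Symmetrizer.
Variables (K : fieldType) (K0 : [pchar K] =i pred0) (n : nat).
Notation A := {ffun 'S_n -> K^o}.
Implicit Types (la mu : intpart) (s t x : 'S_n).

Definition rowsym la : A :=
  [ffun s : 'S_n => [forall k : 'I_n, boxrow la (s k) == boxrow la k]%:R].

Definition colsym la : A :=
  [ffun s : 'S_n => if [forall k : 'I_n, boxcol la (s k) == boxcol la k]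
     then (-1) ^+ odd_perm s else 0].

Definition ysym la : A := gm (rowsym la) (colsym la).

Lemma rowsymM la s : (forall k, boxrow la (s k) = boxrow la k) ->
  gm (rowsym la) (fdelta K s) = rowsym la.
Proof.
move=> sr; apply/ffunP => t; rewrite gm_deltar !ffunE; congr ((nat_of_bool _)%:R).
have sr' k : boxrow la (s^-1%g k) = boxrow la k by rewrite -{2}(permKV s k) sr.
by apply/eq_forallb => k; rewrite permM sr'.
Qed.

Lemma colsymM la s : (forall k, boxcol la (s k) = boxcol la k) ->
  gm (fdelta K s) (colsym la) = (-1) ^+ odd_perm s *: colsym la.
Proof.
move=> sc; apply/ffunP => t; rewrite gm_deltal !ffunE.
have sc' k : boxcol la (s^-1%g k) = boxcol la k by rewrite -{2}(permKV s k) sc.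
have -> : [forall k, boxcol la ((s^-1 * t)%g k) == boxcol la k] = [forall k, boxcol la (t k) == boxcol la k].
  apply/forallP/forallP => h k.
    by have := h (s k); rewrite permM permK sc.
  by rewrite permM (eqP (h _)) sc'.
case: ifP => _; last by rewrite scaler0.
by rewrite odd_permM odd_permV signr_addb.
Qed.

(** The transposition of two offending boxes fixes the row symmetrizer, and its conjugate by [x]
    changes the sign of the column symmetrizer; the product equals its own opposite. *)
Lemma row_col_cross la mu x : ~ cross_inj la mu x ->
  gm (gm (rowsym la) (fdelta K x)) (colsym mu) = 0.
Proof.
move=> /existsNP[k /existsNP[l]] /not_implyP[rE /not_implyP[cE kl]].
pose t := tperm k l; set y := gm _ _.
have rt u : boxrow la (t u) = boxrow la u by rewrite /t; case: tpermP => // ->.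
have ct u : boxcol mu ((t ^ x)%g u) = boxcol mu u.
  by rewrite tpermJ; case: tpermP => // ->.
have : y = - y.
  rewrite {1}/y -(rowsymM rt) -!gmA [gm (fdelta _ t) _]gmA gm_delta conjgC.
  rewrite -gm_delta -[gm (gm _ _) (colsym mu)]gmA (colsymM ct) !gmZr gmA.
  by rewrite tpermJ odd_tperm (inj_eq perm_inj); move/eqP: kl => ->; rewrite expr1 scaleN1r.
move/eqP; rewrite -addr_eq0 -mulr2n -scaler_nat scaler_eq0.
by rewrite ((pcharf0P _).1 K0) /= => /eqP.
Qed.

(** Either the product vanishes, or [x] = p q and both factors are absorbed by the symmetrizers, up
    to the sign of q. *)
Lemma row_col_line la x : n = sumn la ->
  exists a, gm (gm (rowsym la) (fdelta K x)) (colsym la) = a *: ysym la.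
Proof.
move=> nE; have [xI|xI] := pselect (cross_inj la la x); last first.
  by exists 0; rewrite scale0r row_col_cross.
have [p [q [-> pr qc]]] := cross_inj_factor nE xI.
exists ((-1) ^+ odd_perm q).
by rewrite -gm_delta gmA rowsymM // -gmA colsymM // gmZr.
Qed.

Lemma ysym1 la : ysym la 1%g = 1.
Proof.
rewrite /ysym ffunE (bigD1 1%g) //= big1 => [|s s1]; last first.
  rewrite !ffunE mulg1; case: forallP => [rs|_]; last by rewrite mul0r.
  case: forallP => [cs|_]; last by rewrite mulr0.
  case/eqP: s1; apply/permP => k; rewrite perm1; apply: (@box_inj _ la).
    exact/eqP/rs.
  by have := cs (s k); rewrite permK => /eqP.
rewrite !ffunE mulg1 invg1 odd_perm1 addr0.
have -> : [forall k, boxrow la ((1%g : 'S_n) k) == boxrow la k] by apply/forallP => k; rewrite perm1.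
have -> : [forall k, boxcol la ((1%g : 'S_n) k) == boxcol la k] by apply/forallP => k; rewrite perm1.
by rewrite mul1r.
Qed.

Lemma ysym_line la (x : A) : n = sumn la ->
  exists a, gm (gm (ysym la) x) (ysym la) = a *: ysym la.
Proof.
move=> nE; pose y := gm (gm (colsym la) x) (rowsym la).
have -> : gm (gm (ysym la) x) (ysym la) = gm (gm (rowsym la) y) (colsym la).
  by rewrite /ysym /y !gmA.
have /choice[a aE] := fun s => row_col_line s nE.
exists (\sum_s y s * a s); rewrite (gm_expandr (rowsym la)) gm_suml scaler_suml.
by apply: eq_bigr => s _; rewrite gmZl aE scalerA.
Qed.

Lemma ysym_orth la mu (x : A) : (forall s, ~ cross_inj la mu s) ->
  gm (gm (ysym la) x) (ysym mu) = 0.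
Proof.
move=> noI; pose y := gm (gm (colsym la) x) (rowsym mu).
have -> : gm (gm (ysym la) x) (ysym mu) = gm (gm (rowsym la) y) (colsym mu).
  by rewrite /ysym /y !gmA.
rewrite (gm_expandr (rowsym la)) gm_suml big1 // => s _.
by rewrite gmZl row_col_cross ?scaler0.
Qed.

End Symmetrizer.

Section Idempotent.
Variables (K : fieldType) (K0 : [pchar K] =i pred0) (n : nat).
Notation A := {ffun 'S_n -> K^o}.
Implicit Types (la mu : intpart) (s t x : 'S_n).

Definition yscal la : K := gm (ysym K n la) (ysym K n la) 1%g.

Definition yidem la : A := (yscal la)^-1 *: ysym K n la.

Lemma natr_neq0 m : (0 < m)%N -> m%:R != 0 :> K.
Proof. by rewrite ((pcharf0P _).1 K0) lt0n. Qed.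

Lemma ysym_sq la : n = sumn la -> gm (ysym K n la) (ysym K n la) = yscal la *: ysym K n la.
Proof.
move=> nE; have [a] := ysym_line K0 (fdelta K 1%g) nE; rewrite gm1r => E.
by rewrite {1}E /yscal E ffunE ysym1 /GRing.scale /= mulr1.
Qed.

(** Right multiplication by the symmetrizer has trace n!, its coefficient at 1 being 1. It acts as
    the scalar [yscal la] on its image, so n! is [yscal la] times a dimension. *)
Lemma yscal_neq0 la : n = sumn la -> yscal la != 0.
Proof.
move=> nE; pose c := ysym K n la.
have [|a _ _ [x ->] [y ->]|U UE] := @vspace_of_pred K {ffun 'S_n -> K^o} (fun v => exists x : A, v = gm x c).
- by exists 0; rewrite gm0l.
- by exists (a *: x + y); rewrite gm_linearl.
have := @trace_dim K _ U (fun v => gm v c) (yscal la) _ _ _.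
rewrite (eq_bigr (fun=> 1)) => [|s _]; last by rewrite gm_deltal mulVg; apply: ysym1.
rewrite sumr_const => E; apply/eqP => k0; move: E; rewrite k0 mul0r => E.
suff : #|'S_n|%:R == 0 :> K by apply/negP/natr_neq0; rewrite card_Sn fact_gt0.
apply/eqP/E; first exact: gm_linearl.
  by move=> v; apply/UE; exists v.
by move=> v /UE[x ->]; rewrite -gmA ysym_sq // gmZr k0.
Qed.

Lemma yidem_neq0 la : n = sumn la -> yidem la != 0.
Proof.
move=> nE; apply/eqP => /ffunP/(_ 1%g); rewrite ffunE ysym1 [RHS]ffunE /GRing.scale /= mulr1.
by apply/eqP/invr_neq0/yscal_neq0.
Qed.

Lemma yidemK la : n = sumn la -> gm (yidem la) (yidem la) = yidem la.
Proof.
move=> nE; rewrite /yidem gmZl gmZr ysym_sq // [X in _ *: X]scalerA.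
by rewrite mulVf ?yscal_neq0 // scale1r.
Qed.

Lemma yidem_line la (x : A) : n = sumn la ->
  exists a, gm (gm (yidem la) x) (yidem la) = a *: yidem la.
Proof.
move=> nE; have [a E] := ysym_line K0 x nE.
by exists ((yscal la)^-1 * a); rewrite /yidem !(gmZl, gmZr) E !scalerA mulrAC.
Qed.

(** The sum is the trace of v |-> e_la v e_mu. For equal partitions this map projects onto the line
    of the idempotent. For distinct ones [cross_inj] has no solution in at least one of the two
    directions, and the pairing is symmetric, so it vanishes. *)
Lemma yidem_pairing la mu : n = sumn la -> n = sumn mu ->
  \sum_s yidem la s * chi (yidem mu) s^-1%g = (la == mu)%:R.
Proof.
move=> nla nmu; have sym (x y : A) : \sum_s x s * chi y s^-1%g = \sum_s y s * chi x s^-1%g.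
  have E (u v : A) : n`!%:R * \sum_s u s * chi v s^-1%g = \sum_s chi u s * chi v s^-1%g.
    by apply: chi_pairing => s t; apply: chiJ.
  apply: (mulfI (natr_neq0 (fact_gt0 n))); rewrite !E (reindex_inj invg_inj) /=.
  by apply: eq_bigr => s _; rewrite invgK mulrC.
have orth (l m : intpart) : (forall s : 'S_n, ~ cross_inj l m s) -> \sum_s yidem l s * chi (yidem m) s^-1%g = 0.
  move=> no; rewrite -trace_gm big1 // => s _.
  by rewrite /yidem !(gmZl, gmZr) ysym_orth // !scaler0 ffunE.
case: eqP => [->{la nla}|ne]; last first.
  have [[x xI]|no] := pselect (exists s : 'S_n, cross_inj la mu s); last first.
    by rewrite orth // => s sI; apply: no; exists s.
  rewrite sym orth // => y yI; exact/ne/(cross_inj_eq nla nmu xI yI).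
rewrite -trace_gm (@trace_dim K _ <[yidem mu : A]>%VS (fun v => gm (gm (yidem mu) v) (yidem mu)) 1).
- by rewrite dim_vline yidem_neq0 // mul1r.
- by move=> a u v; rewrite gm_linearr gm_linearl.
- by move=> v; have [a ->] := yidem_line v nmu; rewrite memvZ ?memv_line.
- by move=> v /vlineP[a ->]; rewrite scale1r (gmZr a) (gmZl a) !(yidemK nmu).
Qed.

End Idempotent.

(** * Conjugacy classes and cycle types *)

Section CycleType.
Variable n : nat.
Implicit Types s t : 'S_n.

Definition orbits_by_size s : seq {set 'I_n} :=
  sort (fun A B : {set 'I_n} => geq #|A| #|B|) (enum (porbits s)).

Definition orbit_sizes s : seq nat :=
  map (fun O : {set 'I_n} => #|O|) (orbits_by_size s).

Lemma mem_orbits s O : (O \in orbits_by_size s) = (O \in porbits s).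
Proof. by rewrite mem_sort mem_enum. Qed.

Fact orbit_sizes_subproof s : sorted geq (orbit_sizes s) && (0%N \notin orbit_sizes s).
Proof.
apply/andP; split.
  rewrite sorted_map; apply: sort_sorted => A B; exact: leq_total.
apply/mapP => -[O]; rewrite mem_orbits => /imsetP[x _ ->] /esym/eqP.
by rewrite (negPf (card_porbit_neq0 _ _)).
Qed.

Definition cycle_type s : intpart := IntPart (orbit_sizes_subproof s).

Lemma sumn_cycle_type s : sumn (cycle_type s) = n.
Proof.
have pP : partition (porbits s) [set: 'I_n].
  apply/and3P; split.
  - apply/eqP/setP => x; rewrite inE; apply/bigcupP; exists (porbit s x); last exact: porbit_id.
    exact: imset_f.
  - apply/trivIsetP => _ _ /imsetP[x _ ->] /imsetP[y _ ->] ne.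
    apply/pred0P => z /=; apply/negbTE; apply: contra ne => /andP[zx zy].
    rewrite eq_porbit_mem; move: zx zy; rewrite -!eq_porbit_mem => /eqP <- /eqP ->.
    by [].
  - by apply/imsetP => -[x _ E]; have := porbit_id s x; rewrite -E inE.
have := card_partition pP; rewrite cardsT card_ord => ->.
by rewrite sumnE big_map (perm_big _ (permEl (perm_sort _ _))) big_enum.
Qed.

Lemma cycle_type_conj s t : cycle_type s = cycle_type t -> exists u, t = (u^-1 * s * u)%g.
Proof.
move=> /(congr1 parts) /= szE.
have szL : size (orbits_by_size s) = size (orbits_by_size t).
  by rewrite -(size_map (fun O : {set 'I_n} => #|O|)) -/(orbit_sizes s) szE size_map.
have uL r : uniq (orbits_by_size r) by rewrite sort_uniq enum_uniq.
(* Orbits of [s] and [t] are matched by their rank in the lists sorted by size, hence have equal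
   sizes. *)
pose m O := nth set0 (orbits_by_size t) (index O (orbits_by_size s)).
have mP O : O \in porbits s -> m O \in porbits t /\ #|m O| = #|O|.
  rewrite -mem_orbits => Os; have lt := Os; rewrite -index_mem in lt.
  split; first by rewrite -mem_orbits mem_nth // -szL.
  rewrite /m -(nth_map set0 0%N (fun O : {set 'I_n} => #|O|)) -?szL //.
  by rewrite -/(orbit_sizes t) -szE (nth_map set0) // nth_index.
have mI O O' : O \in porbits s -> O' \in porbits s -> m O = m O' -> O = O'.
  rewrite -!mem_orbits => Os O's /eqP; rewrite nth_uniq -?szL ?index_mem // => /eqP.
  by move/(congr1 (nth set0 (orbits_by_size s))); rewrite !nth_index.
pose bs x := odflt x [pick y in porbit s x].
pose bt x := odflt x [pick y in m (porbit s x)].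
have bsP x : bs x \in porbit s x.
  by rewrite /bs; case: pickP => //= /(_ x); rewrite porbit_id.
have orb x : porbit s x \in porbits s by apply: imset_f.
have btP x : bt x \in m (porbit s x).
  rewrite /bt; case: pickP => //= h.
  by have [_] := mP _ (orb x); rewrite eq_card0 // => /esym/eqP; rewrite (negPf (card_porbit_neq0 _ _)).
have bs_eq x y : porbit s x = porbit s y -> bs x = bs y.
  move=> E; rewrite /bs E; case: pickP => //= /(_ y); by rewrite porbit_id.
have bt_eq x y : porbit s x = porbit s y -> bt x = bt y.
  move=> E; have := btP y; rewrite /bt E; case: pickP => //= h; by rewrite h.
have bs_orb x : porbit s (bs x) = porbit s x by apply/eqP; rewrite eq_porbit_mem.
have bt_orb x : porbit t (bt x) = m (porbit s x).
  have [/imsetP[z _ E] _] := mP _ (orb x); have := btP x; rewrite E.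
  by rewrite -eq_porbit_mem => /eqP.
pose L x := traject s (bs x) #|porbit s x|.
have xL x : x \in L x by rewrite /L -bs_orb -porbit_traject bs_orb porbit_id.
(* A point is the i-th iterate under [s] of the base point of its orbit; [T] sends it to the i-th
   iterate under [t] of the base point of the matched orbit. *)
pose T x := iter (index x (L x)) t (bt x).
have T_orb x : porbit t (T x) = m (porbit s x).
  by rewrite -bt_orb /T -permX porbit_perm.
have ilt x : (index x (L x) < #|porbit s x|)%N.
  by have := xL x; rewrite -index_mem size_traject.
have xE x : x = iter (index x (L x)) s (bs x).
  by rewrite -(nth_traject s (ilt x)) nth_index.
have TI : injective T.
  move=> x y E; have oE : porbit s x = porbit s y.
    by apply: mI => //; rewrite -!T_orb E.
  rewrite (xE x) (xE y) (bs_eq _ _ oE); congr iter.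
  have [_ cx] := mP _ (orb x); have [_ cy] := mP _ (orb y).
  have := uniq_traject_porbit t (bt y); rewrite bt_orb cy => U.
  move: E; rewrite /T (bt_eq _ _ oE).
  have ix := ilt x; rewrite oE in ix.
  rewrite -(nth_traject t ix (bt y)) -(nth_traject t (ilt y) (bt y)).
  by move/eqP; rewrite nth_uniq ?size_traject ?ilt // => /eqP.
have Ts x : T (s x) = t (T x).
  have oE : porbit s (s x) = porbit s x by have := porbit_perm s 1 x; rewrite expg1.
  (* At the last point of the trajectory [s] returns to the base point, and so does [t] on the
     matched orbit, because the sizes agree. *)
  have := ilt x; rewrite leq_eqVlt => /orP[/eqP iE|lt].
    have sb : s x = bs x.
      by rewrite {1}(xE x) -iterS iE -bs_orb iter_porbit.
    rewrite {1}/T (bt_eq _ _ oE) {1}sb /L oE (bs_eq _ _ oE).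
    have -> : index (bs x) (traject s (bs x) #|porbit s x|) = 0%N.
      by rewrite -iE /= eqxx.
    rewrite /T -iterS iE; have [_ <-] := mP _ (orb x).
    by rewrite -bt_orb iter_porbit.
  rewrite {1}/T (bt_eq _ _ oE) /L oE (bs_eq _ _ oE) /T -iterS; congr iter.
  have -> : s x = nth (bs x) (traject s (bs x) #|porbit s x|) (index x (L x)).+1.
    by rewrite nth_traject // iterS -xE.
  rewrite index_uniq ?size_traject //.
  by have := uniq_traject_porbit s (bs x); rewrite bs_orb.
exists (perm TI); apply/permP => x; rewrite !permM permE Ts; congr (t _).
by rewrite -{1}(permKV (perm TI) x) permE.
Qed.

Lemma conj_inv s : exists u, s^-1%g = (u^-1 * s * u)%g.
Proof.
apply: cycle_type_conj; apply: val_inj => /=.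
by rewrite /orbit_sizes /orbits_by_size porbitsV.
Qed.

End CycleType.

Section Complete.
Variables (K : fieldType) (K0 : [pchar K] =i pred0) (n : nat).
Implicit Types (la mu : intpart) (s t u : 'S_n).

Definition ychar la s : K := chi (yidem K n la) s.

Lemma ycharJ la s t : ychar la (t^-1 * s * t)%g = ychar la s.
Proof. exact: chiJ. Qed.

Lemma ycharV la s : ychar la s^-1%g = ychar la s.
Proof. by have [u ->] := conj_inv s; rewrite ycharJ. Qed.

Lemma ychar_orth la mu : n = sumn la -> n = sumn mu ->
  \sum_s ychar la s * ychar mu s = n`!%:R * (la == mu)%:R.
Proof.
move=> nla nmu; rewrite -(yidem_pairing K0 nla nmu).
rewrite (chi_pairing (yidem K n la) (f := ychar mu)); last exact: ycharJ.
by apply: eq_bigr => s _; rewrite ycharV.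
Qed.

(** Built from the cycle types that occur, so that the character table with these rows is square
    before it is known ([all_typesP]) that every partition of n occurs. *)
Definition all_types : seq intpart := undup [seq cycle_type s | s : 'S_n].

Lemma all_types_sum la : la \in all_types -> n = sumn la.
Proof. by rewrite mem_undup => /mapP[s _ ->]; rewrite sumn_cycle_type. Qed.

Lemma mem_all_types s : cycle_type s \in all_types.
Proof. by rewrite mem_undup; apply: image_f. Qed.

Lemma class_type (f : 'S_n -> K) s t : (forall s u, f (u^-1 * s * u)%g = f s) ->
  cycle_type s = cycle_type t -> f s = f t.
Proof. by move=> fJ /cycle_type_conj[u ->]; rewrite fJ. Qed.

(* The character table, its columns indexed by the cycle types, is a square
   matrix; orthogonality of its rows therefore gives that of its columns. *)
Lemma ychar_complete (f : 'S_n -> K) t : (forall s u, f (u^-1 * s * u)%g = f s) ->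
  \sum_(la <- all_types) (\sum_s f s * ychar la s) * ychar la t = n`!%:R * f t.
Proof.
move=> fJ; pose N := size all_types.
pose al (i : 'I_N) : intpart := nth (cycle_type (1%g : 'S_n)) all_types i.
have alP i : al i \in all_types by apply: mem_nth.
have alI : injective al.
  by move=> i j /eqP; rewrite nth_uniq ?undup_uniq // => /eqP/val_inj.
have clE s : exists i, cycle_type s = al i.
  have lt := mem_all_types s; rewrite -index_mem in lt.
  by exists (Ordinal lt); rewrite /al nth_index ?mem_all_types.
have /fin_all_exists[rep repE] : forall i, exists s, cycle_type s = al i.
  by move=> i; have := alP i; rewrite mem_undup => /mapP[s _ ->]; exists s.
pose cls i : {set 'S_n} := [set s : 'S_n | cycle_type s == al i].
have sumE (g : 'S_n -> K) : \sum_s g s = \sum_i \sum_(s in cls i) g s.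
  have /fin_all_exists[cl clP] := clE.
  rewrite (partition_big cl xpredT) //; apply: eq_bigr => i _; apply: eq_bigl => s.
  by rewrite inE clP (inj_eq alI).
have n0 : n`!%:R != 0 :> K by apply: natr_neq0 => //; apply: fact_gt0.
pose X := \matrix_(i, j) ychar (al i) (rep j) : 'M[K]_N.
pose Y := \matrix_(j, i) (#|cls j|%:R / n`!%:R * ychar (al i) (rep j)) : 'M[K]_N.
have XY : X *m Y = 1%:M.
  apply/matrixP => i i'; rewrite !mxE.
  have := ychar_orth (all_types_sum (alP i)) (all_types_sum (alP i')).
  rewrite (inj_eq alI) sumE => E; apply: (mulfI n0); rewrite -E mulr_sumr.
  apply: eq_bigr => j _; rewrite (eq_bigr (fun=> ychar (al i) (rep j) * ychar (al i') (rep j))).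
    rewrite sumr_const !mxE -mulr_natl; move: n0; set w := _%:R => n0.
    by set c := #|_|%:R; field.
  move=> s; rewrite inE -repE => /eqP sE.
  by congr (_ * _); apply: class_type sE; apply: ycharJ.
have YX := mulmx1C XY.
have [j0 tE] := clE t.
transitivity (\sum_s f s * \sum_i ychar (al i) s * ychar (al i) t).
  rewrite (big_nth (cycle_type (1%g : 'S_n))) big_mkord.
  under eq_bigr do rewrite mulr_suml.
  rewrite exchange_big; apply: eq_bigr => s _; rewrite mulr_sumr.
  by apply: eq_bigr => i _; rewrite mulrA.
have clsE (g : 'S_n -> K) j s : (forall s u, g (u^-1 * s * u)%g = g s) -> s \in cls j -> g s = g (rep j).
  by move=> gJ; rewrite inE -repE => /eqP; apply: class_type.
transitivity (\sum_j (n`!%:R * f (rep j)) * (j == j0)%:R); last first.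
  rewrite (bigD1 j0) //= eqxx mulr1 big1 ?addr0 => [|j /negPf ->]; last by rewrite mulr0.
  by congr (_ * _); apply: class_type => //; rewrite repE tE.
rewrite sumE; apply: eq_bigr => j _.
have /matrixP/(_ j j0) := YX; rewrite !mxE => <-.
rewrite (eq_bigr (fun=> f (rep j) * \sum_i ychar (al i) (rep j) * ychar (al i) (rep j0))); last first.
  move=> s sj; rewrite (clsE f _ _ fJ sj); congr (_ * _); apply: eq_bigr => i _.
  rewrite (clsE _ _ _ (@ycharJ (al i)) sj); congr (_ * _).
  by apply: class_type; [apply: ycharJ | rewrite repE tE].
rewrite sumr_const -[LHS]mulr_natl !mulr_sumr; apply: eq_bigr => i _; rewrite !mxE.
move: n0; set w := n`!%:R => n0; set c := #|_|%:R; by field.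
Qed.

(** A partition of n that is not a cycle type would have a character orthogonal to all rows of the
    table. Completeness makes this character zero, which contradicts its norm n!. *)
Lemma all_typesP la : (la \in all_types) = (n == sumn la).
Proof.
apply/idP/eqP => [/all_types_sum //|nla]; apply: contraT => laN.
have n0 : n`!%:R != 0 :> K by apply: natr_neq0 => //; apply: fact_gt0.
have z t : ychar la t = 0.
  apply: (mulfI n0); rewrite mulr0 -ychar_complete; last exact: ycharJ.
  rewrite big_seq big1 // => mu muP.
  have ne : (la == mu) = false by apply: contraNF laN => /eqP ->.
  by rewrite (ychar_orth nla (all_types_sum muP)) ne mulr0 mul0r.
have := ychar_orth nla nla; rewrite eqxx mulr1 big1 => [/esym/eqP|s _]; last by rewrite z mul0r.
by rewrite (negPf n0).
Qed.

End Complete.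

(* Only from here on: [classical_sets] shadows the notations of [finset]. *)
From mathcomp Require Import finmap monalg classical_sets functions fsbigop.

(** * Tensors and words *)

Arguments lext : simpl never.
Arguments sact : simpl never.
Arguments tmap : simpl never.
Arguments contract : simpl never.

Lemma lin_eq_supp (K : fieldType) (I : choiceType) (W : lmodType K)
    (f g : {linear {malg K[I]} -> W}) x :
  (forall i, x@_i != 0 -> f << i >> = g << i >>) -> f x = g x.
Proof.
move=> fg; rewrite (malg_sumU x) /lext !linear_sum /= big_seq [RHS]big_seq.
apply: eq_bigr => i; rewrite -mcoeff_neq0 => /fg E.
by rewrite !linearZ /= E.
Qed.

Section Words.
Variables (K : fieldType) (I : choiceType) (n : nat).
Notation T := (tpow K I n).
Notation A := {ffun 'S_n -> K^o}.
Implicit Types (x y : A) (t : T) (s : 'S_n).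

Lemma sactM s s' t : sact s (sact s' t) = sact (s * s')%g t.
Proof.
move: t; apply: (@malg_linear_eq K _ T (@sact K I n s \o @sact K I n s') (@sact K I n (s * s')%g)) => i /=.
by rewrite !sactU; congr << _ >>; apply/ffunP => k; rewrite !ffunE permM.
Qed.

Lemma mcoeff_sact s t (i : {ffun 'I_n -> I}) :
  (sact s t)@_i = t@_[ffun k => i (s^-1%g k)].
Proof.
rewrite [in LHS](malg_sumU t) /lext linear_sum raddf_sum /=.
rewrite [in RHS](malg_sumU t) /lext raddf_sum /=; apply: eq_bigr => j _.
rewrite linearZ /= !mcoeffZ sactU !mcoeffU; congr (_ * (nat_of_bool _)%:R).
apply/eqP/eqP => [<-|->]; apply/ffunP => k; rewrite !ffunE ?permKV ?permK //.
Qed.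

Definition pact x t : T := \sum_s x s *: sact s t.

Lemma pact_linear x : linear (pact x).
Proof.
move=> a t t'; rewrite /pact scaler_sumr -big_split; apply: eq_bigr => s _ /=.
by rewrite linearP scalerDr !scalerA mulrC.
Qed.

HB.instance Definition _ x := GRing.isLinear.Build K T T *:%R (pact x) (pact_linear x).

Lemma pact_linearl t : linear (pact^~ t).
Proof.
move=> a x y; rewrite /pact scaler_sumr -big_split; apply: eq_bigr => s _ /=.
by rewrite !ffunE scalerDl scalerA.
Qed.

Lemma pact_delta s t : pact (fdelta K s) t = sact s t.
Proof.
rewrite /pact (bigD1 s) //= ffunE eqxx scale1r big1 ?addr0 // => u /negPf us.
by rewrite ffunE us scale0r.
Qed.

Lemma pactM x y t : pact x (pact y t) = pact (gm x y) t.
Proof.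
rewrite /pact; under [RHS]eq_bigr do rewrite ffunE scaler_suml.
rewrite [RHS]exchange_big; apply: eq_bigr => s _ /=.
rewrite (linear_sum (sact s)) scaler_sumr [RHS](reindex_inj (mulgI s)) /=.
by apply: eq_bigr => u _; rewrite linearZ /= scalerA sactM mulKg.
Qed.

Lemma pactZ a x t : pact (a *: x) t = a *: pact x t.
Proof. by have := pact_linearl t a x 0; rewrite addr0 => ->; rewrite [X in _ + X]big1 ?addr0 // => s _; rewrite ffunE scale0r. Qed.

Lemma pact_sum J (r : seq J) (F : J -> A) t :
  pact (\sum_(j <- r) F j) t = \sum_(j <- r) pact (F j) t.
Proof.
elim: r => [|j r IH]; last first.
  by rewrite !big_cons -IH -[F j in LHS]scale1r pact_linearl scale1r.
by rewrite !big_nil -[X in pact X](scale0r (0 : A)) pactZ scale0r.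
Qed.

(** The coefficients of [t] on the rearrangements of the word [ka], which may repeat letters.
    Permuting the positions of [t] multiplies this element on the left ([pol_sact]); permuting the
    letters of a multilinear tensor multiplies it on the right ([pol_wv]). *)
Definition pol (ka : 'I_n -> I) t : A := [ffun s : 'S_n => t@_[ffun j => ka (s j)]].

Lemma pol_linear ka : linear (pol ka).
Proof. by move=> a t t'; apply/ffunP => s; rewrite !ffunE mcoeffD mcoeffZ. Qed.

HB.instance Definition _ ka := GRing.isLinear.Build K T A *:%R (pol ka) (pol_linear ka).

Lemma pol_eq0 t : (forall ka, pol ka t = 0) -> t = 0.
Proof.
move=> t0; apply/malgP => i; rewrite mcoeff0; have /ffunP/(_ 1%g) := t0 i.
by rewrite !ffunE => <-; congr (t@_ _); apply/ffunP => j; rewrite ffunE perm1.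
Qed.

Lemma pol_sact ka s t : pol ka (sact s t) = gm (fdelta K s) (pol ka t).
Proof.
apply/ffunP => u; rewrite gm_deltal !ffunE mcoeff_sact; congr (t@_ _).
by apply/ffunP => k; rewrite !ffunE permM.
Qed.

Lemma pol_pact ka x t : pol ka (pact x t) = gm x (pol ka t).
Proof.
rewrite /pact linear_sum gm_expand; apply: eq_bigr => s _.
by rewrite linearZ /= pol_sact.
Qed.

Section Weight.
Variable w : 'I_n -> I.

Definition wv (v : A) : T := \sum_s v s *: << [ffun j => w (s j)] >>.

Lemma wv_linear : linear wv.
Proof.
move=> a x y; rewrite /wv scaler_sumr -big_split; apply: eq_bigr => s _ /=.
by rewrite !ffunE scalerDl scalerA.
Qed.

HB.instance Definition _ := GRing.isLinear.Build K A T *:%R wv wv_linear.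

Lemma wv_delta s : wv (fdelta K s) = << [ffun j => w (s j)] >>.
Proof.
rewrite /wv (bigD1 s) //= ffunE eqxx scale1r big1 ?addr0 // => u /negPf us.
by rewrite ffunE us scale0r.
Qed.

Lemma sact_wv s v : sact s (wv v) = wv (gm (fdelta K s) v).
Proof.
rewrite /wv linear_sum [RHS](reindex_inj (mulgI s)); apply: eq_bigr => u _.
rewrite linearZ /= sactU gm_deltal mulKg; congr (_ *: << _ >>).
by apply/ffunP => k; rewrite !ffunE permM.
Qed.

Lemma pact_wv x v : pact x (wv v) = wv (gm x v).
Proof.
rewrite /pact gm_expand linear_sum; apply: eq_bigr => s _.
by rewrite linearZ /= sact_wv.
Qed.

Hypothesis w_inj : injective w.

Lemma mcoeff_wv v s : (wv v)@_[ffun j => w (s j)] = v s.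
Proof.
rewrite /wv raddf_sum (bigD1 s) //= mcoeffZ mcoeffU eqxx mulr1 big1 ?addr0 // => u us.
rewrite mcoeffZ mcoeffU; case: eqP => [E|_]; last by rewrite mulr0.
case/eqP: us; apply/permP => k; apply: w_inj.
by move/ffunP/(_ k): E; rewrite !ffunE.
Qed.

Lemma wv_inj : injective wv.
Proof. by move=> x y E; apply/ffunP => s; rewrite -!mcoeff_wv E. Qed.

Lemma pol_wv s v : pol (w \o s) (wv v) = gm v (fdelta K s^-1%g).
Proof.
apply/ffunP => u; rewrite gm_deltar invgK ffunE -mcoeff_wv.
by congr ((wv v)@_ _); apply/ffunP => k; rewrite !ffunE permM.
Qed.

Lemma pol_wv1 v : pol w (wv v) = v.
Proof.
rewrite -[RHS]gm1r -invg1 -pol_wv; congr (pol _ _).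
by apply/funext => k /=; rewrite perm1.
Qed.

End Weight.
End Words.

Lemma tmap_pact (K : fieldType) (I J : choiceType) (g : {malg K[I]} -> {malg K[J]}) n x (t : tpow K I n) :
  tmap g (pact x t) = pact x (tmap g t).
Proof.
by rewrite /pact linear_sum; apply: eq_bigr => s _; rewrite linearZ /= sact_tmap.
Qed.

Section Evaluation.
Variables (K : fieldType) (K0 : [pchar K] =i pred0) (D : basedCat K) (la : intpart).
Notation n := (sumn la).
Variable A : subfunctor (tensor_power D n).
Hypothesis A_sact : forall X s (t : tpow K (bc_basis X) n), t \in A X -> sact s t \in A X.

Fact ysym_specht : ysym K n la \in @specht_pred K la.
Proof. by apply/asboolP; exists (fdelta K 1%g); rewrite -[LHS]gm1l. Qed.

Definition ygen : specht K la := Subspace ysym_specht.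

Section Space.
Variable X : bc_ob D.
Notation hom := (fob (specht_hom A) X).

(** The Specht module is generated by the Young symmetrizer, so a homomorphism is known by this
    value; the values are the tensors of [A X] fixed by the Young idempotent ([ev_in], [ev_idem],
    [ev_surj]). *)
Definition ev (f : hom) : tpow K (bc_basis X) n := val f ygen.

Lemma ev_linear : linear ev.
Proof. by []. Qed.

HB.instance Definition _ := GRing.isLinear.Build K hom (tpow K (bc_basis X) n) *:%R ev ev_linear.

Lemma pact_mem x t : t \in A X -> pact x t \in A X.
Proof. by move=> tA; rewrite rpred_sum // => s _; rewrite rpredZ ?A_sact. Qed.

Lemma ev_in f : ev f \in A X.
Proof. by have /asboolP[_ _] : val f \in @hom_pred K D la A X := valP f; apply. Qed.

Let hom_scale (f : hom) a m : val f (a *: m) = a *: val f m.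
Proof.
have /asboolP[f1 _ _] : val f \in @hom_pred K D la A X := valP f.
have f0 : val f 0 = 0 := linear0 (HB.pack_for {linear specht K la -> tpow K (bc_basis X) n} (val f)
    (GRing.isLinear.Build K _ _ *:%R (val f) f1)).
by have := f1 a m 0; rewrite addr0 f0 addr0.
Qed.

Let hom_pact (f : hom) x (m z : specht K la) :
  val z = gm x (val m) -> val f z = pact x (val f m).
Proof.
have /asboolP[f1 f2 _] : val f \in @hom_pred K D la A X := valP f.
move=> zE; pose g := HB.pack_for {linear specht K la -> tpow K (bc_basis X) n} (val f)
    (GRing.isLinear.Build K _ _ *:%R (val f) f1).
pose F s : specht K la := (x s : K) *: specht_act s m.
have -> : z = \sum_s F s.
  apply: val_inj; rewrite zE linear_sum /= gm_expand; apply: eq_bigr => s _.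
  by congr (_ *: _); apply/ffunP => u; rewrite gm_deltal ffunE.
have E : val f (\sum_s F s) = \sum_s val f (F s) := linear_sum g _ _ _.
by rewrite E; apply: eq_bigr => s _; rewrite hom_scale f2.
Qed.

Lemma ev_idem f : pact (yidem K n la) (ev f) = ev f.
Proof.
have nE : n = sumn la by [].
rewrite /yidem pactZ -(@hom_pact f _ ygen (yscal K n la *: ygen)); last first.
  by rewrite /= ysym_sq.
by rewrite hom_scale scalerA mulVf ?scale1r // yscal_neq0.
Qed.

Lemma ev_inj f g : ev f = ev g -> f = g.
Proof.
move=> E; apply/val_inj/funext => m.
have /asboolP[y yE] := valP m.
have h (k : hom) : val k m = pact y (ev k) by apply: hom_pact; apply: yE.
by rewrite [LHS]h [RHS]h E.
Qed.

Lemma ev_surj t : t \in A X -> pact (yidem K n la) t = t -> exists f, ev f = t.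
Proof.
move=> tA te; have nE : n = sumn la by [].
(* At the generator this is the Young idempotent applied to [t], which is [t]. *)
pose f (m : specht K la) := pact ((yscal K n la)^-1 *: val m) t.
have fP : f \in @hom_pred K D la A X.
  apply/asboolP; split=> [a x y|s m|m]; rewrite /f.
  - by rewrite !pactZ pact_linearl scalerDr !scalerA mulrC.
  - rewrite -pact_delta pactM gmZr; congr (pact (_ *: _) t).
    by apply/ffunP => u; rewrite gm_deltal ffunE.
  - exact: pact_mem.
by exists (Subspace fP); rewrite /ev /= /f.
Qed.

End Space.

Lemma ev_nat X Y (h : bc_hom X Y) (f : specht_hom A X) :
  ev (fmap (specht_hom A) h f) = tmap (bc_map h) (ev f).
Proof. by []. Qed.

End Evaluation.

(** * Subfunctors and multiplicities *)

Section Subfunctors.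
Variables (K : fieldType) (D : basedCat K).
Implicit Types F G : functor D.

Lemma submodB (U : lmodType K) (C : submodClosed U) x y : x \in C -> y \in C -> x - y \in C.
Proof. by move=> xC yC; rewrite -scaleN1r addrC rpredD ?rpredZ. Qed.

Lemma submodL (U : lmodType K) (C : submodClosed U) a x y : x \in C -> y \in C -> a *: x + y \in C.
Proof. by move=> xC yC; rewrite rpredD ?rpredZ. Qed.

Section FromProp.
Variables (U : lmodType K) (Q : U -> Prop).
Hypotheses (Q0 : Q 0) (QD : forall a x y, Q x -> Q y -> Q (a *: x + y)).

Definition prop_pred : {pred U} := fun x => `[< Q x >].

Fact prop_closed : submod_closed prop_pred.
Proof. by split=> [|a x y /asboolP qx /asboolP qy]; apply/asboolP; [|apply: QD]. Qed.

Definition prop_submod : submodClosed U :=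
  HB.pack_for (submodClosed U) prop_pred (GRing.isSubmodClosed.Build K U prop_pred prop_closed).

Lemma prop_submodP x : (x \in prop_submod) <-> Q x.
Proof. by split=> [/asboolP|qx]; last exact/asboolP. Qed.
End FromProp.

Lemma subfunctor_of_prop F (Q : forall X, F X -> Prop) :
  (forall X, Q X 0) -> (forall X a x y, Q X x -> Q X y -> Q X (a *: x + y)) ->
  (forall X Y (h : bc_hom X Y) x, Q X x -> Q Y (fmap F h x)) ->
  exists C : subfunctor F, forall X x, (x \in C X) <-> Q X x.
Proof.
move=> Q0 QD Qh.
pose C X := prop_submod (Q0 X) (QD X).
have Ch X Y (h : bc_hom X Y) (x : F X) : x \in C X -> fmap F h x \in C Y.
  by move=> /prop_submodP/Qh qx; apply/prop_submodP.
by exists (Subfunctor Ch) => X x; apply: prop_submodP.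
Qed.

Lemma zero_subfunctor F : exists Z : subfunctor F, forall X x, (x \in Z X) <-> x = 0.
Proof.
apply: subfunctor_of_prop => //.
- by move=> Y a _ _ -> ->; rewrite scaler0 addr0.
- by move=> Y Y' h _ ->; rewrite linear0.
Qed.

Definition lact F X Y (ga : seq (K * bc_hom X Y)) (x : F X) : F Y :=
  \sum_(g <- ga) g.1 *: fmap F g.2 x.

Lemma lact_mem F (A : subfunctor F) X Y (ga : seq (K * bc_hom X Y)) x :
  x \in A X -> lact ga x \in A Y.
Proof. by move=> xA; rewrite rpred_sum // => g _; rewrite rpredZ ?sf_stable. Qed.

Lemma lact_nat F G (B : subfunctor F) (f : forall X, F X -> G X) :
  (forall X a, {in B X &, forall x y, f X (a *: x + y) = a *: f X x + f X y}) ->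
  (forall X Y (h : bc_hom X Y), {in B X, forall x, f Y (fmap F h x) = fmap G h (f X x)}) ->
  forall X Y (ga : seq (K * bc_hom X Y)) x, x \in B X -> f Y (lact ga x) = lact ga (f X x).
Proof.
move=> fl fn X Y ga x xB; rewrite /lact.
have f0 : f Y 0 = 0.
  have := fl Y (-1) 0 0; rewrite !rpred0 => /(_ isT isT).
  by rewrite scaler0 addr0 scaleN1r addNr.
elim: ga => [|g ga IH]; first by rewrite !big_nil.
rewrite !big_cons fl ?IH ?fn ?sf_stable // rpred_sum // => k _.
by rewrite rpredZ ?sf_stable.
Qed.

Record nattrans F G := Nattrans {
  nt :> forall X, {linear F X -> G X};
  nt_nat : forall X Y (h : bc_hom X Y) x, nt Y (fmap F h x) = fmap G h (nt X x) }.

Lemma nt_lact F G (f : nattrans F G) X Y (ga : seq (K * bc_hom X Y)) x :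
  f Y (lact ga x) = lact ga (f X x).
Proof.
by rewrite /lact linear_sum; apply: eq_bigr => g _; rewrite linearZ /= nt_nat.
Qed.

Definition simple_functor G := forall C : subfunctor G,
  (exists X (x : G X), x \in C X /\ x != 0) -> forall X (x : G X), x \in C X.

(** Schur's argument: the kernel of [f] on [B] lies between [A] and [B], and the image of [B] is a
    nonzero subfunctor of [G]. *)
Lemma factor_iso_of_hom F G (A B : subfunctor F) (f : forall X, F X -> G X) :
  simple_factor A B -> simple_functor G ->
  (forall X a, {in B X &, forall x y, f X (a *: x + y) = a *: f X x + f X y}) ->
  (forall X Y (h : bc_hom X Y), {in B X, forall x, f Y (fmap F h x) = fmap G h (f X x)}) ->
  (forall X x, x \in A X -> f X x = 0) ->
  (exists X x, x \in B X /\ f X x != 0) ->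
  factor_iso A B G.
Proof.
move=> [AB nBA sAB] sG fl fn fA [X1 [x1 [x1B fx1]]].
have f0 X : f X 0 = 0 by apply: fA; apply: rpred0.
exists f; split=> //.
- have [|||C CE] := @subfunctor_of_prop F (fun X x => x \in B X /\ f X x = 0).
  + by move=> X; rewrite rpred0.
  + move=> X a x y [xB x0] [yB y0]; split; first by rewrite rpredD ?rpredZ.
    by rewrite fl // x0 y0 scaler0 addr0.
  + by move=> X Y h x [xB x0]; rewrite sf_stable // fn // x0 linear0.
  have [||CA|BC] := sAB C.
  + by move=> X x xA; apply/CE; rewrite fA ?AB.
  + by move=> X x /CE[].
  + move=> X x xB; apply/eqP/idP => [x0|]; last exact: fA.
    by apply: CA; apply/CE.
  + by have /CE[_ /eqP] := BC _ _ x1B; rewrite (negPf fx1).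
- move=> X z.
  have [|||C CE] := @subfunctor_of_prop G (fun X z => exists2 x, x \in B X & f X x = z).
  + by move=> Y; exists 0; rewrite ?rpred0.
  + move=> Y a _ _ [x xB <-] [y yB <-]; exists (a *: x + y); last exact: fl.
    by rewrite rpredD ?rpredZ.
  + by move=> Y Z h _ [x xB <-]; exists (fmap F h x); rewrite ?sf_stable ?fn.
  apply/CE/sG; exists X1, (f X1 x1); split=> //.
  by apply/CE; exists x1.
Qed.

(* A strictly monotone length function bounds the chains of subfunctors. *)
Lemma composition_series_exists F (len : subfunctor F -> nat) :
  (forall A B, sfle A B -> ~ sfle B A -> (len A < len B)%N) ->
  exists l A, @composition_series K D F l A.
Proof.
move=> lenS.
suff main m (B : subfunctor F) : (len B <= m)%N -> exists l (A : nat -> subfunctor F),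
    [/\ forall X (x : F X), x \in A 0%N X -> x = 0, A l = B &
        forall k, (k < l)%N -> simple_factor (A k) (A k.+1)].
  have [|||full fullE] := @subfunctor_of_prop F (fun _ _ => True) => //.
  have [l [A [A0 Al AS]]] := main _ full (leqnn _).
  by exists l, A; split=> // X x; rewrite Al; apply/fullE.
elim: m B => [|m IH] B lB.
  exists 0%N, (fun=> B); split=> // X x xB; apply: contrapT => x0.
  have [|||Z ZE] := @subfunctor_of_prop F (fun X x => x = 0) => //.
  - by move=> Y a _ _ -> ->; rewrite scaler0 addr0.
  - by move=> Y Y' h _ ->; rewrite linear0.
  have : (len Z < len B)%N.
    apply: lenS; first by move=> Y y /ZE ->; rewrite rpred0.
    by move=> BZ; apply: x0; apply/ZE/BZ.
  by move/leq_trans/(_ lB).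
have [[X [x [xB x0]]]|B0] := pselect (exists X (x : F X), x \in B X /\ x <> 0); last first.
  exists 0%N, (fun=> B); split=> // X x xB; apply: contrapT => x0; apply: B0.
  by exists X, x.
(* Among the subfunctors strictly below [B], one of greatest length leaves a simple quotient. *)
pose Q d := `[< exists A, [/\ sfle A B, ~ sfle B A & len A = d] >].
have exQ : exists d, Q d.
  have [|||Z ZE] := @subfunctor_of_prop F (fun X x => x = 0) => //.
  - by move=> Y a _ _ -> ->; rewrite scaler0 addr0.
  - by move=> Y Y' h _ ->; rewrite linear0.
  exists (len Z); apply/asboolP; exists Z; split=> //.
    by move=> Y y /ZE ->; rewrite rpred0.
  by move=> BZ; apply: x0; apply/ZE/BZ.
have ubQ d : Q d -> (d <= m)%N.
  move=> /asboolP[A [AB nBA <-]]; have := lenS _ _ AB nBA; lia.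
case: (ex_maxnP exQ ubQ) => d /asboolP[A [AB nBA Ad]] dmax.
have [|l [A' [A'0 A'l A'S]]] := IH A; first by rewrite Ad ubQ //; apply/asboolP; exists A.
exists l.+1, (fun k => if (k <= l)%N then A' k else B).
split=> [||k kl]; rewrite ?ltnn //.
rewrite ltnS in kl; rewrite kl; case: ltnP => // lk; first by apply: A'S; lia.
have -> : k = l by lia.
rewrite A'l; split=> // C AC CB.
have [CA|CA] := pselect (sfle C A); [by left|right].
apply: contrapT => BC; have := lenS _ _ AC CA; rewrite Ad ltnNge => /negP; apply.
by apply: dmax; apply/asboolP; exists C.
Qed.

(* Counting along a series with an additive function replaces the
   Jordan-Hoelder theorem. *)
Lemma multiplicity_of_additive F G (len d : subfunctor F -> nat) m :
  (forall A B, sfle A B -> ~ sfle B A -> (len A < len B)%N) ->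
  (forall A B, simple_factor A B -> d B = (d A + `[< factor_iso A B G >])%N) ->
  (forall A : subfunctor F, (forall X (x : F X), x \in A X -> x = 0) -> d A = 0%N) ->
  (forall A : subfunctor F, (forall X (x : F X), x \in A X) -> d A = m) ->
  multiplicity F G m.
Proof.
move=> lenS dS d0 dm; split; first exact: composition_series_exists lenS.
move=> l A [A0 Al AS]; rewrite -(dm _ Al) /factor_count.
suff main k : (k <= l)%N -> d (A k) = (\sum_(i < k) `[< factor_iso (A i) (A i.+1) G >])%N.
  rewrite main // -sum1_card -big_mkcond /= big_mkcond /= [RHS]big_mkcond /=.
  by apply: eq_bigr => i _; rewrite inE; case: asboolP.
elim: k => [_|k IH kl]; first by rewrite big_ord0 d0.
by rewrite big_ord_recr /= -(IH (ltnW kl)) (dS _ _ (AS k kl)).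
Qed.

End Subfunctors.

(** * Layers of a polarizable filtration *)

Definition letters_in (K : fieldType) (I : choiceType) n (B : seq I) (t : tpow K I n) :=
  forall i, t@_i != 0 -> forall k, i k \in B.

Definition letters (K : fieldType) (I : choiceType) n (t : tpow K I n) : seq I :=
  flatten [seq [seq i k | k <- enum 'I_n] | i : {ffun 'I_n -> I} <- msupp t].

Lemma lettersP (K : fieldType) (I : choiceType) n (t : tpow K I n) B :
  {subset letters t <= B} -> letters_in B t.
Proof.
move=> sB i ti k; apply: sB; apply/flattenP; exists [seq i k | k <- enum 'I_n].
  by apply: map_f; rewrite -mcoeff_neq0.
by apply: map_f; rewrite mem_enum.
Qed.

Section Polarizable.
Variables (K : fieldType) (D : basedCat K).

(* In [X0 n] the letters [w n] span the multilinear part of the n-th tensor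
   power; [S n] is the part of the tensor power that it generates. *)
Record polarizable (S : forall n, subfunctor (tensor_power D n))
    (X0 : nat -> bc_ob D) (w : forall n, 'I_n -> bc_basis (X0 n)) : Prop := Polarizable {
  pz_inj : forall n, injective (w n);
  pz_sact : forall n X s (t : tpow K (bc_basis X) n), t \in S n X -> sact s t \in S n X;
  pz_wv : forall n v, wv (w n) v \in S n (X0 n);
  (* One combination has to polarize all tensors with letters in [B] simultaneously, since it acts
     on an element that is seen through several maps to tensor powers. Its vanishing on lower powers
     separates the layers. *)
  pz_pol : forall X n (ka : 'I_n -> bc_basis X) (B : seq (bc_basis X)),
    exists ga : seq (K * bc_hom X (X0 n)),
    (forall t : tpow K (bc_basis X) n, letters_in B t ->
       lact (F := tensor_power D n) ga t = wv (w n) (pol ka t)) /\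
    (forall m (t : tpow K (bc_basis X) m), (m < n)%N -> letters_in B t ->
       lact (F := tensor_power D m) ga t = 0);
  (* Stated for families, because an element is recovered from its images under all the maps of a
     layer together. *)
  pz_gen : forall n (J : finType) (U : forall X, (J -> tpow K (bc_basis X) n) -> Prop),
    (forall X, U X (fun=> 0)) ->
    (forall X a t t', U X t -> U X t' -> U X (fun j => a *: t j + t' j)) ->
    (forall X Y (h : bc_hom X Y) t, U X t -> U Y (fun j => tmap (bc_map h) (t j))) ->
    forall X t, (forall j, t j \in S n X) ->
      (forall ka, U (X0 n) (fun j => wv (w n) (pol ka (t j)))) -> U X t }.
End Polarizable.

Section Layer.
Variables (K : fieldType) (K0 : [pchar K] =i pred0) (D : basedCat K).
Variables (S : forall n, subfunctor (tensor_power D n)).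
Variables (X0 : nat -> bc_ob D) (w : forall n, 'I_n -> bc_basis (X0 n)).
Hypothesis pz : polarizable S w.

Section One.
Variables (F : functor D) (P : nat) (J : finType).
Variable th : J -> nattrans F (tensor_power D P).
Variable hi : subfunctor F.
Notation V := {ffun J * 'S_P -> K^o}.
Implicit Types (A B : subfunctor F) (v : V).

Definition vj (j : J) v : {ffun 'S_P -> K^o} := [ffun s => v (j, s)].

Lemma vj_linear j : linear (vj j).
Proof. by move=> a x y; apply/ffunP => s; rewrite !ffunE. Qed.

HB.instance Definition _ j := GRing.isLinear.Build K V {ffun 'S_P -> K^o} *:%R (vj j) (vj_linear j).

Lemma vjZ j (a : K) v : vj j (a *: v) = a *: vj j v.
Proof. by apply/ffunP => s; rewrite !ffunE. Qed.

Lemma vj_eq u v : (forall j, vj j u = vj j v) -> u = v.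
Proof. by move=> E; apply/ffunP => -[j s]; have /ffunP/(_ s) := E j; rewrite !ffunE. Qed.

Definition vof (f : J -> {ffun 'S_P -> K^o}) : V := [ffun p => f p.1 p.2].

Lemma vofK f j : vj j (vof f) = f j.
Proof. by apply/ffunP => s; rewrite !ffunE. Qed.

(** A finite-dimensional record of the part of [A] in [hi], seen through the maps [th]: the families
    of multilinear tensors that its elements realize jointly. *)
Definition W A v := exists x : F (X0 P), [/\ x \in A (X0 P), x \in hi (X0 P) &
  forall j, th j (X0 P) x = wv (@w P) (vj j v)].

Lemma W0 A : W A 0.
Proof.
exists 0; rewrite !rpred0; split=> // j.
by rewrite !linear0.
Qed.

Lemma WD A a u v : W A u -> W A v -> W A (a *: u + v).
Proof.
move=> [x [xA xh xE]] [y [yA yh yE]]; exists (a *: x + y).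
split=> [||j]; [exact: submodL|exact: submodL|].
by rewrite (linearP (th j _)) vj_linear linearP /= xE yE.
Qed.

Lemma W_le A B v : sfle A B -> W A v -> W B v.
Proof. by move=> AB [x [xA xh xE]]; exists x; split=> //; apply: AB. Qed.

Lemma polar_lact X (ka : 'I_P -> bc_basis X) (x : F X) (B0 : seq (bc_basis X)) :
  exists ga : seq (K * bc_hom X (X0 P)),
  [/\ forall j, th j (X0 P) (lact ga x) = wv (@w P) (pol ka (th j X x)),
     forall t : tpow K (bc_basis X) P, letters_in B0 t ->
       lact (F := tensor_power D P) ga t = wv (@w P) (pol ka t) &
     forall m (t : tpow K (bc_basis X) m), (m < P)%N -> letters_in B0 t ->
       lact (F := tensor_power D m) ga t = 0].
Proof.
pose Bs := flatten [seq letters (th j X x : tpow K (bc_basis X) P) | j <- enum J].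
have [ga [g1 g2]] := pz_pol pz ka (Bs ++ B0).
exists ga; split=> [j|t tB|m t mP tB].
- rewrite nt_lact g1 //; apply: lettersP => i ij; rewrite mem_cat; apply/orP; left.
  by apply/flattenP; exists (letters (th j X x : tpow K (bc_basis X) P)) => //; apply: map_f; rewrite mem_enum.
- by apply: g1 => i /tB ti k; rewrite mem_cat ti orbT.
- by apply: g2 => // i /tB ti k; rewrite mem_cat ti orbT.
Qed.

Lemma W_polar A X (ka : 'I_P -> bc_basis X) (x : F X) : x \in A X -> x \in hi X ->
  W A (vof (fun j => pol ka (th j X x))).
Proof.
move=> xA xh; have [ga [g1 _ _]] := polar_lact ka x [::].
exists (lact ga x); split=> [||j]; [exact: lact_mem|exact: lact_mem|].
by rewrite g1 vofK.
Qed.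

(** Polarizing along the letters permuted by s^-1 multiplies every member of the family on the right
    by s. With [W_sum] this makes [W A] stable under the whole group algebra. *)
Lemma W_delta A v s : W A v -> W A (vof (fun j => gm (vj j v) (fdelta K s))).
Proof.
move=> [x [xA xh xE]]; have := W_polar (@w P \o s^-1%g) xA xh.
congr (W A _); apply: vj_eq => j; rewrite !vofK xE.
by rewrite pol_wv ?invgK //; apply: pz_inj pz _.
Qed.

Lemma W_sum A (I : Type) (r : seq I) (a : I -> K) (f : I -> V) :
  (forall i, W A (f i)) -> W A (\sum_(i <- r) a i *: f i).
Proof.
move=> Wf; elim: r => [|i r IH]; first by rewrite big_nil; apply: W0.
by rewrite big_cons; apply: WD.
Qed.

Lemma W_gm A v x : W A v -> W A (vof (fun j => gm (vj j v) x)).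
Proof.
move=> Wv; have := W_sum (index_enum 'S_P) x (fun s => W_delta s Wv).
congr (W A _); apply: vj_eq => j; rewrite vofK gm_expandr.
rewrite (linear_sum (vj j)); apply: eq_bigr => s _.
by rewrite [LHS](vjZ j (x s)) vofK.
Qed.

Variable lo : subfunctor F.
Hypothesis th_in : forall X x, x \in hi X -> forall j, th j X x \in S P X.
Hypothesis th_ker : forall X x, x \in hi X -> (forall j, th j X x = 0) -> x \in lo X.
Hypothesis lo_ker : forall X x, x \in lo X -> forall j, th j X x = 0.

(** By [pz_gen], the images of an element x of [B] in [hi] are also those of an element y of [A] in
    [hi]. Then x - y is killed by all [th], so it lies in [lo] and in [B], hence in [A]. *)
Lemma W_step A B : sfle A B -> (forall X x, x \in B X -> x \in lo X -> x \in A X) ->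
  (forall v, W B v -> W A v) -> forall X x, x \in B X -> x \in hi X -> x \in A X.
Proof.
move=> AB Blo WBA X x xB xh.
pose U X (t : J -> tpow K (bc_basis X) P) :=
  exists y : F X, [/\ y \in A X, y \in hi X & forall j, th j X y = t j].
have [|||||y [yA yh yE]] := @pz_gen _ _ _ _ _ pz P J U _ _ _ X (fun j => th j X x).
- by move=> Y; exists 0; rewrite !rpred0; split=> // j; rewrite linear0.
- move=> Y a t t' [y [yA yh yE]] [z [zA zh zE]]; exists (a *: y + z).
  split=> [||j]; [exact: submodL|exact: submodL|].
  by rewrite linearP /= yE zE.
- move=> Y Z h t [y [yA yh yE]]; exists (fmap F h y).
  by rewrite !sf_stable //; split=> // j; rewrite nt_nat yE.
- by move=> j; apply: th_in.
- move=> ka; have [y [yA yh yE]] := WBA _ (W_polar ka xB xh).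
  by exists y; split=> // j; rewrite yE vofK.
- rewrite -[x](subrK y) rpredD //; apply: Blo.
    by apply: submodB => //; apply: AB.
  apply: th_ker; first exact: submodB.
  by move=> j; rewrite linearB /= yE subrr.
Qed.

End One.

Section Simple.
Variable nu : intpart.
Notation n := (sumn nu).
Notation Vnu := (specht_hom (S n)).
Notation e := (yidem K n nu).

Let S_sact X s (t : tpow K (bc_basis X) n) : t \in S n X -> sact s t \in S n X.
Proof. exact: pz_sact pz _ _ _ _. Qed.

Fact evn_nat X Y (h : bc_hom X Y) (f : Vnu X) :
  ev (fmap Vnu h f) = fmap (tensor_power D n) h (ev f).
Proof. exact: ev_nat. Qed.

Definition evn : nattrans Vnu (tensor_power D n) :=
  @Nattrans K D Vnu (tensor_power D n) (fun X => @ev K D nu (S n) X) evn_nat.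

Lemma ev_eq0 X (x : Vnu X) : ev x = 0 -> x = 0.
Proof. by move=> x0; apply: ev_inj; rewrite x0 linear0. Qed.

(** A nonzero subfunctor contains a nonzero multilinear vector v = e v. Multiplying by e on the
    right gives e v e, a nonzero multiple of e; so e is reached, and with it every vector e u =
    u. *)
Lemma specht_hom_simple : simple_functor Vnu.
Proof.
move=> C [X [x [xC /eqP xn0]]] Y z.
have nE : n = sumn nu by [].
have wI := pz_inj pz (n:=n).
pose full := full_subfunctor Vnu.
have [|||Z ZE] := @subfunctor_of_prop K D Vnu (fun X x => x = 0) => //.
- by move=> U a _ _ -> ->; rewrite scaler0 addr0.
- by move=> U U' h _ ->; rewrite linear0.
have WE v : W (fun _ : unit => evn) full full v -> gm e (vj tt v) = vj tt v.
  move=> [y [_ _ yE]]; apply: (wv_inj wI); rewrite -pact_wv -(yE tt).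
  exact: (ev_idem K0).
apply: (@W_step _ n unit (fun _ => evn) full Z _ _ C full) => //.
- by move=> U y _ _; apply: ev_in.
- by move=> U y _ y0; apply/ZE/ev_eq0/(y0 tt).
- by move=> U y _ /ZE ->; rewrite rpred0.
have [ka kx] : exists ka, pol ka (ev x) <> 0.
  by apply: contra_notP xn0 => /forallNP h; apply/ev_eq0/pol_eq0 => ka; apply: contrapT; apply: h.
have [s us] : exists s, pol ka (ev x) s <> 0.
  apply: contra_notP kx => /forallNP h; apply/ffunP => s.
  by rewrite [RHS]ffunE; apply: contrapT; apply: h.
have WCx := @W_polar Vnu n unit (fun _ => evn) full C X ka x xC isT.
have := W_delta s^-1%g WCx; set v1 := vof _ => Wv1.
have v11 : vj tt v1 1%g = pol ka (ev x) s.
  by rewrite /v1 vofK gm_deltar invgK mul1g vofK.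
move: v1 Wv1 v11 => v1 Wv1 v11.
have Cf : sfle C full by [].
have ev1 := WE _ (W_le Cf Wv1).
have [a aE] := yidem_line K0 (vj tt v1) nE.
(* The coefficients at 1 of v1 e and of e v1 = v1 agree by the trace property, and the latter was
   arranged to be nonzero. *)
have a0 : a != 0.
  apply/eqP => a0; move: aE; rewrite a0 scale0r ev1 => /ffunP/(_ 1%g).
  by rewrite gm_tr ev1 [RHS]ffunE v11.
have We : W (fun _ : unit => evn) full C (vof (fun _ => e)).
  have := WD a^-1 (W_gm e Wv1) (W0 _ _ _); rewrite addr0; congr (W _ _ _).
  by apply: vj_eq => -[]; rewrite vjZ !vofK -{1}ev1 aE scalerA mulVf ?scale1r.
move=> v Wv; have := W_gm (vj tt v) We; congr (W _ _ _).
by apply: vj_eq => -[]; rewrite !vofK WE.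
Qed.

Section Jump.
Variables (F : functor D) (J : finType).
Variables (lo hi : subfunctor F) (A B : subfunctor F).
Hypothesis sAB : simple_factor A B.
Hypothesis Blo : forall X x, x \in B X -> x \in lo X -> x \in A X.

Section Degree.
Variable P : nat.
Variable th : J -> nattrans F (tensor_power D P).
Hypothesis th_in : forall X x, x \in hi X -> forall j, th j X x \in S P X.
Hypothesis th_ker : forall X x, x \in hi X -> (forall j, th j X x = 0) -> x \in lo X.

(** If P < n, polarization in degree n sends x into [lo], hence into [A], so every polarization of f
    x vanishes and x is in [A]. If n < P, polarization in degree P kills the values of f; the
    polarized element is then in [A] while its images under [th] are kept, and [W_step] applies. *)
Lemma factor_iso_degree : ~ (forall X x, x \in B X -> x \in hi X -> x \in A X) ->
  factor_iso A B Vnu -> P = n.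
Proof.
move=> nBA [f [fl fn fk _]]; have [AB _ _] := sAB.
apply: contra_notP nBA => /eqP; rewrite neq_ltn => /orP[Pn|nP] X x xB xh.
  rewrite -fk // ; apply/eqP/ev_eq0/pol_eq0 => ka.
  pose Bs := flatten [seq letters (th j X x : tpow K (bc_basis X) P) | j <- enum J] ++ letters (ev (f X x)).
  have [ga [g1 g2]] := pz_pol pz ka Bs.
  have yA : lact ga x \in A (X0 n).
    apply: Blo; first exact: lact_mem.
    apply: th_ker => [|j]; first exact: lact_mem.
    rewrite nt_lact g2 //; apply: lettersP => i ij; rewrite mem_cat; apply/orP; left.
    by apply/flattenP; exists (letters (th j X x : tpow K (bc_basis X) P)) => //; apply: map_f; rewrite mem_enum.
  apply: (wv_inj (pz_inj pz (n:=n))); rewrite linear0 -g1; last first.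
    by apply: lettersP => i ij; rewrite mem_cat ij orbT.
  rewrite -[X in lact ga X]/(evn X (f X x)) -nt_lact -(lact_nat fl fn) //.
  by have := yA; rewrite -fk ?lact_mem // => /eqP ->; rewrite linear0.
apply: (W_step th_in th_ker AB Blo _ xB xh) => v [y [yB yh yE]].
have [ga [g1 _ g3]] := polar_lact th (@w P) y (letters (ev (f _ y))).
exists (lact ga y); split=> [||j]; first 1 last.
- exact: lact_mem.
- by rewrite g1 yE pol_wv1 //; apply: pz_inj pz _.
rewrite -fk; last exact: lact_mem.
rewrite (lact_nat fl fn) //; apply/eqP/ev_eq0.
rewrite -[LHS]/(evn _ _) nt_lact; apply: g3 => //.
exact: lettersP.
Qed.

End Degree.
Section Weight.
Variable th : J -> nattrans F (tensor_power D n).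
Hypothesis th_in : forall X x, x \in hi X -> forall j, th j X x \in S n X.
Hypothesis th_ker : forall X x, x \in hi X -> (forall j, th j X x = 0) -> x \in lo X.
Hypothesis Bhi : forall X x, x \in B X -> exists2 a, a \in A X & x - a \in hi X.
Notation V := {ffun J * 'S_n -> K^o}.

Definition Efix (v : V) := forall j, gm (vj j v) e = vj j v.

(** The isomorphism transports multilinear vectors of [B] to those of V_nu, namely eA, with kernel
    those of [A]; the right e-fixed ones go to the line eAe. *)
Lemma weight_of_iso : factor_iso A B Vnu ->
  exists v0, [/\ W th hi B v0, Efix v0, ~ W th hi A v0 &
    forall v, W th hi B v -> Efix v -> exists c, W th hi A (- c *: v0 + v)].
Proof.
move=> [f [fl fn fk fs]]; have [AB _ _] := sAB.
have nE : n = sumn nu by [].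
have wI := pz_inj pz (n:=n).
(* A relation is used rather than a map: the multilinear vectors [v] of x and [u] of f x are read
   off from one common x. *)
pose Rel v u := exists x : F (X0 n), [/\ x \in B (X0 n), x \in hi (X0 n),
  forall j, th j (X0 n) x = wv (@w n) (vj j v) & ev (f (X0 n) x) = wv (@w n) u].
have RelA X (x : F X) : x \in B X -> f X x = 0 -> x \in A X.
  by move=> xB x0; rewrite -fk // x0.
have Rpol X (x : F X) ka : x \in B X -> x \in hi X ->
    Rel (vof (fun j => pol ka (th j X x))) (pol ka (ev (f X x))).
  move=> xB xh; have [ga [g1 g2 _]] := polar_lact th ka x (letters (ev (f X x))).
  exists (lact ga x); split=> [|||]; try exact: lact_mem.
    by move=> j; rewrite g1 vofK.
  rewrite (lact_nat fl fn) // -[LHS]/(evn _ _) nt_lact; apply: g2; exact: lettersP.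
have R1 v : W th hi B v -> exists u, Rel v u.
  move=> [x [xB xh xE]]; exists (pol (@w n) (ev (f _ x))).
  have := Rpol _ _ (@w n) xB xh; congr (Rel _ _).
  by apply: vj_eq => j; rewrite vofK xE pol_wv1.
have RB v u : Rel v u -> W th hi B v by move=> [x [xB xh xE _]]; exists x.
have R0 v : Rel v 0 -> W th hi A v.
  move=> [x [xB xh xE]]; rewrite linear0 => /ev_eq0 x0.
  by exists x; split=> //; apply: RelA.
have R0' v u : Rel v u -> W th hi A v -> u = 0.
  move=> [x [xB xh xE xu]] [y [yA yh yE]]; apply: (wv_inj wI); rewrite -xu linear0.
  have xA : x \in A (X0 n).
    rewrite -[x](subrK y) rpredD //; apply: Blo.
      by apply: submodB => //; apply: AB.
    by apply: th_ker => [|j]; [apply: submodB | rewrite linearB /= xE yE subrr].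
  by have := xA; rewrite -fk // => /eqP ->; rewrite linear0.
have RD a v u v' u' : Rel v u -> Rel v' u' -> Rel (a *: v + v') (a *: u + u').
  move=> [x [xB xh xE xu]] [y [yB yh yE yu]]; exists (a *: x + y).
  split; [exact: submodL|exact: submodL| |].
    by move=> j; rewrite (linearP (th j _)) vj_linear linearP /= xE yE.
  by rewrite fl // ev_linear linearP /= xu yu.
have Rdelta v u s : Rel v u ->
    Rel (vof (fun j => gm (vj j v) (fdelta K s))) (gm u (fdelta K s)).
  move=> [x [xB xh xE xu]]; have := Rpol _ _ (@w n \o s^-1%g) xB xh.
  have -> : pol (@w n \o s^-1%g) (ev (f _ x)) = gm u (fdelta K s).
    by rewrite xu (pol_wv wI) invgK.
  congr (Rel _ _).
  by apply: vj_eq => j; rewrite !vofK xE pol_wv ?invgK.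
have R00 : Rel 0 0.
  exists 0; rewrite !rpred0; split=> // [j|]; rewrite ?linear0 //.
  by have /eqP -> : f (X0 n) 0 == 0; rewrite ?fk ?rpred0 ?linear0.
have Rgm v u x : Rel v u -> Rel (vof (fun j => gm (vj j v) x)) (gm u x).
  move=> Rvu; have -> : vof (fun j => gm (vj j v) x) = \sum_s x s *: vof (fun j => gm (vj j v) (fdelta K s)).
    apply: vj_eq => j; rewrite vofK gm_expandr (linear_sum (vj j)); apply: eq_bigr => s _.
    by rewrite [RHS](vjZ j (x s)) vofK.
  rewrite (gm_expandr u); elim: (index_enum _) => [|s r IH]; first by rewrite !big_nil.
  by rewrite !big_cons; apply: RD => //; apply: Rdelta.
have Ridem v u : Rel v u -> gm e u = u.
  move=> [x [_ _ _ xu]]; apply: (wv_inj wI); rewrite -pact_wv -xu; exact: (ev_idem K0).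
have Rsurj u : gm e u = u -> exists v, Rel v u.
  move=> eu; have [||z zE] := @ev_surj K D nu (S n) S_sact (X0 n) (wv (@w n) u).
  - exact: pz_wv pz _ _.
  - by rewrite pact_wv eu.
  have [x xB xz] := fs _ z; have [a aA xah] := Bhi xB.
  have xaB : x - a \in B (X0 n) by apply: submodB => //; apply: AB.
  have fa : f (X0 n) a = 0 by apply/eqP; rewrite fk //; apply: AB.
  have fxa : f (X0 n) (x - a) = z.
    by rewrite -scaleN1r addrC fl ?fa ?scaler0 ?add0r //; apply: AB.
  have := Rpol _ _ (@w n) xaB xah; rewrite fxa zE pol_wv1 // => R.
  by eexists; exact: R.
(* The vector e belongs to V_nu; a preimage of it, multiplied by e on the right, is the required
   [v0]. *)
have [v Rv] := Rsurj e (yidemK K0 nE).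
have Rv0 := Rgm _ _ e Rv; rewrite yidemK // in Rv0.
set v0 := vof _ in Rv0; have Ev0 : Efix v0.
  by move=> j; rewrite /v0 !vofK -gmA yidemK.
exists v0; split=> //; first exact: RB Rv0.
  by move=> /(R0' _ _ Rv0)/eqP; rewrite (negPf (yidem_neq0 K0 nE)).
(* The image u of v' satisfies e u = u, and v' e = v' replaces it by u e = e u e, a multiple c of e;
   so v' - c v0 has image 0. *)
move=> v' Wv' Ev'; have [u Ru] := R1 _ Wv'.
have Rue := Rgm _ _ e Ru; have vE : vof (fun j => gm (vj j v') e) = v'.
  by apply: vj_eq => j; rewrite vofK Ev'.
rewrite vE in Rue; have [c cE] := yidem_line K0 u nE.
rewrite (Ridem _ _ Ru) in cE; rewrite cE in Rue.
have ce : - c *: e + c *: e = 0 by rewrite scaleNr addNr.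
by exists c; apply: R0; rewrite -ce; apply: RD.
Qed.

(** A linear form separating [v1] from [W A] is turned into a natural map from [hi] to the tensor
    power that kills [A]; followed by the Young idempotent it becomes a nonzero map from the simple
    factor to V_nu. *)
Lemma iso_of_weight v1 : W th hi B v1 -> Efix v1 -> ~ W th hi A v1 -> factor_iso A B Vnu.
Proof.
move=> Wv1 Ev1 nWv1; have [AB _ _] := sAB.
have nE : n = sumn nu by [].
have wI := pz_inj pz (n:=n).
have [U UE] := vspace_of_pred (W0 th hi A) (@WD F n J th hi A).
have [p pv1] : exists p, (v1 - projv U v1) p <> 0.
  apply: contra_notP nWv1 => /forallNP h; apply/UE.
  have -> : v1 = projv U v1.
    apply/eqP; rewrite -subr_eq0; apply/eqP/ffunP => q; rewrite [RHS]ffunE.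
    by apply: contrapT; apply: h.
  exact: memv_proj.
pose ell (v : V) : K := (v - projv U v) p.
have ell_lin a u v : ell (a *: u + v) = a * ell u + ell v.
  rewrite /ell linearP /= opprD addrACA -scalerBr.
  by rewrite ffunE [(_ *: _ : V) _]ffunE.
have ell0 v : W th hi A v -> ell v = 0.
  by move=> /UE vU; rewrite /ell projv_id // subrr ffunE.
have ell_sum I (r : seq I) (a : I -> K) (g : I -> V) :
    ell (\sum_(i <- r) a i *: g i) = \sum_(i <- r) a i * ell (g i).
  elim: r => [|i r IH]; last by rewrite !big_cons ell_lin IH.
  by rewrite !big_nil ell0 //; apply: W0.
(* Chosen so that [ell v] is the coefficient at 1 of the sum of the products L_j v_j. As [W A] is
   stable on the right, the vanishing of [ell] there makes the whole sum vanish. *)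
pose L j : {ffun 'S_n -> K^o} := [ffun s => ell (fdelta K (j, s^-1%g))].
have LE v : (\sum_j gm (L j) (vj j v)) 1%g = ell v.
  rewrite [in RHS](fdelta_sum v) ell_sum sum_ffunE.
  transitivity (\sum_j \sum_s v (j, s) * ell (fdelta K (j, s))); last first.
    by rewrite pair_bigA; apply: eq_bigr => -[j s] _.
  apply: eq_bigr => j _; rewrite ffunE (reindex_inj invg_inj); apply: eq_bigr => s _.
  by rewrite !ffunE !invgK mulg1 mulrC.
have LA v : W th hi A v -> \sum_j gm (L j) (vj j v) = 0.
  move=> Wv; apply/ffunP => s; rewrite [RHS]ffunE -(ell0 _ (W_delta s^-1%g Wv)) -LE.
  rewrite !sum_ffunE; apply: eq_bigr => j _; rewrite vofK gmA gm_deltar invgK mul1g.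
  by [].
pose Phi X (x : F X) : tpow K (bc_basis X) n := \sum_j pact (L j) (th j X x).
have Phi_lin X a x y : Phi X (a *: x + y) = a *: Phi X x + Phi X y.
  rewrite /Phi scaler_sumr -big_split; apply: eq_bigr => j _.
  by rewrite linearP (linearP (pact (L j))).
have PhiA X x : x \in A X -> x \in hi X -> Phi X x = 0.
  move=> xA xh; apply: pol_eq0 => ka; rewrite /Phi linear_sum.
  rewrite -[RHS](LA _ (W_polar th ka xA xh)); apply: eq_bigr => j _.
  by rewrite vofK -pol_pact.
have Phi_nat X Y (h : bc_hom X Y) x : Phi Y (fmap F h x) = tmap (bc_map h) (Phi X x).
  rewrite /Phi (linear_sum (@tmap K _ _ (bc_map h) n)); apply: eq_bigr => j _.
  by rewrite nt_nat -tmap_pact.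
have Phi_in X x : x \in hi X -> Phi X x \in S n X.
  by move=> xh; rewrite rpred_sum // => j _; apply: (pact_mem S_sact); apply: th_in.
have Phi_eq X (y y' : F X) : y \in hi X -> y' \in hi X -> y - y' \in A X -> Phi X y = Phi X y'.
  move=> yh y'h yA; have := Phi_lin X 1 (y - y') y'; rewrite !scale1r subrK => ->.
  by rewrite PhiA ?add0r //; apply: submodB.
have PhiW (x : F (X0 n)) v : (forall j, th j _ x = wv (@w n) (vj j v)) ->
    Phi _ x = wv (@w n) (\sum_j gm (L j) (vj j v)).
  move=> xE; rewrite /Phi linear_sum; apply: eq_bigr => j _.
  by rewrite xE pact_wv.
clearbody Phi.
(* An element of [B] is first moved into [hi] by an element of [A]. The choice does not affect the
   value, since [Phi] kills [A] inside [hi]. *)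
pose Rel X (x : F X) (z : Vnu X) := exists y, [/\ y \in B X, y \in hi X, x - y \in A X & ev z = pact e (Phi X y)].
have Rel_ex X (x : F X) : x \in B X -> exists z : Vnu X, Rel X x z.
  move=> xB; have [a aA xah] := Bhi xB.
  have [||z zE] := @ev_surj K D nu (S n) S_sact X (pact e (Phi X (x - a))).
  - by apply: (pact_mem S_sact); apply: Phi_in.
  - by rewrite pactM yidemK.
  exists z, (x - a); split=> //; first by apply: submodB => //; apply: AB.
  by rewrite opprB addrC subrK.
have Rel_uniq X (x : F X) (z z' : Vnu X) : Rel X x z -> Rel X x z' -> z = z'.
  move=> [y [yB yh yA yE]] [y' [y'B y'h y'A y'E]]; apply: ev_inj; rewrite yE y'E.
  have yy : y - y' \in A X by have := submodB y'A yA; rewrite opprB addrC addrA subrK.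
  exact: congr1 (Phi_eq _ _ _ yh y'h yy).
have fex X (x : F X) : exists z : Vnu X, x \in B X -> Rel X x z.
  have [xB|xB] := boolP (x \in B X); last by exists 0.
  by have [z zR] := Rel_ex _ _ xB; exists z.
pose f X (x : F X) : Vnu X := xget 0 [set z | x \in B X -> Rel X x z]%classic.
have fP X (x : F X) : x \in B X -> Rel X x (f X x).
  have [z zP] := fex X x; rewrite /f.
  exact: (@xgetPex _ 0 [set z | x \in B X -> Rel X x z]%classic (fex X x)).
clearbody f.
have fA X (x : F X) : x \in A X -> f X x = 0.
  move=> xA; apply: Rel_uniq (fP _ _ (AB _ _ xA)) _; exists 0.
  rewrite !rpred0 subr0; split=> //; rewrite linear0.
  by have := Phi_lin X (-1) 0 0; rewrite scaler0 addr0 scaleN1r addNr => ->; rewrite linear0.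
apply: (@factor_iso_of_hom K D F Vnu A B f) => //.
- exact: specht_hom_simple.
- move=> X a x x' xB x'B; apply: Rel_uniq (fP _ _ (submodL a xB x'B)) _.
  have [y [yB yh yA yE]] := fP _ _ xB; have [y' [y'B y'h y'A y'E]] := fP _ _ x'B.
  exists (a *: y + y'); split; [exact: submodL|exact: submodL| |].
    by rewrite opprD addrACA -scalerBr; apply: submodL.
  by rewrite ev_linear yE y'E Phi_lin linearP.
- move=> X Y h x xB; apply: Rel_uniq (fP _ _ (sf_stable h xB)) _.
  have [y [yB yh yA yE]] := fP _ _ xB; exists (fmap F h y).
  split; [exact: sf_stable|exact: sf_stable| |].
    by rewrite -linearB; apply: sf_stable.
  by rewrite ev_nat yE Phi_nat tmap_pact.
- have [x1 [x1B x1h x1E]] := Wv1; exists (X0 n), x1; split=> //.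
  have [y [yB yh yA yE]] := fP _ _ x1B; apply/eqP => f0.
  have zR : Rel _ x1 0 by rewrite -f0; apply: fP.
  have [y' [y'B y'h y'A]] := zR; rewrite linear0 => /esym y'E.
  (* It remains to see that e u is nonzero: its coefficient at 1 is that of u e = u, which is
     [ell v1]. *)
  pose u := \sum_j gm (L j) (vj j v1).
  move: y'E; rewrite -(Phi_eq _ _ _ x1h y'h y'A) (PhiW _ _ x1E) -/u pact_wv => y'E.
  have := wv_inj wI (etrans y'E (esym (linear0 (wv (@w n))))).
  move=> /ffunP/(_ 1%g); rewrite gm_tr [RHS]ffunE.
  have -> : gm u e = u.
    rewrite /u gm_suml; apply: eq_bigr => j _; by rewrite -gmA Ev1.
  by rewrite LE; apply: pv1.
Qed.

End Weight.
End Jump.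

End Simple.
End Layer.

Section Layered.
Variables (K : fieldType) (K0 : [pchar K] =i pred0) (D : basedCat K).
Variables (S : forall n, subfunctor (tensor_power D n)).
Variables (X0 : nat -> bc_ob D) (w : forall n, 'I_n -> bc_basis (X0 n)).
Hypothesis pz : polarizable S w.
Variables (F : functor D) (J : finType) (nu : intpart).
Notation Vnu := (specht_hom (S (sumn nu))).

Definition yfix P (v : {ffun J * 'S_P -> K^o}) :=
  forall j, gm (vj j v) (yidem K P nu) = vj j v.

Lemma yfixD P a (u v : {ffun J * 'S_P -> K^o}) : yfix u -> yfix v -> yfix (a *: u + v).
Proof. by move=> yu yv j; rewrite vj_linear gm_linearl yu yv. Qed.

Lemma yfix0 P : yfix (0 : {ffun J * 'S_P -> K^o}).
Proof. by move=> j; rewrite linear0 gm0l. Qed.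

Lemma jump_dim P (th : J -> nattrans F (tensor_power D P)) (lo hi A B : subfunctor F)
    (UA UB : {vspace {ffun J * 'S_P -> K^o}}) : P = sumn nu ->
  simple_factor A B ->
  (forall X x, x \in B X -> x \in lo X -> x \in A X) ->
  (forall X x, x \in hi X -> forall j, th j X x \in S P X) ->
  (forall X x, x \in hi X -> (forall j, th j X x = 0) -> x \in lo X) ->
  (forall X x, x \in B X -> exists2 a, a \in A X & x - a \in hi X) ->
  (forall v, v \in UA <-> W w th hi A v /\ yfix v) ->
  (forall v, v \in UB <-> W w th hi B v /\ yfix v) ->
  \dim UB = (\dim UA + `[< factor_iso A B Vnu >])%N.
Proof.
move=> eP; subst P => sAB Blo th_in th_ker Bhi UAE UBE; have [AB _ _] := sAB.
have sUAB : (UA <= UB)%VS.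
  by apply/subvP => v /UAE[Wv Ev]; apply/UBE; split=> //; apply: W_le Wv.
case: asboolP => [iso|niso]; last first.
  rewrite addn0; congr (\dim _); apply/eqP; rewrite eqEsubv sUAB andbT.
  apply/subvP => v /UBE[Wv Ev]; apply/UAE; split=> //; apply: contrapT => nW.
  exact: niso (iso_of_weight K0 pz sAB th_in Bhi Wv Ev nW).
have [v0 [Wv0 Ev0 nWv0 h]] := weight_of_iso K0 pz sAB Blo th_ker Bhi iso.
have v0UA : v0 \notin UA by apply/negP => /UAE[].
have -> : UB = (UA + <[v0]>)%VS.
  apply/eqP; rewrite eqEsubv; apply/andP; split; last first.
    by rewrite subv_add sUAB -memvE; apply/UBE.
  apply/subvP => v /UBE[Wv Ev]; have [c Wc] := h _ Wv Ev.
  have -> : v = (- c *: v0 + v) + c *: v0 by rewrite addrAC scaleNr addNr add0r.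
  apply: memv_add; last by rewrite memvZ ?memv_line.
  by apply/UAE; split; [|exact: yfixD].
rewrite dimv_disjoint_sum ?dim_vline; last first.
  apply/eqP; rewrite -subv0; apply/subvP => x; rewrite memv_cap => /andP[xU /vlineP[a xE]].
  have [a0|a0] := eqVneq a 0; first by rewrite xE a0 scale0r mem0v.
  by case/negP: v0UA; rewrite -(scale1r v0) -(mulVf a0) -scalerA -xE memvZ.
by congr (_ + nat_of_bool _)%N; apply: contraNneq v0UA => ->; rewrite mem0v.
Qed.

Variables (L : nat) (P : nat -> nat).
Variable th : forall k, J -> nattrans F (tensor_power D (P k)).
Variable Fs : nat -> subfunctor F.
Hypothesis Fs0 : forall X x, x \in Fs 0 X -> x = 0.
Hypothesis FsL : forall X x, x \in Fs L X.
Hypothesis Fs_le : forall k, sfle (Fs k) (Fs k.+1).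
Hypothesis th_in : forall k, (k < L)%N -> forall X x, x \in Fs k.+1 X ->
  forall j, th k j X x \in S (P k) X.
Hypothesis th_ker : forall k, (k < L)%N -> forall X x, x \in Fs k.+1 X ->
  (forall j, th k j X x = 0) -> x \in Fs k X.
Hypothesis lo_ker : forall k, (k < L)%N -> forall X x, x \in Fs k X ->
  forall j, th k j X x = 0.
Hypothesis P_inj : forall k l, (k < L)%N -> (l < L)%N -> P k = P l -> k = l.

Notation Wk k := (W w (th k) (Fs k.+1)).

Lemma Fs_mono k l : (k <= l)%N -> sfle (Fs k) (Fs l).
Proof.
move=> /subnK <-; elim: (l - k)%N => [|m IH] X x xk //.
by rewrite addSn; apply/Fs_le/IH.
Qed.

Lemma filtration_ind (A B : subfunctor F) : (forall k, (k < L)%N ->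
    (forall X x, x \in B X -> x \in Fs k X -> x \in A X) ->
    (forall X x, x \in B X -> x \in Fs k.+1 X -> x \in A X)) -> sfle B A.
Proof.
move=> step X x xB; suff main k : (k <= L)%N -> forall X x, x \in B X -> x \in Fs k X -> x \in A X.
  exact: main (leqnn _) _ _ xB (FsL _).
elim: k => [_ Y y _ /Fs0 ->|k IH kL]; first by rewrite rpred0.
by apply: step => //; apply/IH/ltnW.
Qed.

(** The layer k is the one where the filtered parts of [B] first leave [A]. Simplicity applied to
    [A] enlarged by the part of [B] in [Fs k.+1] gives all of [B]; elements can then be changed
    modulo [A] so that the higher layers see no difference. *)
Lemma jump_layer (A B : subfunctor F) : simple_factor A B -> exists k, [/\ (k < L)%N,
  forall X x, x \in B X -> x \in Fs k X -> x \in A X,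
  forall X x, x \in B X -> exists2 a, a \in A X & x - a \in Fs k.+1 X,
  ~ (forall X x, x \in B X -> x \in Fs k.+1 X -> x \in A X) &
  forall l, (l < L)%N -> l != k -> forall v, Wk l B v -> Wk l A v].
Proof.
move=> [AB nBA sAB].
have [k [kL Blo nB]] : exists k, [/\ (k < L)%N,
    forall X x, x \in B X -> x \in Fs k X -> x \in A X &
    ~ (forall X x, x \in B X -> x \in Fs k.+1 X -> x \in A X)].
  apply: contra_notP nBA => /forallNP h; apply: filtration_ind => k kL Blo.
  by apply: contrapT => nB; apply: (h k).
have [|||C CE] := @subfunctor_of_prop K D F
    (fun X x => exists2 a, a \in A X & x - a \in B X /\ x - a \in Fs k.+1 X).
- by move=> X; exists 0; rewrite ?subr0 ?rpred0.
- move=> X c x y [a aA [xB xF]] [b bA [yB yF]]; exists (c *: a + b); first exact: submodL.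
  by rewrite opprD addrACA -scalerBr; split; apply: submodL.
- move=> X Y h x [a aA [xB xF]]; exists (fmap F h a); first exact: sf_stable.
  by rewrite -linearB; split; apply: sf_stable.
have BC : sfle B C.
  have [||CA|//] := sAB C.
  - by move=> X x xA; apply/CE; exists x; rewrite ?subrr ?rpred0.
  - by move=> X x /CE[a aA [xB _]]; rewrite -[x](subrK a) rpredD // AB.
  case: nB => X x xB xF; apply: CA; apply/CE.
  by exists 0; rewrite ?rpred0 ?subr0.
have Bhi X x : x \in B X -> exists2 a, a \in A X & x - a \in Fs k.+1 X.
  by move=> /BC/CE[a aA []]; exists a.
exists k; split=> // l lL; rewrite neq_ltn => /orP[lk|kl] v [x [xB xF xE]].
  by exists x; split=> //; apply: Blo => //; apply: (Fs_mono lk).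
have [a aA xa] := Bhi _ _ xB.
have xal : x - a \in Fs l (X0 (P l)) by apply: (Fs_mono kl).
exists a; split=> //.
  rewrite -[a](subrK x) rpredD // -opprB -scaleN1r rpredZ //.
  exact: (Fs_mono (leqnSn l)).
move=> j; rewrite -xE; apply/eqP; rewrite eq_sym -subr_eq0 -linearB.
by rewrite lo_ker.
Qed.

Lemma Wspace_ex k A : exists U : {vspace {ffun J * 'S_(P k) -> K^o}}, forall v, v \in U <-> Wk k A v.
Proof. by apply: vspace_of_pred => [|a x y]; [apply: W0 | apply: WD]. Qed.

Definition Wspace k A := sval (cid (Wspace_ex k A)).

Lemma WspaceP k A v : v \in Wspace k A <-> Wk k A v.
Proof. exact: svalP (cid (Wspace_ex k A)) v. Qed.

Definition weight_length A := (\sum_(k < L) \dim (Wspace k A))%N.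

(** If no layer grew, all spaces of multilinear vectors would agree, and [W_step] applied layer by
    layer would put [B] inside [A]. *)
Lemma weight_length_lt (A B : subfunctor F) : sfle A B -> ~ sfle B A -> (weight_length A < weight_length B)%N.
Proof.
move=> AB nBA; have sub k : (Wspace k A <= Wspace k B)%VS.
  by apply/subvP => v /WspaceP Wv; apply/WspaceP; apply: W_le Wv.
rewrite ltn_neqAle; apply/andP; split; last first.
  by apply: leq_sum => k _; apply: dimvS.
apply: contra_notN nBA => /eqP E; apply: filtration_ind => k kL Blo.
apply: (W_step pz (th_in kL) (th_ker kL) AB Blo) => v /WspaceP.
suff -> : Wspace k B = Wspace k A by move/WspaceP.
apply/esym/eqP; rewrite -(geq_leqif (dimv_leqif_eq (sub k))).
have := leqif_sum (fun (i : 'I_L) (_ : true) => leqif_eq (dimvS (sub i))).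
rewrite /weight_length in E; rewrite E => -[_]; rewrite eqxx => /esym/forallP/(_ (Ordinal kL))/= /eqP ->.
exact: leqnn.
Qed.

Lemma Espace_ex k A : exists U : {vspace {ffun J * 'S_(P k) -> K^o}},
  forall v, v \in U <-> Wk k A v /\ yfix v.
Proof.
apply: vspace_of_pred => [|a x y [Wx Ex] [Wy Ey]].
  by split; [apply: W0 | apply: yfix0].
by split; [apply: WD | apply: yfixD].
Qed.

(** The additive function is the dimension of the right e-fixed vectors of layer k. A simple factor
    located in another layer changes nothing there, and it is not V_nu because the degrees [P] are
    distinct. *)
Lemma multiplicity_layer k (U : {vspace {ffun J * 'S_(P k) -> K^o}}) :
  (k < L)%N -> P k = sumn nu ->
  (forall v, v \in U <-> Wk k (full_subfunctor F) v /\ yfix v) ->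
  multiplicity F Vnu (\dim U).
Proof.
move=> kL eP UE; pose Esp A := sval (cid (Espace_ex k A)).
have EspP A v : v \in Esp A <-> Wk k A v /\ yfix v by exact: svalP (cid (Espace_ex k A)) v.
apply: (@multiplicity_of_additive K D F Vnu weight_length (fun A => \dim (Esp A))).
- exact: weight_length_lt.
- move=> A B sAB; have [l [lL Blo Bhi nB jE]] := jump_layer sAB; have [AB _ _] := sAB.
  have [lk|lk] := eqVneq l k.
    subst l; exact: (@jump_dim _ (th k) _ _ A B _ _ eP sAB Blo (th_in kL) (th_ker kL) Bhi (EspP A) (EspP B)).
  have -> : Esp B = Esp A.
    apply/eqP; rewrite eqEsubv; apply/andP; split; apply/subvP => v /EspP[Wv Ev]; apply/EspP; split=> //.
      by apply: jE => //; rewrite eq_sym.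
    exact: W_le Wv.
  case: asboolP => [iso|]; rewrite ?addn0 //.
  have := factor_iso_degree pz sAB Blo (th_in lL) (th_ker lL) nB iso.
  by rewrite -eP => /(P_inj lL kL) E; rewrite E eqxx in lk.
- move=> A A0; apply/eqP; rewrite dimv_eq0 -subv0; apply/subvP => v /EspP[[x [xA _ xE]] _].
  rewrite memv0; apply/eqP/vj_eq => j; rewrite linear0.
  by apply: (wv_inj (pz_inj pz (n:=_))); rewrite -xE (A0 _ _ xA) !linear0.
- move=> A Afull; congr (\dim _); apply/eqP; rewrite eqEsubv; apply/andP; split; apply/subvP => v.
    by move=> /EspP[Wv Ev]; apply/UE; split=> //; apply: W_le Wv.
  by move=> /UE[Wv Ev]; apply/EspP; split=> //; apply: W_le Wv.
Qed.

Lemma multiplicity_no_layer : (forall k, (k < L)%N -> P k <> sumn nu) -> multiplicity F Vnu 0.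
Proof.
move=> nP; apply: (@multiplicity_of_additive K D F Vnu weight_length (fun=> 0%N)) => //.
  exact: weight_length_lt.
move=> A B sAB; have [l [lL Blo Bhi nB jE]] := jump_layer sAB.
case: asboolP => // iso.
by case: (nP l lL); exact: (factor_iso_degree pz sAB Blo (th_in lL) (th_ker lL) nB iso).
Qed.

End Layered.

(** * Tensor products *)

Section Bilinear.
Variables (K : fieldType) (U W Z : lmodType K) (b : U -> W -> Z).
Hypothesis bl : forall w, linear (b^~ w).
Hypothesis br : forall u, linear (b u).

Let bp (p : U * W) : Z := b p.1 p.2.

Let rel0 x : x \in lspan (@bilin_rel K U W) -> lext bp x = 0.
Proof.
move=> xR; apply/eqP; rewrite -(Defs.kerE (lext bp)).
apply: lspan_min xR => y yR; rewrite Defs.kerE; apply/eqP.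
case: yR => [[a [u1 [u2 [w ->]]]]|[a [u [w1 [w2 ->]]]]].
  by rewrite linearB /= linearP /= !lextU /bp /= bl subrr.
by rewrite linearB /= linearP /= !lextU /bp /= br subrr.
Qed.

Definition tlift (x : tprod U W) : Z :=
  lext (fun p : U * W => b p.1 p.2) (generic_quotient.repr (x : Quotient.quot _)).

Lemma tlift_proj x : tlift (quot_proj _ x) = lext bp x.
Proof.
apply/eqP; rewrite -subr_eq0 -linearB; apply/eqP; apply: rel0.
by apply/quot_projE; apply: quot_projK.
Qed.

Lemma tlift_linear : linear tlift.
Proof.
move=> a x y; rewrite -(quot_projK x) -(quot_projK y) -linearP.
by rewrite !tlift_proj linearP.
Qed.

Lemma tlift_ptens u w : tlift (ptens u w) = b u w.
Proof. by rewrite tlift_proj lextU. Qed.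

Lemma tlift_sum (s : seq (U * W)) :
  tlift (\sum_(p <- s) ptens p.1 p.2) = \sum_(p <- s) b p.1 p.2.
Proof.
pose f := HB.pack_for {linear tprod U W -> Z} tlift (GRing.isLinear.Build K _ _ *:%R tlift tlift_linear).
rewrite -[LHS]/(f _) linear_sum; apply: eq_bigr => p _; exact: tlift_ptens.
Qed.

Lemma tprod_sum (x : tprod U W) : exists s : seq (U * W), x = \sum_(p <- s) ptens p.1 p.2.
Proof.
rewrite -(quot_projK x); move: (generic_quotient.repr _) => {}x.
exists [seq (x@_p *: p.1, p.2) | p <- msupp x].
rewrite big_map [in LHS](malg_sumU x) /lext linear_sum; apply: eq_bigr => p _ /=.
have := ptens_linearl p.2 x@_p p.1 0; rewrite addr0 => ->.
have -> : ptens 0 p.2 = 0 :> tprod U W.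
  by have := ptens_linearl p.2 (-1) (0 : U) 0; rewrite scaler0 addr0 scaleN1r addNr.
by rewrite addr0 linearZ; case: p.
Qed.

(* Replaces a dependent family of left factors by a shorter one. *)
Lemma bilinear_elim (c : U * W -> K) (p0 : U * W) (s : seq (U * W)) :
  c p0 != 0 -> \sum_(p <- p0 :: s) c p *: p.1 = 0 ->
  \sum_(p <- p0 :: s) b p.1 p.2 =
  \sum_(p <- [seq (p.1, - (c p / c p0) *: p0.2 + p.2) | p <- s]) b p.1 p.2.
Proof.
move=> c0; rewrite !big_cons big_map /= => E.
have bZ u a w : b u (a *: w) = a *: b u w.
  have b0 : b u 0 = 0 by have := br u (-1) 0 0; rewrite scaler0 addr0 scaleN1r addNr.
  by have := br u a w 0; rewrite addr0 b0 addr0.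
under [RHS]eq_bigr do rewrite br.
rewrite big_split /=; congr (_ + _).
have -> : p0.1 = \sum_(p <- s) (- (c p / c p0)) *: p.1.
  apply: (scalerI c0); move/eqP: E; rewrite addr_eq0 => /eqP ->.
  rewrite scaler_sumr -sumrN; apply: eq_bigr => p _.
  by rewrite scalerA mulrN mulrC divfK // scaleNr.
elim: (s) => [|p r IH]; rewrite ?big_nil ?big_cons.
  by have := bl p0.2 (-1) 0 0; rewrite scaler0 addr0 scaleN1r addNr.
by rewrite bl IH.
Qed.

End Bilinear.

Lemma linear_of_mcoeff (K : fieldType) (I J : choiceType) (f : {malg K[I]} -> {malg K[J]})
    (c : J -> K) (g : J -> I) :
  (forall w z, (f w)@_z = c z * w@_(g z)) -> linear f.
Proof.
move=> fE a x y; apply/malgP => z.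
by rewrite mcoeffD mcoeffZ !fE mcoeffD mcoeffZ mulrDr mulrCA.
Qed.

Section Concatenation.
Variables (K : fieldType) (I : choiceType) (n m : nat).

Definition catw (i : {ffun 'I_n -> I}) (j : {ffun 'I_m -> I}) : {ffun 'I_(n + m) -> I} :=
  [ffun k : 'I_(n + m) => match fintype.split k with inl a => i a | inr b => j b end].

Definition leftw (z : {ffun 'I_(n + m) -> I}) : {ffun 'I_n -> I} := [ffun a : 'I_n => z (lshift m a)].
Definition rightw (z : {ffun 'I_(n + m) -> I}) : {ffun 'I_m -> I} := [ffun b : 'I_m => z (rshift n b)].

Lemma catw_l i j a : catw i j (lshift m a) = i a.
Proof. by rewrite ffunE (unsplitK (inl a)). Qed.

Lemma catw_r i j b : catw i j (rshift n b) = j b.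
Proof. by rewrite ffunE (unsplitK (inr b)). Qed.

Lemma catw_eqP i j z : (catw i j == z) = (i == leftw z) && (j == rightw z).
Proof.
apply/eqP/andP => [<-|[/eqP -> /eqP ->]].
  by split; apply/eqP/ffunP => k; rewrite ffunE ?catw_l ?catw_r.
by apply/ffunP => k; rewrite ffunE; case: fintype.splitP => u uk; rewrite ffunE; congr (z _); apply: val_inj; rewrite /= uk.
Qed.

Definition tcat (t : tpow K I n) (u : tpow K I m) : tpow K I (n + m) :=
  lext (fun i => lext (fun j => (<< catw i j >> : tpow K I (n + m))) u) t.

Lemma mcoeff_tcat t u z : (tcat t u)@_z = t@_(leftw z) * u@_(rightw z).
Proof.
rewrite /tcat {1}/lext raddf_sum /= [in RHS](malg_sumU t) /lext raddf_sum /= mulr_suml.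
apply: eq_bigr => i _; rewrite !mcoeffZ mcoeffU -mulrA; congr (_ * _).
rewrite raddf_sum /= [in RHS](malg_sumU u) /lext raddf_sum /= mulr_sumr.
apply: eq_bigr => j _; rewrite !mcoeffZ !mcoeffU catw_eqP mulrCA; congr (_ * _).
by rewrite -mulnb natrM.
Qed.

Lemma tcat_linearl u : linear (tcat^~ u).
Proof. by move=> a x y; apply/malgP => z; rewrite mcoeffD mcoeffZ !mcoeff_tcat mcoeffD mcoeffZ mulrDl mulrA. Qed.

Lemma tcat_linearr t : linear (tcat t).
Proof.
exact: (linear_of_mcoeff (fun w z => mcoeff_tcat t w z)).
Qed.

HB.instance Definition _ t := GRing.isLinear.Build K _ _ *:%R (tcat t) (tcat_linearr t).

Definition tcatr u t := tcat t u.
HB.instance Definition _ u := GRing.isLinear.Build K _ _ *:%R (tcatr u) (tcat_linearl u).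

Lemma tcatU i j : tcat << i >> << j >> = << catw i j >>.
Proof. by rewrite /tcat !lextU. Qed.

Fact psum_inj (s : 'S_n) (t : 'S_m) : injective (fun k : 'I_(n + m) =>
  match fintype.split k with inl a => lshift m (s a) | inr b => rshift n (t b) end).
Proof.
move=> k l; rewrite -[k]splitK -[l]splitK !unsplitK.
case: (fintype.split k) => a; case: (fintype.split l) => b /=.
- by move/(congr1 val) => /= /val_inj/perm_inj ->.
- by move/(congr1 val) => /= E; have := ltn_ord (s a); rewrite E; lia.
- by move/(congr1 val) => /= E; have := ltn_ord (s b); rewrite -E; lia.
- by move/(congr1 val) => /= /addnI/val_inj/perm_inj ->.
Qed.

Definition psum s t : 'S_(n + m) := perm (@psum_inj s t).

Lemma psum_l s t a : psum s t (lshift m a) = lshift m (s a).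
Proof. by rewrite permE (unsplitK (inl a)). Qed.

Lemma psum_r s t b : psum s t (rshift n b) = rshift n (t b).
Proof. by rewrite permE (unsplitK (inr b)). Qed.

Lemma psum_ext (s s' : 'S_(n + m)) : (forall a, s (lshift m a) = s' (lshift m a)) ->
  (forall b, s (rshift n b) = s' (rshift n b)) -> s = s'.
Proof. by move=> hl hr; apply/permP => k; rewrite -(splitK k); case: (fintype.split k) => u /=. Qed.

Lemma psumM s s' t t' : (psum s t * psum s' t')%g = psum (s * s')%g (t * t')%g.
Proof. by apply: psum_ext => u; rewrite permM !(psum_l, psum_r) permM. Qed.

Lemma psum1 : psum 1 1 = 1%g.
Proof. by apply: psum_ext => u; rewrite !(psum_l, psum_r) !perm1. Qed.

Lemma psumV s t : (psum s t)^-1%g = psum s^-1%g t^-1%g.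
Proof. by apply/eqP; rewrite eq_invg_mul psumM !mulgV psum1. Qed.

Lemma sact_tcat s t x y : sact (psum s t) (tcat x y) = tcat (sact s x) (sact t y).
Proof.
apply/malgP => z; rewrite mcoeff_sact !mcoeff_tcat !mcoeff_sact psumV.
by congr (_ * _); congr (mcoeff _ _); apply/ffunP => k; rewrite !ffunE ?psum_l ?psum_r.
Qed.

Definition gtens (x : {ffun 'S_n -> K^o}) (y : {ffun 'S_m -> K^o}) : {ffun 'S_(n + m) -> K^o} :=
  \sum_s \sum_t (x s * y t) *: fdelta K (psum s t).

Lemma pact_tcat x y t u : pact (gtens x y) (tcat t u) = tcat (pact x t) (pact y u).
Proof.
apply/malgP => z; rewrite mcoeff_tcat /gtens pact_sum raddf_sum /=.
rewrite /pact !raddf_sum /= big_distrlr /=; apply: eq_bigr => s _.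
rewrite -/(pact _ _) pact_sum raddf_sum /=; apply: eq_bigr => r _.
by rewrite pactZ pact_delta sact_tcat !mcoeffZ mcoeff_tcat mulrACA.
Qed.

End Concatenation.

Lemma tmap_tcat (K : fieldType) (I J : choiceType) (g : {malg K[I]} -> {malg K[J]})
    n m (t : tpow K I n) (u : tpow K I m) :
  tmap g (tcat t u) = tcat (tmap g t) (tmap g u).
Proof.
move: u; apply: (@malg_linear_eq K _ _ (@tmap K I J g (n + m) \o tcat t) (tcat (tmap g t) \o @tmap K I J g m)) => j /=.
suff H : (@tmap K I J g (n + m) \o @tcatr K I n m << j >>) =1 (@tcatr K J n m (tmap g << j >>) \o @tmap K I J g n) by exact: H t.
apply: malg_linear_eq => i; rewrite -[LHS]/(tmap g (tcat << i >> << j >>)) -[RHS]/(tcat (tmap g << i >>) (tmap g << j >>)).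
rewrite tcatU !tmapU; apply/malgP => z; rewrite mcoeff_tcat !mcoeff_tens big_split_ord /=.
congr (_ * _); apply: eq_bigr => k _; first by rewrite catw_l [leftw z k]ffunE.
by rewrite catw_r [rightw z k]ffunE.
Qed.

Section TensorEmbedding.
Variables (K : fieldType) (K0 : [pchar K] =i pred0) (D : basedCat K).
Variables (S : forall n, subfunctor (tensor_power D n)) (la mu : intpart).
Notation n := (sumn la).
Notation m := (sumn mu).
Notation F := (tensor (specht_hom (S n)) (specht_hom (S m))).

Definition temb_fun X (z : F X) : tpow K (bc_basis X) (n + m) :=
  tlift (fun (f : specht_hom (S n) X) (g : specht_hom (S m) X) => tcat (ev f) (ev g)) z.

Let bl X (g : specht_hom (S m) X) : linear (fun f : specht_hom (S n) X => tcat (ev f) (ev g)).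
Proof. by move=> a x y; rewrite ev_linear tcat_linearl. Qed.

Let br X (f : specht_hom (S n) X) : linear (fun g : specht_hom (S m) X => tcat (ev f) (ev g)).
Proof. by move=> a x y; rewrite ev_linear tcat_linearr. Qed.

Fact temb_linear X : linear (@temb_fun X).
Proof. exact: tlift_linear (@bl X) (@br X). Qed.

HB.instance Definition _ X := GRing.isLinear.Build K (F X) (tpow K (bc_basis X) (n + m)) *:%R
  (@temb_fun X) (@temb_linear X).

Lemma temb_ptens X (f : specht_hom (S n) X) (g : specht_hom (S m) X) :
  temb_fun (ptens f g : F X) = tcat (ev f) (ev g).
Proof. exact: tlift_ptens (@bl X) (@br X) f g. Qed.

Lemma tensor_ind X (Q : F X -> Prop) :
  Q 0 -> (forall x y, Q x -> Q y -> Q (x + y)) -> (forall f g, Q (ptens f g)) ->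
  forall z, Q z.
Proof.
move=> Q0 QD Qp z; have [s ->] := tprod_sum z.
elim: s => [|p s IH]; first by rewrite big_nil.
by rewrite big_cons; apply: QD.
Qed.

Fact temb_nat X Y (h : bc_hom X Y) (z : F X) :
  temb_fun (fmap F h z) = tmap (bc_map h) (temb_fun z).
Proof.
move: z; apply: tensor_ind => [|x y xE yE|f g]; first by rewrite !linear0.
  rewrite (linearD (fmap F h)); apply: etrans (linearD (@temb_fun Y) _ _) _.
  apply: etrans (congr2 +%R xE yE) _; rewrite -(linearD (@tmap K _ _ (bc_map h) (n + m))).
  by congr (tmap _ _); rewrite (linearD (@temb_fun X)).
by rewrite temb_ptens tmap_tcat -!ev_nat -temb_ptens; congr temb_fun; apply: tprod_map_ptens.
Qed.

Definition temb : nattrans F (tensor_power D (n + m)) :=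
  @Nattrans K D F (tensor_power D (n + m)) (fun X => @temb_fun X) temb_nat.

Lemma temb_idem X (z : F X) :
  pact (gtens (yidem K n la) (yidem K m mu)) (temb_fun z) = temb_fun z.
Proof.
move: z; apply: tensor_ind => [|x y xE yE|f g]; first by rewrite !linear0.
  rewrite (linearD (@temb_fun X)); apply: etrans (linearD (pact _) _ _) _.
  exact: (congr2 +%R xE yE).
by rewrite temb_ptens pact_tcat !(ev_idem K0).
Qed.

(** Induction on the number of pure tensors. A nonzero coefficient of the right factor of the first
    term gives a linear dependence among the left factors, and [bilinear_elim] removes one term both
    in the tensor product and in its image. *)
Lemma temb_eq0 X (z : F X) : temb_fun z = 0 -> z = 0.
Proof.
have [s ->] := tprod_sum z.
rewrite /temb_fun (tlift_sum (@bl X) (@br X)).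
move: {2}(size s) (erefl (size s)) => r; elim: r s => [|r IH] [|p0 s] //= sz E; rewrite ?big_nil //; case: sz => sz.
have [w0|w0] := eqVneq p0.2 0.
  have p00 : ptens p0.1 p0.2 = 0 :> tprod (specht_hom (S n) X) (specht_hom (S m) X).
    rewrite w0; have := ptens_linearr p0.1 (-1) (0 : specht_hom (S m) X) 0.
    by rewrite scaler0 addr0 scaleN1r addNr.
  rewrite big_cons p00 add0r; apply: IH => //.
  by move: E; rewrite big_cons /= w0 (_ : ev 0 = 0) // [X in X + _ = _](_ : _ = 0) ?add0r //; apply: (linear0 (@tcat _ _ _ _ _)).
have [b wb] : exists b, (ev p0.2)@_b != 0.
  apply: contrapT => /forallNP h; case/eqP: w0; apply/ev_eq0/malgP => b.
  by rewrite mcoeff0; apply/eqP; apply: contrapT => /negP/h.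
pose c (p : specht_hom (S n) X * specht_hom (S m) X) := (ev p.2)@_b.
have cE : \sum_(p <- p0 :: s) c p *: p.1 = 0.
  apply: ev_eq0; rewrite linear_sum; apply/malgP => a; rewrite mcoeff0.
  move: E => /(congr1 (mcoeff (catw a b))); rewrite mcoeff0 => <-.
  rewrite !raddf_sum; apply: eq_bigr => p _ /=; rewrite linearZ mcoeffZ mcoeff_tcat mulrC.
  by congr (_ * _); congr (mcoeff _ _); apply/ffunP => k; rewrite ffunE ?catw_l ?catw_r.
rewrite (bilinear_elim (@ptens_linearl _ _ _) (@ptens_linearr _ _ _) wb cE).
rewrite (bilinear_elim (@bl X) (@br X) wb cE) in E.
by apply: IH => //; rewrite size_map.
Qed.

End TensorEmbedding.

(** * Polarization *)

Section InclusionExclusion.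
Variables (K : fieldType) (n m : nat).
Implicit Types (o : {ffun 'I_m -> option 'I_n}).

Definition iesign (J : {set 'I_n}) : K := \prod_j (if j \in J then 1 else -1).

Definition covers o := [forall j, exists p, o p == Some j].

(** Inclusion-exclusion: [o] tells which positions receive a fresh letter and which one, and the
    alternating sum over the allowed sets of letters keeps only the choices using every letter. *)
Lemma iesign_sum o :
  \sum_(J : {set 'I_n}) iesign J * \prod_p (if o p is Some j then (j \in J)%:R else 1) = (covers o)%:R.
Proof.
have prodE (J : {set 'I_n}) : \prod_p (if o p is Some j then (j \in J)%:R else 1) =
    \prod_j (if j \in J then 1 else (~~ [exists p, o p == Some j])%:R) :> K.
  have [sub|/existsP[p]] := boolP [forall p, if o p is Some j then j \in J else true].
    rewrite big1 ?[RHS]big1 // => [j _|p _]; last by have := forallP sub p; case: (o p) => // j ->.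
    case: ifPn => // jJ; case: existsP => // -[p /eqP op].
    by have := forallP sub p; rewrite op (negPf jJ).
  case op: (o p) => [j|//] jJ; rewrite (bigD1 p) //= op (negPf jJ) mul0r.
  rewrite (bigD1 j) //= (negPf jJ); case: existsP => [_|[]]; first by rewrite mul0r.
  by exists p; rewrite op.
transitivity (\prod_j (1 - (~~ [exists p, o p == Some j])%:R) : K).
  rewrite bigA_distr big_mkcond /=; apply: eq_bigr => J _; rewrite prodE -big_split /=.
  by apply: eq_bigr => j _; case: ifP => _; rewrite ?mulr1 ?mul1r ?mulN1r.
have [/forallP cov|/forallPn[j nj]] := boolP (covers o).
  by rewrite big1 // => j _; rewrite cov subr0.
by rewrite (bigD1 j) //= nj subrr mul0r.
Qed.

Lemma covers_gt o : covers o -> (n <= m)%N.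
Proof.
move=> /forallP cov; have /fin_all_exists[f fP] : forall j, exists p, o p == Some j.
  by move=> j; apply/existsP.
have fI : injective f.
  by move=> j j' E; have := fP j; rewrite E (eqP (fP j')) => /eqP[].
by have := leq_card f fI; rewrite !card_ord.
Qed.
End InclusionExclusion.

Section Polarization.
Variables (K : fieldType) (I L : choiceType) (n : nat) (ka : 'I_n -> I) (w : 'I_n -> L).
Variables (u : I -> {malg K[L]}) (B : seq I).
Variable G : {set 'I_n} -> {malg K[I]} -> {malg K[L]}.
Hypothesis GE : forall J i, i \in B -> G J << i >> = u i + \sum_(j in J | ka j == i) << w j >>.

(** The two kinds of terms of [G J] at position p: the part [u] for [None], the fresh letter [w j]
    for [Some j]. *)
Let cf m (i : {ffun 'I_m -> I}) (z : {ffun 'I_m -> L}) p (oj : option 'I_n) : K :=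
  if oj is Some j then (ka j == i p)%:R * (w j == z p)%:R else (u (i p))@_(z p).

Let word_expand m (i : {ffun 'I_m -> I}) z : (forall p, i p \in B) ->
  (\sum_J iesign K J *: tmap (G J) (<< i >> : tpow K I m))@_z =
  \sum_(o : {ffun 'I_m -> option 'I_n} | covers o) \prod_p cf i z p (o p).
Proof.
move=> iB; rewrite raddf_sum /=.
transitivity (\sum_J \sum_(o : {ffun 'I_m -> option 'I_n}) iesign K J *
    ((\prod_p (if o p is Some j then (j \in J)%:R else 1)) * \prod_p cf i z p (o p))).
  apply: eq_bigr => J _; rewrite mcoeffZ tmapU mcoeff_tens -mulr_sumr; congr (_ * _).
  under [RHS]eq_bigr do rewrite -big_split /=.
  rewrite -(bigA_distr_bigA (fun p oj => (if oj is Some j then (j \in J)%:R else 1) * cf i z p oj)) /=.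
  apply: eq_bigr => p _; rewrite GE // mcoeffD; rewrite raddf_sum /=.
  rewrite (bigD1 None) //= mul1r; congr (_ + _).
  rewrite [RHS](reindex_omap Some id) /=; last by case.
  rewrite [LHS]big_mkcond /= [RHS]big_mkcond /=; apply: eq_bigr => j _.
  rewrite eqxx; case: (j \in J) => /=; last by rewrite mul0r.
  by case: (ka j == i p); rewrite ?mcoeff0 ?mul0r ?mul1r ?mcoeffU.
rewrite exchange_big [RHS]big_mkcond /=; apply: eq_bigr => o _.
under eq_bigr do rewrite mulrA.
by rewrite -mulr_suml iesign_sum; case: ifP => _; rewrite ?mul1r ?mul0r.
Qed.

Let extend m (h : {linear tpow K I m -> tpow K L m}) t :
  (forall i : {ffun 'I_m -> I}, (forall p, i p \in B) ->
     \sum_J iesign K J *: tmap (G J) (<< i >> : tpow K I m) = h << i >>) ->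
  letters_in B t -> \sum_J iesign K J *: tmap (G J) t = h t.
Proof.
move=> hE tB; rewrite [in RHS](malg_sumU t) /lext linear_sum /=.
transitivity (\sum_(i <- msupp t) t@_i *: (\sum_J iesign K J *: tmap (G J) (<< i >> : tpow K I m))).
  under [RHS]eq_bigr do rewrite scaler_sumr.
  rewrite exchange_big /=; apply: eq_bigr => J _.
  rewrite {1}(malg_sumU t) /lext (linear_sum (@tmap K I L (G J) m)) scaler_sumr.
  by apply: eq_bigr => i _; rewrite linearZ /= !scalerA mulrC.
rewrite big_seq [RHS]big_seq; apply: eq_bigr => i; rewrite -mcoeff_neq0 => ti.
by rewrite hE ?linearZ //; apply: tB.
Qed.

Lemma polarize_low m (t : tpow K I m) : (m < n)%N -> letters_in B t ->
  \sum_J iesign K J *: tmap (G J) t = 0.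
Proof.
move=> mn tB; rewrite (@extend m (@GRing.null_fun (tpow K I m) (tpow K L m)) t) // => i iB; apply/malgP => z.
rewrite word_expand // big1 ?mcoeff0 // => o /covers_gt; by rewrite leqNgt mn.
Qed.

(** Only the terms using each of the n fresh letters survive. With n positions these use each letter
    once, so they are indexed by permutations; with fewer positions there are none
    ([polarize_low]). *)
Lemma polarize (t : tpow K I n) : letters_in B t ->
  \sum_J iesign K J *: tmap (G J) t = wv w (pol ka t).
Proof.
move=> tB; rewrite (@extend n (wv w \o pol ka) t) // => i iB; apply/malgP => z.
rewrite word_expand //= /wv raddf_sum /=.
pose h (s : 'S_n) : {ffun 'I_n -> option 'I_n} := [ffun p => Some (s p)].
have hI : injective h.
  by move=> s s' E; apply/permP => p; move/ffunP/(_ p): E; rewrite !ffunE => -[].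
have cE o : covers o = (o \in [set h s | s : 'S_n]).
  apply/idP/imsetP => [/forallP cov|[s _ ->]]; last first.
    by apply/forallP => j; apply/existsP; exists (s^-1%g j); rewrite ffunE permKV.
  have /fin_all_exists[f fP] : forall j, exists p, o p == Some j.
    by move=> j; apply/existsP.
  have fI : injective f.
    by move=> j j' E; have := fP j; rewrite E (eqP (fP j')) => /eqP[].
  exists (perm fI)^-1%g => //; apply/ffunP => p; rewrite ffunE.
  by have := fP ((perm fI)^-1%g p); rewrite -[f _](permE fI) permKV => /eqP.
rewrite (eq_bigl _ _ cE) big_imset /=; last by move=> s s' _ _; apply: hI.
rewrite (eq_bigl xpredT) => [|s]; last by rewrite inE.
apply: eq_bigr => s _; rewrite mcoeffZ !ffunE !mcoeffU /cf.
have prodb (P Q : pred 'I_n) : \prod_p ((P p)%:R * (Q p)%:R) = ([forall p, P p] && [forall p, Q p])%:R :> K.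
  have [/andP[/forallP p1 /forallP q1]|] := boolP (_ && _).
    by rewrite big1 // => p _; rewrite p1 q1 mulr1.
  rewrite negb_and => /orP[] /forallPn[p np].
    by rewrite (bigD1 p) //= (negPf np) !mul0r.
  by rewrite (bigD1 p) //= (negPf np) mulr0 mul0r.
rewrite (eq_bigr (fun p => (ka (s p) == i p)%:R * (w (s p) == z p)%:R)) => [|p _]; last by rewrite ffunE.
rewrite (prodb (fun p => ka (s p) == i p) (fun p => w (s p) == z p)) -mulnb natrM.
congr ((nat_of_bool _)%:R * (nat_of_bool _)%:R).
  apply/forallP/eqP => [E|-> p]; last by rewrite ffunE.
  by apply/ffunP => p; rewrite ffunE (eqP (E p)).
apply/forallP/eqP => [E|<- p]; last by rewrite ffunE.
by apply/ffunP => p; rewrite ffunE (eqP (E p)).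
Qed.
End Polarization.

Section VecPolarizable.
Variables (K : fieldType) (K0 : [pchar K] =i pred0).
Notation VS n := (full_subfunctor (tensor_power (Vec K) n)).

Definition Vec_letter n : 'I_n -> bc_basis (b := Vec K) n := id.

Lemma lact_tpow_list (D : basedCat K) (T : finType) X Y (c : T -> K) (g : T -> bc_hom X Y) m
    (t : tpow K (bc_basis X) m) :
  lact (F := tensor_power D m) [seq (c J, g J) | J <- enum T] t =
  \sum_J c J *: tmap (bc_map (g J)) t.
Proof. by rewrite /lact big_map big_enum. Qed.

Lemma Vec_pol d n (ka : 'I_n -> 'I_d) : exists ga : seq (K * bc_hom (b := Vec K) d n),
    (forall t : tpow K 'I_d n, lact (F := tensor_power (Vec K) n) ga t = wv (@Vec_letter n) (pol ka t)) /\
    (forall m (t : tpow K 'I_d m), (m < n)%N -> lact (F := tensor_power (Vec K) m) ga t = 0).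
Proof.
pose G (J : {set 'I_n}) : {linear {malg K['I_d]} -> {malg K['I_n]}} :=
  lext (fun i => \sum_(j in J | ka j == i) << j >>).
have GE J i : i \in enum 'I_d -> G J << i >> = 0 + \sum_(j in J | ka j == i) << (@Vec_letter n) j >>.
  by move=> _; rewrite add0r; apply: lextU.
have allB m (t : tpow K 'I_d m) : letters_in (enum 'I_d) t by move=> i _ k; rewrite mem_enum.
exists [seq (iesign K J, G J : bc_hom (b := Vec K) d n) | J : {set 'I_n} <- enum {set 'I_n}]; split=> [t|m t mn].
  by rewrite (@lact_tpow_list (Vec K)); apply: (polarize GE).
by rewrite (@lact_tpow_list (Vec K)); apply: (polarize_low GE).
Qed.

Lemma malg_sum_words (I : finType) n (t : {malg K[{ffun 'I_n -> I}]}) :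
  t = \sum_(i : {ffun 'I_n -> I}) t@_i *: << i >>.
Proof.
apply/malgP => z; rewrite raddf_sum (bigD1 z) //= mcoeffZ mcoeffU eqxx mulr1.
by rewrite big1 ?addr0 // => i /negPf iz; rewrite mcoeffZ mcoeffU iz mulr0.
Qed.

Lemma Vec_polarizable : polarizable (D := Vec K) (fun n => VS n) Vec_letter.
Proof.
split=> //.
- by move=> n i j.
- move=> X n ka B; have [ga [g1 g2]] := Vec_pol ka.
  by exists ga; split=> [t _|m t mn _]; [apply: g1 | apply: g2].
- move=> n J U U0 UD Uh d t _ tU.
  pose q (ka : {ffun 'I_n -> 'I_d}) : bc_hom (b := Vec K) n d :=
    (lext (fun j : 'I_n => (<< ka j >> : {malg K['I_d]})) : {linear {malg K['I_n]} -> {malg K['I_d]}}).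
  have Usum (T : finType) (F : T -> J -> tpow K 'I_d n) : (forall i, U d (F i)) ->
      U d (fun j => \sum_i F i j).
    move=> UF; have h r : U d (fun j => \sum_(i <- r) F i j).
      elim: r => [|i r IH].
        by have := U0 d; congr (U d _); apply/funext => j; rewrite big_nil.
      have := UD _ 1 _ _ (UF i) IH; congr (U d _).
      by apply/funext => j; rewrite scale1r big_cons.
    exact: h.
  have n0 : n`!%:R != 0 :> K by apply: natr_neq0 => //; apply: fact_gt0.
  (* Substituting ka j for the j-th letter in the polarization along [ka] gives the rearrangements
     of [ka], weighted as in [t]; over all [ka] each word is met n! times. *)
  have tE j : t j = n`!%:R^-1 *: \sum_(ka : {ffun 'I_n -> 'I_d})
      tmap (bc_map (q ka)) (wv (@Vec_letter n) (pol ka (t j))).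
    apply: (scalerI n0); rewrite scalerA divff // scale1r.
    under eq_bigr => ka _.
      rewrite /wv linear_sum.
      under eq_bigr => s _.
        rewrite linearZ /=.
        have -> : tmap (bc_map (q ka)) (<< [ffun j0 => Vec_letter (s j0)] >> : tpow K 'I_n n)
            = << [ffun k => ka (s k)] >> :> tpow K 'I_d n.
          rewrite tmapU -tensU; congr tens; apply/funext => k; rewrite ffunE; exact: lextU.
        rewrite ffunE; over.
      over.
    rewrite exchange_big /= (eq_bigr (fun=> t j)).
      by rewrite sumr_const scaler_nat -card_Sn; congr (_ *+ _); apply: eq_card.
    move=> s _; rewrite [RHS]malg_sum_words.
    pose h (ka : {ffun 'I_n -> 'I_d}) : {ffun 'I_n -> 'I_d} := [ffun k => ka (s k)].
    rewrite [RHS](reindex_inj (h := h)) //.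
    move=> ka ka' E; apply/ffunP => k; move/ffunP/(_ (s^-1%g k)): E.
    by rewrite !ffunE permKV.
  have := UD _ n`!%:R^-1 _ _ (Usum _ _ (fun ka : {ffun 'I_n -> 'I_d} => Uh _ _ (q ka) _ (tU ka))) (U0 d).
  by congr (U d _); apply/funext => j; rewrite addr0 [RHS]tE.
Qed.

End VecPolarizable.

(** * Littlewood-Richardson coefficients and characters *)

Lemma multiplicity_uniq (K : fieldType) (D : basedCat K) (F G : functor D) m m' :
  multiplicity F G m -> multiplicity F G m' -> m = m'.
Proof. by move=> [[l [A sA]] h] [_ h']; rewrite -(h _ _ sA) (h' _ _ sA). Qed.

Section GroupTensor.
Variables (K : fieldType) (n m : nat).

Lemma chi_pairingV (p : nat) (f : 'S_p -> K) (x : {ffun 'S_p -> K^o}) :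
  (forall s t, f (t^-1 * s * t)%g = f s) ->
  p`!%:R * (\sum_s x s * f s) = \sum_s chi x s * f s.
Proof.
move=> fJ; have := chi_pairing x (f := fun s => f s^-1%g) (fun s t => _).
rewrite (eq_bigr (fun s => x s * f s)) => [|s _]; last by rewrite invgK.
rewrite [RHS](eq_bigr (fun s => chi x s * f s)) => [|s _]; last by rewrite invgK.
by apply=> s t; rewrite -(fJ s^-1%g t) !invMg invgK mulgA.
Qed.

Lemma gtens_sum (x : {ffun 'S_n -> K^o}) (y : {ffun 'S_m -> K^o}) (f : 'S_(n + m) -> K) :
  \sum_u gtens x y u * f u = \sum_s \sum_t x s * y t * f (psum s t).
Proof.
under eq_bigr do rewrite /gtens sum_ffunE mulr_suml.
rewrite exchange_big; apply: eq_bigr => s _ /=.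
under eq_bigr do rewrite sum_ffunE mulr_suml.
rewrite exchange_big; apply: eq_bigr => t _ /=.
rewrite (bigD1 (psum s t)) //= !ffunE eqxx big1 ?addr0 => [|u /negPf us].
  by rewrite /GRing.scale /= mulr1.
by rewrite !ffunE us scaler0 mul0r.
Qed.

(** Checked on a word with distinct letters, on which the group algebra acts faithfully. *)
Lemma gtens_idem (x : {ffun 'S_n -> K^o}) (y : {ffun 'S_m -> K^o}) :
  gm x x = x -> gm y y = y -> gm (gtens x y) (gtens x y) = gtens x y.
Proof.
move=> xx yy; pose w (k : 'I_(n + m)) := k.
have wI : injective w by [].
have wE : wv w (fdelta K 1%g) = tcat << leftw [ffun k => w k] >> << rightw [ffun k => w k] >>.
  rewrite wv_delta tcatU; congr << _ >>; apply/esym/eqP; rewrite catw_eqP.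
  by apply/andP; split; apply/eqP; congr (_ _); apply/ffunP => k; rewrite !ffunE perm1.
apply: (wv_inj wI); rewrite -[gtens x y in RHS]gm1r -[gm _ _ in LHS]gm1r -!pact_wv.
rewrite -pactM.
rewrite wE.
rewrite pact_tcat.
rewrite pact_tcat.
rewrite (pactM x x) xx.
rewrite (pactM y y) yy; reflexivity.
Qed.

Lemma class_psum (f : 'S_(n + m) -> K) : (forall s t, f (t^-1 * s * t)%g = f s) ->
  forall s t u v, f (psum (u^-1 * s * u)%g (v^-1 * t * v)%g) = f (psum s t).
Proof. by move=> fJ s t u v; rewrite -(fJ (psum s t) (psum u v)) psumV !psumM. Qed.

Lemma class_psum_l (f : 'S_(n + m) -> K) t : (forall s u, f (u^-1 * s * u)%g = f s) ->
  forall s u, f (psum (u^-1 * s * u)%g t) = f (psum s t).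
Proof. by move=> fJ s u; rewrite -(class_psum fJ s t u 1%g) invg1 mul1g mulg1. Qed.

Lemma class_psum_r (f : 'S_(n + m) -> K) s : (forall s u, f (u^-1 * s * u)%g = f s) ->
  forall t u, f (psum s (u^-1 * t * u)%g) = f (psum s t).
Proof. by move=> fJ t u; rewrite -(class_psum fJ s t 1%g u) invg1 mul1g mulg1. Qed.

Lemma gtens_pairing (x : {ffun 'S_n -> K^o}) (y : {ffun 'S_m -> K^o}) (f : 'S_(n + m) -> K) :
  (forall s t, f (t^-1 * s * t)%g = f s) ->
  n`!%:R * m`!%:R * (\sum_u gtens x y u * f u) =
  \sum_s \sum_t chi x s * chi y t * f (psum s t).
Proof.
move=> fJ; rewrite gtens_sum -mulrA mulr_sumr.
have E s : m`!%:R * (\sum_t x s * y t * f (psum s t)) = x s * \sum_t chi y t * f (psum s t).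
  under eq_bigr do rewrite -mulrA.
  rewrite -mulr_sumr mulrCA chi_pairingV //; exact: class_psum_r.
under eq_bigr do rewrite E.
rewrite (@chi_pairingV n (fun s => \sum_t chi y t * f (psum s t))); last first.
  by move=> s u; apply: eq_bigr => t _; rewrite class_psum_l.
by apply: eq_bigr => s _; rewrite mulr_sumr; apply: eq_bigr => t _; rewrite mulrA.
Qed.
End GroupTensor.

Section LRformula.
Variables (K : fieldType) (K0 : [pchar K] =i pred0) (la mu nu : intpart).
Notation n := (sumn la).
Notation m := (sumn mu).
Notation VS n := (full_subfunctor (tensor_power (Vec K) n)).
Notation F := (tensor (schur K la) (schur K mu)).
Notation ee := (gtens (yidem K n la) (yidem K m mu)).
Notation N := (n + m)%N.

Let i0 : nattrans F (tensor_power (Vec K) N) := @temb K (Vec K) (fun n => VS n) la mu.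
Let th (k : nat) (_ : unit) := i0.

Lemma temb_full_word X (z : {ffun 'I_N -> 'I_X}) : exists y : F X,
  i0 X y = pact ee (<< z >> : tpow K 'I_X N).
Proof.
have zE : << z >> = tcat << leftw z >> << rightw z >> :> tpow K 'I_X N.
  by rewrite tcatU; congr << _ >>; apply/esym/eqP; rewrite catw_eqP !eqxx.
have [f fE] : exists f : schur K la X, ev f = pact (yidem K n la) << leftw z >>.
  apply: ev_surj; [exact: (fun _ _ _ _ => isT) | exact: isT|].
  by rewrite pactM (yidemK K0).
have [g gE] : exists g : schur K mu X, ev g = pact (yidem K m mu) << rightw z >>.
  apply: ev_surj; [exact: (fun _ _ _ _ => isT) | exact: isT|].
  by rewrite pactM (yidemK K0).
exists (ptens f g); rewrite zE pact_tcat -fE -gE; exact: temb_ptens.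
Qed.

(** All words are available in the full tensor power, so the Young idempotents of the two factors
    give the only condition. *)
Lemma W_schur v : W (@Vec_letter K) (th 0) (full_subfunctor F) (full_subfunctor F) v <->
  gm ee (vj tt v) = vj tt v.
Proof.
have wI : injective (@Vec_letter K N) by [].
split=> [[x [_ _ xE]]|vE].
  apply: (wv_inj wI); rewrite -pact_wv -(xE tt); exact: temb_idem.
have /choice[y yE] : forall s : 'S_N, exists y : F N,
    i0 N y = pact ee (<< [ffun j => @Vec_letter K N (s j)] >> : tpow K 'I_N N).
  by move=> s; apply: temb_full_word.
exists (\sum_s (vj tt v s : K) *: y s); split=> // -[].
rewrite -[in RHS]vE -pact_wv /wv linear_sum [RHS]linear_sum; apply: eq_bigr => s _.
by rewrite linearZ [RHS]linearZ /= -yE.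
Qed.

Lemma multiplicity_schur_tensor :
  (sumn nu = N -> exists U : {vspace {ffun unit * 'S_N -> K^o}},
     (forall v, v \in U <-> gm ee (vj tt v) = vj tt v /\ yfix nu v) /\
     multiplicity F (schur K nu) (\dim U)) /\
  (sumn nu <> N -> multiplicity F (schur K nu) 0).
Proof.
have [Z ZE] := zero_subfunctor F.
(* A filtration with a single layer, detected by the embedding into the tensor power. *)
pose Fs k := if k is 0%N then Z else full_subfunctor F.
have Fs0 X x : x \in Fs 0 X -> x = 0 by move/ZE.
have FsL X x : x \in Fs 1 X by [].
have Fs_le k : sfle (Fs k) (Fs k.+1) by [].
have th_in k : (k < 1)%N -> forall X x, x \in Fs k.+1 X -> forall j, th k j X x \in VS N X by [].
have th_ker k : (k < 1)%N -> forall X x, x \in Fs k.+1 X -> (forall j, th k j X x = 0) -> x \in Fs k X.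
  by case: k => // _ X x _ /(_ tt) x0; apply/ZE; exact: (temb_eq0 x0).
have lo_ker k : (k < 1)%N -> forall X x, x \in Fs k X -> forall j, th k j X x = 0.
  by case: k => // _ X x /ZE -> j; rewrite linear0.
have P_inj k l : (k < 1)%N -> (l < 1)%N -> N = N -> k = l by case: k l => // -[].
have pz := Vec_polarizable K0.
split=> [eN|neN]; last first.
  exact: (multiplicity_no_layer (P := fun=> N) pz Fs0 FsL Fs_le th_in th_ker lo_ker (fun k _ => nesym neN)).
have [||U UE] := @vspace_of_pred K {ffun unit * 'S_N -> K^o} (fun v => gm ee (vj tt v) = vj tt v /\ yfix nu v).
- by split; [rewrite linear0 gm0r | apply: yfix0].
- move=> a x y [ex fx] [ey fy]; split; last exact: yfixD.
  by rewrite vj_linear gm_linearr ex ey.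
exists U; split=> //.
apply: (multiplicity_layer (P := fun=> N) K0 pz Fs0 FsL Fs_le th_in th_ker lo_ker P_inj (k := 0%N)) => // v.
rewrite UE; split=> -[v1 v2]; split=> //; exact/W_schur.
Qed.

Lemma LR_eq0 : sumn nu <> N -> LR K nu la mu = 0%N.
Proof.
move=> /(multiplicity_schur_tensor.2) M; rewrite /LR.
apply: (@xget_unique _ 0%N [set x | multiplicity F (schur K nu) x]%classic 0%N M).
by move=> y My; apply: multiplicity_uniq My M.
Qed.

(** The layer consists of the v with v = ee v = v e, and its dimension is the trace of v |-> ee v
    e. *)
Lemma LR_char : sumn nu = N ->
  n`!%:R * m`!%:R * (LR K nu la mu)%:R =
  \sum_(s : 'S_n) \sum_(t : 'S_m) ychar K la s * ychar K mu t * ychar K nu (psum s t) :> K.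
Proof.
move=> eN; have [U [UE M]] := multiplicity_schur_tensor.1 eN.
have -> : LR K nu la mu = \dim U.
  apply: (@xget_unique _ 0%N [set x | multiplicity F (schur K nu) x]%classic (\dim U) M).
  by move=> y My; apply: multiplicity_uniq My M.
pose e := yidem K N nu.
have eK : gm e e = e by apply: yidemK.
have eeK : gm ee ee = ee by apply: gtens_idem; apply: yidemK.
pose B (v : {ffun unit * 'S_N -> K^o}) : {ffun unit * 'S_N -> K^o} := vof (fun j => gm (gm ee (vj j v)) e).
have := @trace_dim K _ U B 1 _ _ _; rewrite mul1r => <-.
- rewrite -(gtens_pairing (yidem K n la) (yidem K m mu) (f := ychar K nu)); last exact: ycharJ.
  congr (_ * _); transitivity (\sum_s gm (gm ee (fdelta K s)) e s); last first.
    rewrite trace_gm; apply: eq_bigr => s _; congr (_ * _); exact: ycharV.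
  rewrite (reindex (fun s : 'S_N => (tt, s))) /=; last by exists snd => [s|[[] s]].
  apply: eq_bigr => s _; rewrite ffunE /=; congr (gm (gm ee _) e s).
  by apply/ffunP => t; rewrite !ffunE.
- move=> a x y; apply: vj_eq => j; rewrite vj_linear !vofK vj_linear.
  by rewrite gm_linearr gm_linearl.
- move=> v; apply/UE; split=> [|j]; rewrite !vofK; first by rewrite !gmA eeK.
  by rewrite -gmA eK.
- move=> v /UE[ev fv]; rewrite scale1r; apply: vj_eq => -[].
  by rewrite vofK ev fv.
Qed.

End LRformula.

(** * Elements of the orthogonal group *)

(** The index of the basis vector dual to the i-th one: indices start at 0, so the hyperbolic pairs
    are 2k, 2k + 1. *)
Definition prt (i : nat) : nat := if odd i then i.-1 else i.+1.

Lemma prtE (b : bool) h : prt (b + h.*2) = (~~ b + h.*2)%N.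
Proof. by rewrite /prt oddD odd_double addbF oddb; case: b. Qed.

Variant pair_spec : nat -> Type := PairSpec (b : bool) h : pair_spec (b + h.*2).

Lemma pairP i : pair_spec i.
Proof. by rewrite -[i]odd_double_half; constructor. Qed.

Lemma prtK : involutive prt.
Proof. by move=> i; case: (pairP i) => b h; rewrite !prtE negbK. Qed.

Lemma prt_neq i : prt i != i.
Proof. by case: (pairP i) => -[] h; rewrite prtE /=; apply/eqP; lia. Qed.

Lemma prt_lt i d : (prt i < d.*2)%N = (i < d.*2)%N.
Proof. by case: (pairP i) => -[] h; rewrite prtE /=; apply/idP/idP; lia. Qed.

Section Orth.
Variables (K : fieldType).
Notation V := {malg K[nat]}.

Lemma omegaU i j : omega << i >> << j >> = (j == prt i)%:R :> K.
Proof.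
rewrite (@omegaE K i.+1) => [|k ik]; last by rewrite mcoeffU; case: eqP => // E; lia.
under eq_bigr do rewrite !mcoeffU -!natrM -natrD.
have hi : (i./2 < i.+1)%N by lia.
rewrite (bigD1 (Ordinal hi)) //= big1 => [|k kh]; last first.
  have {}kh : i./2 <> k by move=> E; case/eqP: kh; apply: val_inj; rewrite /= E.
  have -> : (i == k.*2) = false by apply/eqP => E; apply: kh; lia.
  by have -> : (i == k.*2.+1) = false by apply/eqP => E; apply: kh; lia.
rewrite addr0 /prt; have := odd_double_half i; case: (odd i) => /= iE.
  have -> : (i == i./2.*2) = false by apply/eqP; lia.
  have -> : (i == i./2.*2.+1) by apply/eqP; lia.
  by rewrite mul0n mul1n add0n; congr ((nat_of_bool _)%:R); apply/eqP/eqP; lia.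
have -> : (i == i./2.*2.+1) = false by apply/eqP; lia.
have -> : (i == i./2.*2) by apply/eqP; lia.
by rewrite mul0n mul1n addn0; congr ((nat_of_bool _)%:R); apply/eqP/eqP; lia.
Qed.

Lemma omega0l (x : V) : omega 0 x = 0.
Proof. by have := omega_linearl x (-1) 0 0; rewrite scaler0 addr0 mulN1r addNr. Qed.

Lemma omega_preserve (g : {linear V -> V}) :
  (forall i j, omega (g << i >>) (g << j >>) = omega << i >> << j >>) ->
  forall x y, omega (g x) (g y) = omega x y.
Proof.
move=> gU.
have lin (z : V) : linear (fun x : V => omega x z : K^o) by move=> a x y; apply: omega_linearl.
pose O z := HB.pack_for {linear V -> K^o} (fun x : V => omega x z : K^o)
  (GRing.isLinear.Build K V K^o *:%R _ (lin z)).
have h j x : omega (g x) (g << j >>) = omega x << j >>.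
  by apply: (@malg_linear_eq K nat K^o (O (g << j >>) \o g) (O << j >>)) => i /=.
move=> x y; rewrite !(omegaC _ y) omegaC.
by apply: (@malg_linear_eq K nat K^o (O (g x) \o g) (O x)) => i /=; rewrite omegaC h omegaC.
Qed.

Lemma lext_cancel (f f' : nat -> V) : (forall i, lext f (f' i) = << i >>) -> cancel (lext f') (lext f).
Proof.
move=> E x; apply: (@malg_linear_eq K nat V (lext f \o lext f') idfun) => i /=.
by rewrite lextU.
Qed.

Lemma Oinf_of (f f' : nat -> V) d :
  (forall i, lext f (f' i) = << i >>) -> (forall i, lext f' (f i) = << i >>) ->
  (forall i, (d <= i)%N -> f i = << i >>) ->
  (forall i j, (i < d)%N -> (d <= j)%N -> (f i)@_j = 0) ->
  (forall i j, omega (f i) (f j) = omega << i >> << j >>) ->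
  exists g : Oinf K, forall i, oinf_map g << i >> = f i.
Proof.
move=> ff' f'f fd fdj fo.
have gG : in_GLinf (lext f : {linear V -> V}).
  split; first by exists (lext f'); apply: lext_cancel.
  exists d; split=> [i di|i j id dj]; first exact: etrans (lextU f i) (fd i di).
  exact: etrans (congr1 (mcoeff j) (lextU f i)) (fdj i j id dj).
have go : forall x y, omega (lext f x) (lext f y) = omega x y.
  apply: (@omega_preserve (lext f : {linear V -> V})) => i j.
  exact: etrans (congr2 (@omega K) (lextU f i) (lextU f j)) (fo i j).
by exists (OinfElt gG go) => i /=; apply: lextU.
Qed.

Lemma Oinf_id : exists g : Oinf K, forall x, oinf_map g x = x.
Proof.
have gG : in_GLinf (idfun : {linear V -> V}).
  split; first by exists idfun.
  by exists 0%N; split=> // i j; rewrite ltn0.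
by exists (@OinfElt K (idfun : {linear V -> V}) gG (fun _ _ => erefl)).
Qed.

Lemma GLinf_supp (g : {linear V -> V}) d (x : V) : 
  (forall i, (d <= i)%N -> g << i >> = << i >>) ->
  (forall i j, (i < d)%N -> (d <= j)%N -> (g << i >>)@_j = 0) ->
  (forall j, (d <= j)%N -> x@_j = 0) -> forall j, (d <= j)%N -> (g x)@_j = 0.
Proof.
move=> gd gdj xd j dj; rewrite (malg_sumU x) /lext linear_sum raddf_sum big_seq big1 // => i.
rewrite -mcoeff_neq0 => xi /=; rewrite linearZ mcoeffZ gdj ?mulr0 //.
by rewrite ltnNge; apply: contraNN xi => /xd ->.
Qed.

Lemma GLinf_widen (g : {linear V -> V}) d e : (d <= e)%N ->
  (forall i, (d <= i)%N -> g << i >> = << i >>) ->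
  (forall i j, (i < d)%N -> (d <= j)%N -> (g << i >>)@_j = 0) ->
  (forall i, (e <= i)%N -> g << i >> = << i >>) /\
  (forall i j, (i < e)%N -> (e <= j)%N -> (g << i >>)@_j = 0).
Proof.
move=> de gd gdj; split=> [i ei|i j ie ej]; first by rewrite gd // (leq_trans de).
have [di|di] := leqP d i; last by apply: gdj => //; apply: leq_trans ej.
by rewrite gd // mcoeffU; case: eqP => // E; move: ie; rewrite E ltnNge ej.
Qed.

Lemma Oinf_comp (g h : Oinf K) : exists k : Oinf K, forall x, oinf_map k x = oinf_map g (oinf_map h x).
Proof.
have [gb [d [gd gdj]]] := oinf_GLinf g; have [hb [e [he hej]]] := oinf_GLinf h.
have [gm gmj] := GLinf_widen (leq_maxl d e) gd gdj.
have [hm hmj] := GLinf_widen (leq_maxr d e) he hej.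
have kG : in_GLinf (oinf_map g \o oinf_map h : {linear V -> V}).
  split; first exact: bij_comp.
  exists (maxn d e); split=> [i im|i j im mj] /=; first by rewrite hm // gm.
  by apply: (GLinf_supp gm gmj) => // l; apply: hmj.
have ko x y : omega (oinf_map g (oinf_map h x)) (oinf_map g (oinf_map h y)) = omega x y.
  by rewrite !oinf_omega.
by exists (OinfElt kG ko).
Qed.

Section Unipotent.
Variables (a b : nat) (ba : b != a) (bp : b != prt a).

(** The skew endomorphism attached to e_a /\ e_b. The conditions on a and b make their span
    isotropic and killed by this endomorphism N, so N^2 = 0 and the exponential is 1 + t N, the map
    [unif t]. *)
Definition uniN (i : nat) : V := (i == prt a)%:R *: << b >> - (i == prt b)%:R *: << a >>.

Lemma uniN_a : uniN a = 0.
Proof.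
rewrite /uniN eq_sym (negPf (prt_neq a)) scale0r.
have -> : (a == prt b) = false by apply: contra_neqF bp => /eqP ->; rewrite prtK.
by rewrite scale0r subr0.
Qed.

Lemma uniN_b : uniN b = 0.
Proof. by rewrite /uniN (negPf bp) scale0r eq_sym (negPf (prt_neq b)) scale0r subr0. Qed.

Definition unif t (i : nat) : V := << i >> + t *: uniN i.

Lemma unif_inv t i : lext (unif t) (unif (- t) i) = << i >>.
Proof.
have -> : lext (unif t) (unif (- t) i) = unif t i - t *: lext (unif t) (uniN i).
  by rewrite {2}/unif linearD linearZ /= lextU scaleNr.
have -> : lext (unif t) (uniN i) = uniN i.
  rewrite {1}/uniN linearB !linearZ /= !lextU.
  by rewrite /unif uniN_a uniN_b !scaler0 !addr0 scalerN.
by rewrite /unif addrK.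
Qed.

Lemma omega_unif t i j : omega (unif t i) (unif t j) = omega << i >> << j >>.
Proof.
have lin x c y z : omega (y + c *: z) x = omega y x + c * omega z x.
  by rewrite addrC omega_linearl addrC.
have linr x c y z : omega x (y + c *: z) = omega x y + c * omega x z.
  by rewrite addrC omega_linearr addrC.
have ND x c y z u : omega (c *: y - z *: u) x = c * omega y x - z * omega u x :> K.
  by rewrite -scaleNr lin mulNr -[c *: y]add0r lin omega0l add0r.
have NDr x c y z u : omega x (c *: y - z *: u) = c * omega x y - z * omega x u :> K.
  by rewrite !(omegaC x) ND.
have z1 : (a == prt b) = false by apply: contra_neqF bp => /eqP ->; rewrite prtK.
have z2 : (b == prt a) = false by apply: negPf.
have z3 : (a == prt a) = false by rewrite eq_sym (negPf (prt_neq _)).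
have z4 : (b == prt b) = false by rewrite eq_sym (negPf (prt_neq _)).
have sw k l : (k == prt l) = (l == prt k) by apply/eqP/eqP => ->; rewrite prtK.
rewrite /unif /uniN lin linr linr !ND !NDr !omegaU z1 z2 z3 z4.
rewrite (sw a i) (sw b i) /=.
move: (i == prt a)%:R (i == prt b)%:R (j == prt a)%:R (j == prt b)%:R (j == prt i)%:R => p q p' q' r.
by ring.
Qed.

Lemma Oinf_uni t : exists g : Oinf K, forall i, oinf_map g << i >> = unif t i.
Proof.
pose d := (maxn a b).+2.
have dp l : (l <= maxn a b)%N -> (l < d)%N /\ (prt l < d)%N.
  by move=> h; rewrite /prt /d; case: ifP => _; lia.
have [ad pad] := dp _ (leq_maxl a b); have [bd pbd] := dp _ (leq_maxr a b).
apply: (@Oinf_of (unif t) (unif (- t)) d).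
- exact: unif_inv.
- by move=> i; have := unif_inv (- t) i; rewrite opprK.
- move=> i di; rewrite /unif /uniN.
  have -> : (i == prt a) = false by apply/eqP; lia.
  have -> : (i == prt b) = false by apply/eqP; lia.
  by rewrite !scale0r subr0 scaler0 addr0.
- move=> i j id dj; rewrite /unif /uniN mcoeffD mcoeffZ mcoeffB !mcoeffZ !mcoeffU.
  have -> : (i == j) = false by apply/eqP; lia.
  have -> : (a == j) = false by apply/eqP; lia.
  have -> : (b == j) = false by apply/eqP; lia.
  by rewrite !mulr0 subr0 mulr0 addr0.
- exact: omega_unif.
Qed.

End Unipotent.

Lemma Oinf_perm (f : nat -> nat) d : involutive f -> (forall i, f (prt i) = prt (f i)) ->
  (forall i, (d <= i)%N -> f i = i) -> exists g : Oinf K, forall i, oinf_map g << i >> = << f i >>.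
Proof.
move=> fK fp fd; apply: (@Oinf_of (fun i => << f i >>) (fun i => << f i >>) d).
- by move=> i; rewrite lextU fK.
- by move=> i; rewrite lextU fK.
- by move=> i di; rewrite fd.
- move=> i j id dj; rewrite mcoeffU; case: eqP => // E.
  by move: id; rewrite -(fK i) E fd // ltnNge dj.
- by move=> i j; rewrite !omegaU -fp (inj_eq (can_inj fK)).
Qed.

(* Exchanges the first P hyperbolic pairs with those numbered d, ..., d + P - 1. *)
Definition pairswap (P d i : nat) : nat :=
  if (i < P.*2)%N then (i + d.*2)%N
  else if (d.*2 <= i)%N && (i < (d + P).*2)%N then (i - d.*2)%N else i.

Lemma pairswapE P d (b : bool) h : pairswap P d (b + h.*2) =
  (b + (if h < P then h + d else if (d <= h) && (h < d + P) then h - d else h).*2)%N.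
Proof.
have -> : pairswap P d (b + h.*2) = (b + pairswap P d h.*2)%N.
  by rewrite /pairswap; case: b => /=; do ! case: ifP => ?; lia.
by congr (_ + _)%N; rewrite /pairswap; do ! case: ifP => ?; lia.
Qed.

Lemma Oinf_pairswap P d : (P <= d)%N ->
  exists g : Oinf K, forall i, oinf_map g << i >> = << pairswap P d i >>.
Proof.
move=> Pd; apply: (@Oinf_perm _ (d + P).*2).
- by move=> i; rewrite {2}/pairswap; do ! (case: ifP => ?); rewrite /pairswap; do ! (case: ifP => ?); lia.
- by move=> i; case: (pairP i) => b h; rewrite prtE !pairswapE prtE.
- by move=> i di; rewrite /pairswap; do ! case: ifP => ?; lia.
Qed.

End Orth.

Section Substitution.
Variables (K : fieldType).
Notation V := {malg K[nat]}.
Variables (n d : nat) (ka : 'I_n -> nat) (nd : (n <= d)%N) (kad : forall j, (ka j < d.*2)%N).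

Let fresh (j : 'I_n) : nat := (d + j).*2.

(** One unipotent per j, with a = prt (ka j) and b = fresh j, adds the fresh letter to the letter ka
    j. The fresh letters are even and at least 2d, so they are fixed by all these unipotents. *)
Lemma Oinf_add_fresh (s : seq 'I_n) : exists g : Oinf K,
  (forall i, (i < d.*2)%N -> oinf_map g << i >> = << i >> + \sum_(j <- s | ka j == i) << fresh j >>) /\
  (forall j, oinf_map g << fresh j >> = << fresh j >>).
Proof.
elim: s => [|j s [g [gi gf]]].
  have [g gE] := Oinf_id K; exists g; split=> [i _|j]; rewrite gE //.
  by rewrite big_nil addr0.
have pa : (prt (ka j) < d.*2)%N by rewrite prt_lt.
have b1 : fresh j != prt (ka j) by apply/eqP; rewrite /fresh; lia.
have b2 : fresh j != prt (prt (ka j)) by rewrite prtK; apply/eqP; have := kad j; rewrite /fresh; lia.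
have [h hE] := Oinf_uni b1 b2 (1 : K); have [k kE] := Oinf_comp g h.
have pf l : prt (fresh l) = (fresh l).+1 by rewrite /prt /fresh odd_double.
exists k; split=> [i id|l]; rewrite kE hE /unif /uniN prtK pf scale1r.
  have -> : (i == (fresh j).+1) = false by apply/eqP; rewrite /fresh; lia.
  rewrite scale0r subr0 linearD linearZ /= gi // gf big_cons (eq_sym i).
  by case: (ka j == i); rewrite ?scale1r ?scale0r ?addr0 // addrAC addrA.
have -> : (fresh l == ka j) = false by apply/eqP; have := kad j; rewrite /fresh; lia.
have -> : (fresh l == (fresh j).+1) = false by apply/eqP; rewrite /fresh; lia.
by rewrite !scale0r subr0 addr0 gf.
Qed.

Lemma pairswap_fresh (j : 'I_n) : pairswap n d (fresh j) = j.*2.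
Proof.
have := pairswapE n d false (d + j); rewrite !add0n -/(fresh j) => ->.
have := ltn_ord j; do ! (case: ifP => ?); lia.
Qed.

(** The swap of hyperbolic pairs brings the fresh letters back to the fixed positions 2j; this gives
    the operators required in [GE] for polarization. *)
Lemma Oinf_subst (J : {set 'I_n}) : exists g : Oinf K, forall i, (i < d.*2)%N ->
  oinf_map g << i >> = << pairswap n d i >> + \sum_(j in J | ka j == i) << j.*2 >>.
Proof.
have [g [gi _]] := Oinf_add_fresh (enum J); have [p pE] := Oinf_pairswap K nd.
have [k kE] := Oinf_comp p g; exists k => i id; rewrite kE gi // linearD linear_sum /= pE.
congr (_ + _); rewrite [LHS]big_mkcond /= [RHS]big_mkcondr /= -[RHS]big_enum.
by apply: eq_bigr => j _; case: ifP => // _; rewrite pE pairswap_fresh.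
Qed.

End Substitution.

Section Traceless.
Variables (K : fieldType) (n : nat).
Implicit Types x : tpow K nat n.

Definition setw2 (i : {ffun 'I_n -> nat}) (p q : 'I_n) (c c' : nat) : {ffun 'I_n -> nat} :=
  [ffun k => if k == p then c else if k == q then c' else i k].

(** A contraction whose two positions are filled again with letters c, c'. Staying in the same
    tensor power, it avoids the renumbering of positions and commutes with permutations up to moving
    p and q. *)
Definition repl (p q : 'I_n) c c' : tpow K nat n -> tpow K nat n :=
  lext (fun i : {ffun 'I_n -> nat} => omega << i p >> << i q >> *: (<< setw2 i p q c c' >> : tpow K nat n)).

HB.instance Definition _ p q c c' := GRing.Linear.copy (repl p q c c')
  (lext (fun i : {ffun 'I_n -> nat} => omega << i p >> << i q >> *: (<< setw2 i p q c c' >> : tpow K nat n))).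

Lemma replU p q c c' i : repl p q c c' << i >> = omega << i p >> << i q >> *: << setw2 i p q c c' >>.
Proof. exact: lextU. Qed.

End Traceless.
Arguments repl : simpl never.

Lemma traceless_repl (K : fieldType) n (x : tpow K nat n) :
  x \in @traceless_pred K n <-> forall p q c c', p != q -> repl p q c c' x = 0.
Proof.
case: n x => [|[|n]] x.
- by split=> // _ [].
- by split=> // _ p q c c'; rewrite !ord1.
split=> [/traceless_predP xt p q c c' pq|xr].
  have [q' qE] : exists q', q = lift p q' by case: (unliftP p q) pq => [q' ->|->]; [exists q' | rewrite eqxx].
  pose ins : tpow K nat n -> tpow K nat n.+2 := lext (fun z : {ffun 'I_n -> nat} =>
    << [ffun k => if unlift p k is Some k' then if unlift q' k' is Some k'' then z k'' else c' else c] >>).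
  have E : repl p q c c' =1 ins \o contract p q'.
    apply: (@malg_linear_eq K _ _ (repl p q c c') (lext _ \o contract p q')) => i /=.
    rewrite replU contractU linearZ /= qE; congr (_ *: _); rewrite lextU; congr << _ >>.
    apply/ffunP => k; rewrite !ffunE; case: (unliftP p k) => [k' ->|->]; last by rewrite eqxx.
    rewrite eq_sym (negPf (neq_lift _ _)) (inj_eq lift_inj); case: (unliftP q' k') => [k'' ->|->]; last by rewrite eqxx.
    by rewrite eq_sym (negPf (neq_lift _ _)) ffunE.
  by rewrite E /= xt; apply: (linear0 (lext _)).
apply/traceless_predP => p q.
pose pull : tpow K nat n.+2 -> tpow K nat n := lext (fun i : {ffun 'I_n.+2 -> nat} =>
  << [ffun k => i (lift p (lift q k))] >>).
have E : contract p q =1 pull \o repl p (lift p q) 0 0.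
  apply: (@malg_linear_eq K _ _ (contract p q) (lext _ \o repl p (lift p q) 0 0)) => i /=.
  rewrite replU contractU linearZ /=; congr (_ *: _); rewrite lextU; congr << _ >>.
  apply/ffunP => k; rewrite !ffunE eq_sym (negPf (neq_lift _ _)) (inj_eq lift_inj).
  by rewrite eq_sym (negPf (neq_lift _ _)).
by rewrite E /= xr ?neq_lift //; apply: (linear0 (lext _)).
Qed.

Lemma repl_sact (K : fieldType) n (x : tpow K nat n) s p q c c' :
  repl p q c c' (sact s x) = sact s (repl (s p) (s q) c c' x).
Proof.
move: x; apply: (@malg_linear_eq K _ _ (repl p q c c' \o @sact K nat n s) (@sact K nat n s \o repl (s p) (s q) c c')) => i /=.
rewrite sactU !replU linearZ /= sactU !ffunE; congr (_ *: << _ >>).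
by apply/ffunP => k; rewrite !ffunE !(inj_eq perm_inj).
Qed.

Lemma traceless_sact (K : fieldType) n (x : tpow K nat n) s :
  x \in @traceless_pred K n -> sact s x \in @traceless_pred K n.
Proof.
move=> /traceless_repl xt; apply/traceless_repl => p q c c' pq.
by rewrite repl_sact xt ?(inj_eq perm_inj) // linear0.
Qed.

(** * Infinitesimal action *)

(** Weights and nodes extracting the coefficient of t from any polynomial in t of degree at most
    [D]. *)
Lemma moments (K : fieldType) (K0 : [pchar K] =i pred0) D :
  exists s : seq (K * K), forall i, (i <= D)%N -> \sum_(c <- s) c.1 * c.2 ^+ i = (i == 1%N)%:R.
Proof.
suff [s sE] : exists s : seq (K * K), forall i, (0 < i)%N -> (i <= D)%N ->
    \sum_(c <- s) c.1 * c.2 ^+ i = (i == 1%N)%:R.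
  (* The node 0 contributes to the power 0 only, since 0 ^ 0 = 1, and corrects that moment. *)
  exists ((- \sum_(c <- s) c.1, 0) :: s) => i iD; rewrite big_cons /=.
  case: i iD => [|i] iD; last by rewrite expr0n mulr0 add0r sE.
  rewrite expr0 mulr1; under [X in _ + X]eq_bigr do rewrite expr0 mulr1.
  by rewrite addNr.
elim: D => [|[|D] [s sE]]; first by exists [::]; case.
  exists [:: (1, 1)] => i i0 i1; have -> : i = 1%N by lia.
  by rewrite big_seq1 expr1 mulr1.
have q0 : 2 - 2 ^+ D.+2 != 0 :> K.
  rewrite exprS -{1}[2]mulr1 -mulrBr mulf_neq0 //; first exact: (natr_neq0 K0 (m := 2)).
  rewrite -oppr_eq0 opprB -natrX -(natrB _ (_ : 1 <= 2 ^ D.+1)%N) ?expn_gt0 //.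
  by apply: natr_neq0 => //; rewrite subn_gt0 -{1}(expn0 2) ltn_exp2l.
(* The old rule and its copy with doubled nodes are combined so that al + 2 be = 1 keeps the first
   moment and al + 2^(D+2) be = 0 kills the new one. *)
pose be := (2 - 2 ^+ D.+2 : K)^-1; pose al := - 2 ^+ D.+2 * be.
exists ([seq (al * c.1, c.2) | c <- s] ++ [seq (be * c.1, 2 * c.2) | c <- s]) => i i0 iD.
have -> : \sum_(c <- [seq (al * c.1, c.2) | c <- s] ++ [seq (be * c.1, 2 * c.2) | c <- s]) c.1 * c.2 ^+ i =
    (al + be * 2 ^+ i) * \sum_(c <- s) c.1 * c.2 ^+ i.
  rewrite big_cat !big_map /= mulrDl !mulr_sumr; congr (_ + _); apply: eq_bigr => c _.
    by rewrite mulrA.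
  by rewrite exprMn !mulrA; congr (_ * _); rewrite -!mulrA [c.1 * _]mulrC.
have [iD'|iD'] := leqP i D.+1.
  rewrite sE //; case: eqP => [->|_]; last by rewrite mulr0.
  by rewrite expr1 mulr1 /al mulNr addrC [be * 2]mulrC -mulrBl mulfV.
have -> : i = D.+2 by lia.
have -> : al + be * 2 ^+ D.+2 = 0 by rewrite /al mulNr [be * _]mulrC addNr.
by rewrite mul0r.
Qed.

Lemma malg_linear_ext (K : fieldType) (I : choiceType) (W : lmodType K) (f g : {malg K[I]} -> W) :
  linear f -> linear g -> (forall i, f << i >> = g << i >>) -> f =1 g.
Proof.
move=> fl gl fg.
pose F := HB.pack_for {linear {malg K[I]} -> W} f (GRing.isLinear.Build K _ W *:%R f fl).
pose G := HB.pack_for {linear {malg K[I]} -> W} g (GRing.isLinear.Build K _ W *:%R g gl).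
exact: (@malg_linear_eq K I W F G).
Qed.

Section Derivation.
Variables (K : fieldType) (K0 : [pchar K] =i pred0) (n : nat).
Notation T := (tpow K nat n).
Implicit Types (i : {ffun 'I_n -> nat}).

Definition setw i (p : 'I_n) (c : nat) : {ffun 'I_n -> nat} := [ffun k => if k == p then c else i k].

(* The action of a /\ b in the Lie algebra of O(oo) = /\^2 V. *)
Definition der a b : T -> T := lext (fun i =>
  \sum_p ((i p == prt a)%:R *: << setw i p b >> - (i p == prt b)%:R *: << setw i p a >>) : T).

HB.instance Definition _ a b := GRing.Linear.copy (der a b) (lext (fun i =>
  \sum_p ((i p == prt a)%:R *: << setw i p b >> - (i p == prt b)%:R *: << setw i p a >>) : T)).

Lemma derU a b i : der a b << i >> =
  \sum_p ((i p == prt a)%:R *: << setw i p b >> - (i p == prt b)%:R *: << setw i p a >>).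
Proof. exact: lextU. Qed.

Lemma tens_setw i p c : tens (upd (fun k => << i k >>) p << c >>) = << setw i p c >> :> T.
Proof.
have -> : upd (fun k => << i k >>) p << c >> = (fun k => << setw i p c k >>) :> ('I_n -> {malg K[nat]}).
  by apply/funext => k; rewrite /upd ffunE; case: eqP.
by rewrite tensU; congr << _ >>; apply/ffunP => k; rewrite ffunE.
Qed.

Lemma derU_tens a b i : der a b << i >> = \sum_p tens (upd (fun k => << i k >>) p (uniN K a b (i p))).
Proof.
rewrite derU; apply: eq_bigr => p _.
pose F := HB.pack_for {linear {malg K[nat]} -> T} (fun x => tens (upd (fun k => << i k >>) p x))
  (GRing.isLinear.Build K _ T *:%R _ (tens_multilinear (fun k => << i k >>) p)).
have := linearB F ((i p == prt a)%:R *: << b >>) ((i p == prt b)%:R *: << a >>).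
by rewrite -[X in X = _ -> _]/(tens _) => ->; rewrite !linearZ /= !tens_setw.
Qed.

(** On a tensor power 1 + t N acts by a polynomial in t of degree at most n whose coefficient of t
    is the derivation; [moments] extracts it as a combination of group elements. *)
Lemma der_algebraic a b : b != a -> b != prt a -> exists s : seq (K * Oinf K),
  forall x, der a b x = \sum_(c <- s) c.1 *: tmap (oinf_map c.2) x.
Proof.
move=> ba bp; have [s sE] := moments K0 n.
have /choice[g gE] := Oinf_uni (K := K) ba bp.
exists [seq (c.1, g c.2) | c <- s]; apply: malg_linear_ext => [|l x y|i].
- by move=> l x y; rewrite linearP.
- by rewrite scaler_sumr -big_split; apply: eq_bigr => c _ /=; rewrite linearP scalerDr !scalerA mulrC.
rewrite derU_tens big_map /=; apply/malgP => z; rewrite !raddf_sum /=.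
transitivity (\sum_(Q : {set 'I_n}) (#|Q| == 1%N)%:R *
    \prod_p (if p \in Q then (uniN K a b (i p))@_(z p) else (<< i p >> : {malg K[nat]})@_(z p))).
  transitivity (\sum_(Q in [set [set p] | p : 'I_n]) \prod_p (if p \in Q then (uniN K a b (i p))@_(z p) else (<< i p >> : {malg K[nat]})@_(z p))).
    rewrite big_imset /=; last by move=> p q _ _; apply: set1_inj.
    apply: eq_big => // p _; rewrite mcoeff_tens prod_upd [RHS](bigD1 p) //= inE eqxx.
    by congr (_ * _); apply: eq_bigr => q /negPf qp; rewrite inE qp.
  rewrite big_mkcond /=; apply: eq_bigr => Q _.
  have -> : (Q \in [set [set p] | p : 'I_n]) = (#|Q| == 1%N).
    by apply/imsetP/cards1P => [[p _ ->]|[p ->]]; exists p.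
  by case: ifP => _; rewrite ?mul1r ?mul0r.
have cQ (Q : {set 'I_n}) : (#|Q| <= n)%N by rewrite -[X in (_ <= X)%N](card_ord n); apply: max_card.
under [LHS]eq_bigr => Q _ do rewrite -(sE _ (cQ Q)) mulr_suml.
rewrite exchange_big; apply: eq_bigr => c _ /=.
rewrite mcoeffZ tmapU mcoeff_tens.
have -> : \prod_(k < n) (oinf_map (g c.2) << i k >>)@_(z k) =
    \prod_(k < n) (c.2 * (uniN K a b (i k))@_(z k) + (<< i k >> : {malg K[nat]})@_(z k)).
  by apply: eq_bigr => k _; rewrite gE /unif mcoeffD mcoeffZ addrC.
rewrite bigA_distr mulr_sumr; apply: eq_big => // Q _.
rewrite -mulrA; congr (_ * _).
rewrite [RHS](eq_bigr (fun p => (if p \in Q then c.2 else 1) * (if p \in Q then (uniN K a b (i p))@_(z p) else (<< i p >> : {malg K[nat]})@_(z p)))).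
  rewrite big_split /=; congr (_ * _).
  by rewrite -big_mkcond /= prodr_const.
by move=> p _; case: ifP => _; rewrite ?mul1r.
Qed.

Section Closed.
Variables (J : finType) (U : (J -> T) -> Prop).
Hypothesis U0 : U (fun=> 0).
Hypothesis UD : forall a t t', U t -> U t' -> U (fun j => a *: t j + t' j).
Hypothesis Uh : forall (g : Oinf K) t, U t -> U (fun j => tmap (oinf_map g) (t j)).

Lemma U_sum (R : Type) (r : seq R) (c : R -> K) (f : R -> J -> T) :
  (forall k : R, U (f k)) -> U (fun j => \sum_(i <- r) c i *: f i j).
Proof.
move=> Uf; elim: r => [|i r IH].
  by have := U0; congr U; apply/funext => j; rewrite big_nil.
by have := UD (c i) (Uf i) IH; congr U; apply/funext => j; rewrite big_cons.
Qed.

Lemma U_der a b t : b != a -> b != prt a -> U t -> U (fun j => der a b (t j)).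
Proof.
move=> ba bp Ut; have [s sE] := der_algebraic ba bp.
have := U_sum s (fun c => c.1) (fun c => Uh c.2 Ut).
by congr U; apply/funext => j; rewrite sE.
Qed.

End Closed.

End Derivation.
Arguments der : simpl never.

Section Generation.
Variables (K : fieldType) (K0 : [pchar K] =i pred0) (n : nat).
Notation T := (tpow K nat n).
Implicit Types (i z : {ffun 'I_n -> nat}).

Definition Oletter m (j : 'I_m) : nat := j.*2.

Lemma malg_sum_bounded M (x : T) : (forall i, x@_i != 0 -> forall k, (i k < M)%N) ->
  x = \sum_(f : {ffun 'I_n -> 'I_M}) x@_[ffun k => val (f k)] *: << [ffun k => val (f k)] >>.
Proof.
move=> xM; apply/malgP => z; rewrite raddf_sum /=.
have [xz|xz] := eqVneq x@_z 0.
  rewrite xz big1 // => f _; rewrite mcoeffZ mcoeffU.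
  by case: eqP => [->|_]; rewrite ?mulr0 // xz mul0r.
pose f0 : {ffun 'I_n -> 'I_M} := [ffun k => Ordinal (xM z xz k)].
have f0E : [ffun k => val (f0 k)] = z by apply/ffunP => k; rewrite !ffunE.
rewrite (bigD1 f0) //= f0E mcoeffZ mcoeffU eqxx mulr1 big1 ?addr0 // => f ff0.
rewrite mcoeffZ mcoeffU; case: eqP => [E|_]; last by rewrite mulr0.
case/eqP: ff0; apply/ffunP => k; apply: val_inj; rewrite ffunE /=.
by have /ffunP/(_ k) := E; rewrite ffunE.
Qed.

Section Family.
Variables (J : finType) (U : (J -> T) -> Prop).
Hypothesis U0 : U (fun=> 0).
Hypothesis UD : forall a t t', U t -> U t' -> U (fun j => a *: t j + t' j).
Hypothesis Uh : forall (g : Oinf K) t, U t -> U (fun j => tmap (oinf_map g) (t j)).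

Definition polU (t : J -> T) := forall ka : 'I_n -> nat, U (fun j => wv (@Oletter n) (pol ka (t j))).

Lemma polU0 : polU (fun=> 0).
Proof. by move=> ka; have := U0; congr U; apply/funext => j; rewrite !linear0. Qed.

Lemma polUD a t t' : polU t -> polU t' -> polU (fun j => a *: t j + t' j).
Proof.
move=> Ut Ut' ka; have := UD a (Ut ka) (Ut' ka); congr U.
by apply/funext => j; rewrite pol_linear wv_linear.
Qed.

Lemma common_bound (t : J -> T) : exists M, forall j i, (t j)@_i != 0 -> forall k, (i k < M)%N.
Proof.
pose B := flatten [seq letters (t j) | j <- enum J].
exists (\max_(b <- B) b).+1 => j i ti k; rewrite ltnS; apply: leq_bigmax_seq => //.
apply: (@lettersP K nat n (t j) B) ti k => l lt.
by apply/flattenP; exists (letters (t j)) => //; apply: map_f; rewrite mem_enum.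
Qed.

(** The polarization of g t along [ka] is a combination of polarizations of t along other words,
    with products of matrix entries of g as coefficients. Hence [polU] is itself closed under
    derivations, as the induction in [U_partial] requires. *)
Lemma polUh (g : Oinf K) t : polU t -> polU (fun j => tmap (oinf_map g) (t j)).
Proof.
move=> Ut ka; have [M tM] := common_bound t.
have tZ a (x : T) : tmap (oinf_map g) (a *: x) = a *: tmap (oinf_map g) x by rewrite linearZ.
pose c (f : {ffun 'I_n -> 'I_M}) := \prod_q (oinf_map g << val (f q) >>)@_(ka q).
have := U_sum U0 UD (index_enum {ffun 'I_n -> 'I_M}) c (fun f : {ffun 'I_n -> 'I_M} => Ut (fun q => val (f q))).
congr U; apply/funext => j.
transitivity (wv (@Oletter n) (\sum_f c f *: pol (fun q => val (f q)) (t j))).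
  by rewrite linear_sum; apply: eq_bigr => f _; rewrite linearZ.
congr (wv _ _); apply/ffunP => s; rewrite sum_ffunE ffunE.
rewrite [in RHS](malg_sum_bounded (tM j)) (linear_sum (@tmap K nat nat (oinf_map g) n)) raddf_sum /=.
pose h (f : {ffun 'I_n -> 'I_M}) : {ffun 'I_n -> 'I_M} := [ffun k => f (s k)].
have hI : injective h.
  move=> f f' E; apply/ffunP => k; move/ffunP/(_ (s^-1%g k)): E.
  by rewrite !ffunE permKV.
rewrite [RHS](reindex_inj hI) /=; apply: eq_bigr => f _.
rewrite !ffunE tZ mcoeffZ tmapU mcoeff_tens [LHS]mulrC; congr (_ * _).
  by congr ((t j)@_ _); apply/ffunP => k; rewrite !ffunE.
rewrite /c (reindex_inj (@perm_inj _ s)) /=; apply: eq_bigr => k _.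
by rewrite !ffunE.
Qed.

Variable d : nat.
Definition freshl (j : nat) : nat := (d + j).*2.

(* r of the letters of the word i are the distinct isotropic letters
   freshl 0, ..., freshl r.-1, the others lie below d.*2. *)
Definition partial_word r i :=
  [/\ forall p, (d.*2 <= i p)%N -> exists2 j, (j < r)%N & i p = freshl j,
      forall p q, (d.*2 <= i p)%N -> i p = i q -> p = q &
      (#|[set p | (i p < d.*2)%N]| + r = n)%N].

Lemma der_partial r i l p z : (r < n)%N -> partial_word r i -> (l < d.*2)%N -> i p = l ->
  z = setw i p (freshl r) -> partial_word r.+1 z.
Proof.
move=> rn [i1 i2 i3] ld ip ->; split.
- move=> q; rewrite ffunE; case: eqP => _; first by exists r.
  by move=> /i1[j jr ->]; exists j => //; apply: ltnW.
- move=> q q'; rewrite !ffunE; case: eqP => [->|_]; case: eqP => [->|_] //.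
  + move=> _ E; have [|j jr jE] := i1 q'; first by rewrite -E /freshl; lia.
    by move: E; rewrite jE /freshl; lia.
  + move=> dq E; have [j jr jE] := i1 q dq.
    by move: E; rewrite jE /freshl; lia.
  + exact: i2.
- apply: etrans i3; rewrite addnS -addSn; congr (_ + _)%N.
  rewrite [RHS](cardsD1 p) inE ip ld add1n; congr _.+1.
  apply: eq_card => q; rewrite !inE ffunE; case: eqP => //= _.
  by rewrite /freshl; apply/negbTE; lia.
Qed.

Lemma der_fresh r i l : (r < n)%N -> partial_word r i -> (l < d.*2)%N ->
  der (prt l) (freshl r) << i >> = \sum_p (i p == l)%:R *: (<< setw i p (freshl r) >> : T).
Proof.
move=> rn [i1 _ _] ld; rewrite derU; apply: eq_bigr => p _; rewrite prtK.
have -> : (i p == prt (freshl r)) = false.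
  apply/eqP => E; have pf : prt (freshl r) = (freshl r).+1 by rewrite /prt /freshl odd_double.
  have [|j jr jE] := i1 p; first by rewrite E pf /freshl; lia.
  by move: E; rewrite pf jE /freshl; lia.
by rewrite scale0r subr0.
Qed.

(** The inner derivation replaces a letter l by the fresh one. The outer one either restores l, with
    sign -1, or replaces a letter dual to l at another position by the dual of the fresh letter,
    which is a contraction followed by a refilling. *)
Lemma casimir_word r i : (r < n)%N -> partial_word r i ->
  \sum_(l < d.*2) der l (prt (freshl r)) (der (prt l) (freshl r) << i >>) =
  - (#|[set p | (i p < d.*2)%N]|%:R) *: << i >> +
  \sum_p \sum_(q | q != p) repl p q (freshl r) (prt (freshl r)) (<< i >> : T).
Proof.
move=> rn iw; have [i1 i2 _] := iw.
have pf : prt (freshl r) = (freshl r).+1 by rewrite /prt /freshl odd_double.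
have inner (l : 'I_(d.*2)) p : i p = l -> der l (prt (freshl r)) (<< setw i p (freshl r) >> : T) =
    - << i >> + \sum_(q | q != p) (i q == prt l)%:R *: << setw2 i p q (freshl r) (prt (freshl r)) >>.
  move=> ip; rewrite derU (bigD1 p) //=; congr (_ + _).
    rewrite ffunE eqxx prtK eqxx scale1r.
    have -> : (freshl r == prt l) = false.
      by apply/eqP => E; have := ltn_ord l; rewrite -prt_lt -E /freshl; lia.
    rewrite scale0r sub0r; congr (- << _ >>); apply/ffunP => k; rewrite !ffunE.
    by case: eqP => // ->.
  apply: eq_bigr => q qp; rewrite ffunE (negPf qp) prtK.
  have -> : (i q == freshl r) = false.
    apply/eqP => E; have [|j jr jE] := i1 q; first by rewrite E /freshl; lia.
    by move: E; rewrite jE /freshl; lia.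
  rewrite scale0r subr0; congr (_ *: << _ >>); apply/ffunP => k; rewrite !ffunE.
  case: (eqVneq k p) => [->|//]; by rewrite eq_sym (negPf qp).
transitivity (\sum_(l < d.*2) \sum_p (i p == l)%:R *: (- << i >> +
    \sum_(q | q != p) (i q == prt l)%:R *: (<< setw2 i p q (freshl r) (prt (freshl r)) >> : T))).
  apply: eq_bigr => l _; rewrite (der_fresh rn iw) // linear_sum; apply: eq_bigr => p _.
  rewrite linearZ /=; case: eqP => [E|_]; last by rewrite !scale0r.
  by rewrite inner.
rewrite exchange_big /=.
have -> : - #|[set p | (i p < d.*2)%N]|%:R *: << i >> = \sum_p (i p < d.*2)%N%:R *: - << i >> :> T.
  rewrite -scaler_suml -natr_sum -sum1_card [in LHS]big_mkcond /= scaleNr scalerN.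
  congr (- (_%:R *: _)); apply: eq_bigr => p _; rewrite inE; by case: ifP.
rewrite -big_split /=; apply: eq_bigr => p _.
have [ip|ip] := ltnP (i p) d.*2.
  rewrite (bigD1 (Ordinal ip)) //= eqxx !scale1r [X in _ + X]big1 ?addr0; last first.
    move=> l lp; case: eqP => [E|_]; last by rewrite scale0r.
    by case/eqP: lp; apply: val_inj.
  by congr (_ + _); apply: eq_bigr => q _; rewrite replU omegaU.
rewrite scale0r add0r big1 => [|l _]; last first.
  by case: eqP => [E|_]; [move: ip; rewrite E leqNgt ltn_ord | rewrite scale0r].
rewrite big1 // => q qp; rewrite replU omegaU.
have [j jr jE] := i1 _ ip; have pj : prt (i p) = (freshl j).+1 by rewrite jE /prt /freshl odd_double.
case: eqP => [E|_]; last by rewrite scale0r.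
have [|j' jr' jE'] := i1 q; first by rewrite E pj /freshl; lia.
by move: E; rewrite pj jE' /freshl; lia.
Qed.

Hypothesis nd : (n <= d)%N.

(** Induction on the number s of old letters. On traceless tensors the contraction terms of
    [casimir_word] vanish, so y is a multiple of derivations of tensors with one more fresh letter,
    to which the induction applies. *)
Lemma U_partial s (y : J -> T) : (s <= n)%N -> (forall j, y j \in @traceless_pred K n) ->
  (forall j i, (y j)@_i != 0 -> partial_word (n - s) i) -> polU y -> U y.
Proof.
elim: s y => [|s IH] y sn yt yw Uy.
  (* All letters are now fresh and distinct, so y is its own polarization; a swap of hyperbolic
     pairs carries the letters [Oletter] to the fresh ones. *)
  pose f (k : 'I_n) := freshl k.
  have yE j : y j = wv f (pol f (y j)).
    apply/malgP => z; have wE : (wv f (pol f (y j)))@_z = \sum_(s : 'S_n) (y j)@_[ffun k => f (s k)] * (([ffun k => f (s k)] : {ffun 'I_n -> nat}) == z)%:R.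
      by rewrite /wv raddf_sum; apply: eq_bigr => s _; rewrite /= mcoeffZ mcoeffU ffunE.
    have [yz|yz] := eqVneq (y j)@_z 0.
      rewrite wE big1 ?yz // => s _; case: eqP => [->|_]; last by rewrite mulr0.
      by rewrite yz mul0r.
    have [z1 z2 z3] := yw j z yz; rewrite subn0 in z1 z3.
    have zd k : (d.*2 <= z k)%N.
      rewrite leqNgt; apply/negP => zk; have : (0 < #|[set p | (z p < d.*2)%N]|)%N.
        by apply/card_gt0P; exists k; rewrite inE.
      by move/eqP: z3; rewrite -[X in _ == X]add0n eqn_add2r => /eqP ->.
    have /fin_all_exists[h hE] : forall k, exists l : 'I_n, z k = f l.
      by move=> k; have [l ln lE] := z1 k (zd k); exists (Ordinal ln).
    have hI : injective h by move=> k k' E; apply: z2 => //; rewrite !hE E.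
    have zE : z = [ffun k => f (perm hI k)] by apply/ffunP => k; rewrite ffunE permE.
    rewrite zE mcoeff_wv ?ffunE //.
    by move=> k k' /double_inj/addnI; apply: val_inj.
  have [g gE] := Oinf_pairswap K nd.
  have := Uh g (Uy f); congr U; apply/funext => j; rewrite [RHS]yE /wv linear_sum.
  apply: eq_bigr => s _; rewrite linearZ; congr (_ *: _); apply: etrans (tmapU _ _) _.
  rewrite -tensU; congr tens; apply/funext => k; rewrite ffunE gE; congr << _ >>.
  by have := pairswapE n d false (s k); rewrite !add0n ltn_ord /Oletter addnC /f /freshl => ->.
set r := (n - s.+1)%N in yw; have rn : (r < n)%N by rewrite /r; lia.
have rE : (n - s)%N = r.+1 by rewrite /r; lia.
have odd_fresh : prt (freshl r) = (freshl r).+1 by rewrite /prt /freshl odd_double.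
have c1 (l : 'I_(d.*2)) : freshl r != prt l.
  by apply/eqP => E; have := ltn_ord l; rewrite -prt_lt -E /freshl; lia.
have c2 (l : 'I_(d.*2)) : freshl r != prt (prt l).
  by rewrite prtK; apply/eqP => E; have := ltn_ord l; rewrite -E /freshl; lia.
have c3 (l : 'I_(d.*2)) : prt (freshl r) != l.
  by rewrite odd_fresh; apply/eqP => E; have := ltn_ord l; rewrite -E /freshl; lia.
have c4 (l : 'I_(d.*2)) : prt (freshl r) != prt l.
  by rewrite odd_fresh; apply/eqP => E; have := ltn_ord l; rewrite -prt_lt -E /freshl; lia.
pose yl (l : 'I_(d.*2)) j := der (prt l) (freshl r) (y j).
have Uyl l : U (yl l).
  apply: IH => [|j|j z zy|]; first exact: ltnW.
  - move: j; apply: (U_der K0 (U := fun t : J -> T => forall j, t j \in @traceless_pred K n) _ _ _ (c1 l) (c2 l) yt).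
    + by move=> j; apply: rpred0.
    + by move=> a t t' ht ht' j; apply: rpredD; [apply: rpredZ; exact: ht | exact: ht'].

    + by move=> g t tt j; apply: (traceless_stable g (tt j)).
  - rewrite rE; have /existsNP[i] : ~ forall i, (y j)@_i * (der (prt l) (freshl r) << i >>)@_z = 0.
      move=> h; case/eqP: zy; rewrite /yl {1}(malg_sumU (y j)) /lext linear_sum raddf_sum big1 // => i _.
      by rewrite linearZ; apply: etrans (mcoeffZ _ _ _) (h i).
    move=> /eqP; rewrite mulf_eq0 => /norP[yi]; have iw := yw j i yi.
    rewrite (der_fresh rn iw) // => dz; have /existsNP[p] : ~ forall p, (i p == l)%:R * (z == setw i p (freshl r))%:R = 0 :> K.
      move=> h; case/eqP: dz; rewrite raddf_sum big1 // => p _.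
      by apply: etrans (mcoeffZ _ _ _) _; rewrite mcoeffU [_ == z]eq_sym h.
    move=> /eqP; rewrite mulf_eq0 => /norP[]; case: (i p =P l :> nat) => [ip _|]; last by rewrite eqxx.
    case: (z =P _) => [zE _|]; last by rewrite eqxx.
    exact: (der_partial rn iw (ltn_ord l) ip zE).
  - exact: (U_der K0 polU0 polUD polUh (c1 l) (c2 l) Uy).
(* The Casimir sum acts on y as -(s + 1), the number of its old letters being s + 1; the coefficient
   inverts this scalar. *)
have UU := U_sum U0 UD (index_enum 'I_(d.*2)) (fun=> - s.+1%:R^-1)
  (fun l => U_der K0 U0 UD Uh (c3 l) (c4 l) (Uyl l)).
have s0 : s.+1%:R != 0 :> K by apply: natr_neq0.
move: UU; congr U; apply/funext => j; rewrite -scaler_sumr.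
pose C (x : T) := \sum_(l < d.*2) der l (prt (freshl r)) (der (prt l) (freshl r) x).
pose C' (x : T) := - (s.+1%:R) *: x + \sum_p \sum_(q | q != p) repl p q (freshl r) (prt (freshl r)) x.
have Cl : linear C.
  by move=> a x x'; rewrite /C scaler_sumr -big_split; apply: eq_bigr => l _; rewrite !linearP.
have C'l : linear C'.
  move=> a x x'; rewrite /C' scaleDACA scaler_sumr; congr (_ + _).
  rewrite -big_split; apply: eq_bigr => p _; rewrite scaler_sumr -big_split; apply: eq_bigr => q _.
  by rewrite linearP.
pose f := HB.pack_for {linear T -> T} C (GRing.isLinear.Build K _ T *:%R C Cl).
pose f' := HB.pack_for {linear T -> T} C' (GRing.isLinear.Build K _ T *:%R C' C'l).
have E : C (y j) = C' (y j).
  apply: (@lin_eq_supp K _ T f f') => i /yw iw; change (C << i >> = C' << i >>).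
  have iE : #|[set p | (i p < d.*2)%N]| = s.+1.
    by have [_ _ i3] := iw; apply: (@addIn r); rewrite i3 /r; lia.
  by have := casimir_word rn iw; rewrite iE; exact: id.
rewrite -[X in _ *: X]/(C (y j)) E /C' big1 ?addr0 => [|p _]; last first.
  apply: big1 => q qp; apply: (proj1 (traceless_repl (y j)) (yt j)); by rewrite eq_sym.
by rewrite scalerA mulrNN mulVf // scale1r.
Qed.

End Family.
End Generation.

Lemma O_polarizable (K : fieldType) (K0 : [pchar K] =i pred0) :
  polarizable (D := Ocat K) (fun n => traceless K n) (X0 := fun=> tt) (fun n => @Oletter n).
Proof.
split.
- by move=> n i j /double_inj; apply: val_inj.
- by move=> n X s t; apply: traceless_sact.
- move=> n v; apply/traceless_repl => p q c c' pq; rewrite /wv linear_sum big1 // => s _.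
  rewrite linearZ /= replU omegaU !ffunE.
  have -> : (Oletter (s q) == prt (Oletter (s p))) = false.
    by apply/eqP; rewrite /Oletter /prt odd_double; lia.
  by rewrite scale0r scaler0.
- move=> X n ka B.
  (* Large enough for the swap of n pairs and for all letters of [B] and of [ka] to lie below 2d. *)
  pose d := (n + \max_(b <- B) b + \max_k ka k).+1.
  have nd : (n <= d)%N by rewrite /d; lia.
  have kad j : (ka j < d.*2)%N by have : (ka j <= \max_k ka k)%N := leq_bigmax _; rewrite /d; lia.
  have /choice[g gE] := Oinf_subst K nd kad.
  have GE J i : i \in B -> oinf_map (g J) << i >> = << pairswap n d i >> + \sum_(j in J | ka j == i) << Oletter j >>.
    move=> iB; apply: gE; have : (i <= \max_(b <- B) b)%N by apply: leq_bigmax_seq.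
    by rewrite /d; lia.
  exists [seq (iesign K J, g J : bc_hom (b := Ocat K) X tt) | J : {set 'I_n} <- enum {set 'I_n}]; split=> [t|m t mn] tB.
    by rewrite (@lact_tpow_list K (Ocat K)); apply: (polarize GE).
  by rewrite (@lact_tpow_list K (Ocat K)); apply: (polarize_low GE).
- move=> n J U U0 UD Uh [] t ht Ut.
  have [M tM] := common_bound t; pose d := (n + M)%N.
  apply: (U_partial K0 (U0 tt) (UD tt) (Uh tt tt) (d := d) _ (leqnn n) ht _ Ut); first by rewrite /d; lia.
  move=> j i ti; have iM k : (i k < d.*2)%N by have := tM j i ti k; rewrite /d; lia.
  split.
  + by move=> p; rewrite leqNgt iM.
  + by move=> p q; rewrite leqNgt iM.
  + rewrite (subnn n) addn0; apply: etrans (card_ord n); apply: eq_card => p; rewrite inE; exact: iM.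
Qed.

(** * Contractions *)

Lemma in_RepO_embed (K : fieldType) (F : functor (Ocat K)) N (e : nattrans F (tensor_power (Ocat K) N)) :
  (forall X x, e X x = 0 -> x = 0) -> in_RepO F.
Proof.
move=> eI; pose G := dsum_powers K [:: N].
have [Z ZE] := zero_subfunctor G.
have einj X x y : e X x = e X y -> x = y.
  by move=> E; apply/eqP; rewrite -subr_eq0; apply/eqP/(eI X); rewrite linearB /= E subrr.
pose emb X (x : F X) : G X := (e X x, 0).
have [|||B BE] := @subfunctor_of_prop K (Ocat K) G (fun X y => exists x, y = emb X x).
- by move=> X; exists 0; rewrite /emb linear0.
- move=> X a _ _ [x ->] [y ->]; exists (a *: x + y).
  by rewrite /emb linearP /=; congr pair; rewrite /= scaler0 addr0.
- move=> X Y h _ [x ->]; exists (fmap F h x); rewrite /emb nt_nat; congr pair.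
exists [:: N], Z, B; split; first by move=> X x /ZE ->; apply: rpred0.
pose f X (y : G X) : F X := xget 0 [set x | e X x = y.1]%classic.
have fE X x : f X (emb X x) = x.
  by apply: xget_unique => // y; apply: einj.
exists f; split.
- move=> X a _ _ /BE[x ->] /BE[y ->]; rewrite !fE.
  have -> : a *: emb X x + emb X y = emb X (a *: x + y).
    by rewrite /emb linearP /=; congr pair; rewrite /= scaler0 addr0.
  exact: fE.
- move=> X Y h _ /BE[x ->]; rewrite fE.
  have -> : fmap G h (emb X x) = emb Y (fmap F h x) by rewrite /emb nt_nat; congr pair.
  exact: fE.
- move=> X _ /BE[x ->]; rewrite fE; apply/eqP/idP => [->|/ZE[/eI //]].
  by apply/ZE; rewrite /emb linear0.
- by move=> X z; exists (emb X z); [apply/BE; exists z | rewrite fE].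
Qed.

Lemma in_RepO_Osimple (K : fieldType) (K0 : [pchar K] =i pred0) nu : in_RepO (Osimple K nu).
Proof.
pose e : nattrans (Osimple K nu) (tensor_power (Ocat K) (sumn nu)) :=
  @Nattrans K (Ocat K) (Osimple K nu) (tensor_power (Ocat K) (sumn nu)) (fun X => @ev K (Ocat K) nu (traceless K (sumn nu)) X)
    (fun X Y h x => ev_nat h x).
apply: (in_RepO_embed (e := e)) => X x x0.
have [ev0 eI] : ev (0 : Osimple K nu X) = 0 /\ forall y : Osimple K nu X, ev x = ev y -> x = y.
  by split=> [|y]; [apply: linear0 | apply: ev_inj].
by apply: eI; rewrite ev0; exact: x0.
Qed.

Lemma in_RepO_tensor (K : fieldType) (K0 : [pchar K] =i pred0) la mu :
  in_RepO (tensor (Osimple K la) (Osimple K mu)).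
Proof.
apply: (in_RepO_embed (e := @temb K (Ocat K) (fun n => traceless K n) la mu)) => X x x0.
exact: (temb_eq0 x0).
Qed.

Section Contractions.
Variables (K : fieldType) (N r k : nat) (E : 'I_r -> 'I_N) (L R : 'I_k -> 'I_N).

Definition ctr : tpow K nat N -> tpow K nat r := lext (fun i : {ffun 'I_N -> nat} =>
  (\prod_l omega << i (L l) >> << i (R l) >> : K) *: (<< [ffun c => i (E c)] >> : tpow K nat r)).

HB.instance Definition _ := GRing.Linear.copy ctr (lext (fun i : {ffun 'I_N -> nat} =>
  (\prod_l omega << i (L l) >> << i (R l) >> : K) *: (<< [ffun c => i (E c)] >> : tpow K nat r))).

Lemma ctrU i : ctr << i >> = (\prod_l omega << i (L l) >> << i (R l) >>) *: << [ffun c => i (E c)] >>.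
Proof. exact: lextU. Qed.

Lemma ctrZ a x : ctr (a *: x) = a *: ctr x.
Proof. exact: linearZ. Qed.

Hypotheses (EI : injective E) (LI : injective L) (RI : injective R).
Hypotheses (EL : forall c l, E c != L l) (ER : forall c l, E c != R l) (LR : forall l l', L l != R l').
Hypothesis cov : forall x, [\/ exists c, x = E c, exists l, x = L l | exists l, x = R l].

Lemma ctr_tens (v : 'I_N -> {malg K[nat]}) :
  ctr (tens v) = (\prod_l omega (v (L l)) (v (R l))) *: tens (v \o E).
Proof.
move: v; apply: multilinear_eq => [v x a y z|v x a y z|i].
- by rewrite tens_multilinear linearP.
- case: (cov x) => -[c ->{x}].
  + have pE z' : \prod_l omega (upd v (E c) z' (L l)) (upd v (E c) z' (R l)) = \prod_l omega (v (L l)) (v (R l)).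
      by apply: eq_bigr => l _; rewrite /upd ![_ == E c]eq_sym (negPf (EL c l)) (negPf (ER c l)).
    have tE z' : upd v (E c) z' \o E = upd (v \o E) c z'.
      by apply/funext => c'; rewrite /upd /= (inj_eq EI).
    rewrite (pE (a *: y + z)) (pE y) (pE z) (tE (a *: y + z)) (tE y) (tE z) tens_multilinear scalerDr !scalerA [a * _]mulrC; exact: erefl.
  + have pE z' : \prod_l omega (upd v (L c) z' (L l)) (upd v (L c) z' (R l)) =
        omega z' (v (R c)) * \prod_(l | l != c) omega (v (L l)) (v (R l)).
      rewrite (bigD1 c) //= /upd eqxx [_ == L c]eq_sym (negPf (LR _ _)); congr (_ * _).
      by apply: eq_bigr => l lc; rewrite (inj_eq LI) (negPf lc) [_ == L c]eq_sym (negPf (LR _ _)).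
    have tE z' : upd v (L c) z' \o E = v \o E.
      by apply/funext => c'; rewrite /upd /= (negPf (EL _ _)).
    rewrite (pE (a *: y + z)) (pE y) (pE z) (tE (a *: y + z)) (tE y) (tE z) omega_linearl mulrDl scalerDl scalerA mulrA; exact: erefl.
  + have pE z' : \prod_l omega (upd v (R c) z' (L l)) (upd v (R c) z' (R l)) =
        omega (v (L c)) z' * \prod_(l | l != c) omega (v (L l)) (v (R l)).
      rewrite (bigD1 c) //= /upd eqxx (negPf (LR _ _)); congr (_ * _).
      by apply: eq_bigr => l lc; rewrite (inj_eq RI) (negPf lc) (negPf (LR _ _)).
    have tE z' : upd v (R c) z' \o E = v \o E.
      by apply/funext => c'; rewrite /upd /= (negPf (ER _ _)).
    rewrite (pE (a *: y + z)) (pE y) (pE z) (tE (a *: y + z)) (tE y) (tE z) omega_linearr mulrDl scalerDl scalerA mulrA; exact: erefl.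
- rewrite tensU ctrU; congr (_ *: _); first by apply: eq_bigr => l _; rewrite !ffunE.
  by rewrite /comp tensU; congr << _ >>; apply/ffunP => c; rewrite !ffunE.
Qed.

Lemma ctr_tmap (g : Oinf K) x : ctr (tmap (oinf_map g) x) = tmap (oinf_map g) (ctr x).
Proof.
move: x; apply: (@malg_linear_eq K _ _ (ctr \o @tmap K _ _ (oinf_map g) N) (@tmap K _ _ (oinf_map g) r \o ctr)) => i /=.
rewrite tmapU ctr_tens ctrU linearZ /= tmapU; congr (_ *: tens _).
  by apply: eq_bigr => l _; rewrite oinf_omega.
by apply/funext => c /=; rewrite ffunE.
Qed.

End Contractions.
Arguments ctr : simpl never.

Lemma ctr_sact (K : fieldType) N r k (E : 'I_r -> 'I_N) (L R : 'I_k -> 'I_N) s (x : tpow K nat N) :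
  ctr E L R (sact s x) = ctr (s \o E) (s \o L) (s \o R) x.
Proof.
move: x; apply: (@malg_linear_eq K _ _ (ctr E L R \o @sact K nat N s) (ctr (s \o E) (s \o L) (s \o R))) => i /=.
rewrite sactU !ctrU; congr (_ *: << _ >>); last by apply/ffunP => c; rewrite !ffunE.
by apply: eq_bigr => l _; rewrite !ffunE.
Qed.

Lemma ctr_relabel (K : fieldType) N r k (E : 'I_r -> 'I_N) (L R : 'I_k -> 'I_N) (s : 'S_r) (b : 'S_k) (x : tpow K nat N) :
  ctr (E \o s) (L \o b) (R \o b) x = sact s (ctr E L R x).
Proof.
move: x; apply: (@malg_linear_eq K _ _ (ctr (E \o s) (L \o b) (R \o b)) (@sact K nat r s \o ctr E L R)) => i /=.
rewrite !ctrU linearZ /= sactU; congr (_ *: << _ >>); last by apply/ffunP => c; rewrite !ffunE.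
by rewrite [RHS](reindex_inj (@perm_inj _ b)).
Qed.

Lemma ctr_repl (K : fieldType) N r k (E : 'I_r -> 'I_N) (L R : 'I_k -> 'I_N) c c' a a' (x : tpow K nat N) :
  injective E -> (forall c l, E c != L l) -> (forall c l, E c != R l) ->
  repl c c' a a' (ctr E L R x) = ctr E L R (repl (E c) (E c') a a' x).
Proof.
move=> EI EL ER.
move: x; apply: (@malg_linear_eq K _ _ (repl c c' a a' \o ctr E L R) (ctr E L R \o repl (E c) (E c') a a')) => i /=.
rewrite ctrU linearZ /= !replU ctrZ ctrU !scalerA !ffunE mulrC; congr (_ *: << _ >>).
  congr (_ * _); apply: eq_bigr => l _; rewrite !ffunE ![_ == E _]eq_sym.
  by rewrite !(negPf (EL _ _)) !(negPf (ER _ _)).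
by apply/ffunP => d; rewrite !ffunE !(inj_eq EI).
Qed.

(** A division of the positions on one side into p surviving ones and k contracted ones; the
    numbering of the latter matches them with those of the other side. *)
Definition frame p k n (E : 'I_p -> 'I_n) (L : 'I_k -> 'I_n) :=
  [/\ injective E, injective L, forall a l, E a != L l &
      forall x, (exists a, x = E a) \/ (exists l, x = L l)].

Definition sumf p q n m (f : 'I_p -> 'I_n) (g : 'I_q -> 'I_m) (c : 'I_(p + q)) : 'I_(n + m) :=
  match fintype.split c with inl a => lshift m (f a) | inr b => rshift n (g b) end.

Lemma sumf_l n m p q (f : 'I_p -> 'I_n) (g : 'I_q -> 'I_m) a : sumf f g (lshift q a) = lshift m (f a).
Proof. by rewrite /sumf (unsplitK (inl a)). Qed.

Lemma sumf_r n m p q (f : 'I_p -> 'I_n) (g : 'I_q -> 'I_m) b : sumf f g (rshift p b) = rshift n (g b).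
Proof. by rewrite /sumf (unsplitK (inr b)). Qed.

Section Frames.
Variables (K : fieldType) (n m : nat).

Lemma ord_sum_ind p q (Q : 'I_(p + q) -> Prop) :
  (forall a, Q (lshift q a)) -> (forall b, Q (rshift p b)) -> forall c, Q c.
Proof. by move=> Ql Qr c; rewrite -(splitK c); case: (fintype.split c). Qed.

Definition ctr2 p k q (El : 'I_p -> 'I_n) (L : 'I_k -> 'I_n) (Er : 'I_q -> 'I_m) (R : 'I_k -> 'I_m) :=
  @ctr K (n + m) (p + q) k (sumf El Er) (@lshift n m \o L) (@rshift n m \o R).

Lemma frame_sum p k q (El : 'I_p -> 'I_n) (L : 'I_k -> 'I_n) (Er : 'I_q -> 'I_m) (R : 'I_k -> 'I_m) :
  frame El L -> frame Er R ->
  [/\ injective (sumf El Er), forall c l, sumf El Er c != lshift m (L l),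
      forall c l, sumf El Er c != rshift n (R l) &
      forall x, [\/ exists c, x = sumf El Er c, exists l, x = lshift m (L l) | exists l, x = rshift n (R l)]].
Proof.
move=> [lI _ lL lc] [rI _ rR rc]; split.
- elim/ord_sum_ind => a; elim/ord_sum_ind => b; rewrite ?sumf_l ?sumf_r.
  + by move=> /lshift_inj/lI ->.
  + by move=> /eqP; rewrite eq_lrshift.
  + by move=> /eqP; rewrite eq_sym eq_lrshift.
  + by move=> /rshift_inj/rI ->.
- elim/ord_sum_ind => a l; rewrite ?sumf_l ?sumf_r; last by rewrite eq_sym eq_lrshift.
  by rewrite (inj_eq (@lshift_inj _ _)).
- elim/ord_sum_ind => a l; rewrite ?sumf_l ?sumf_r; first by rewrite eq_lrshift.
  by rewrite (inj_eq (@rshift_inj _ _)).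
- elim/ord_sum_ind => a.
    have [[x ->]|[l ->]] := lc a; last by apply: Or32; exists l.
    by apply: Or31; exists (lshift q x); rewrite sumf_l.
  have [[x ->]|[l ->]] := rc a; last by apply: Or33; exists l.
  by apply: Or31; exists (rshift p x); rewrite sumf_r.
Qed.

Lemma ctr2_tmap p k q (El : 'I_p -> 'I_n) (L : 'I_k -> 'I_n) (Er : 'I_q -> 'I_m) (R : 'I_k -> 'I_m) (g : Oinf K) x :
  frame El L -> frame Er R -> ctr2 El L Er R (tmap (oinf_map g) x) = tmap (oinf_map g) (ctr2 El L Er R x).
Proof.
move=> fl fr; have [fI fL fR fc] := frame_sum fl fr.
have [_ LI _ _] := fl; have [_ RI _ _] := fr.
apply: ctr_tmap => //.
- by move=> l l' /lshift_inj/LI.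
- by move=> l l' /rshift_inj/RI.
- by move=> l l'; rewrite /= eq_lrshift.
Qed.

(* With one pair fewer, the positions L 0 and R 0 become the position 0 of each side. *)
Lemma ctr2_succ p k q (El : 'I_p -> 'I_n) (L : 'I_k.+1 -> 'I_n) (Er : 'I_q -> 'I_m) (R : 'I_k.+1 -> 'I_m) x :
  let ext r N (E : 'I_r -> 'I_N) y := fun a : 'I_r.+1 => if unlift ord0 a is Some a' then E a' else y in
  ctr2 (ext _ _ El (L ord0)) (L \o lift ord0) (ext _ _ Er (R ord0)) (R \o lift ord0) x = 0 ->
  ctr2 El L Er R x = 0.
Proof.
move=> ext; pose g : tpow K nat (p.+1 + q.+1) -> tpow K nat (p + q) := lext (fun w : {ffun 'I_(p.+1 + q.+1) -> nat} =>
  omega << w (lshift q.+1 ord0) >> << w (rshift p.+1 ord0) >> *: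
  (<< [ffun c => w (sumf (lift ord0) (lift ord0) c)] >> : tpow K nat (p + q))).
have E : forall x, ctr2 El L Er R x = g (ctr2 (ext _ _ El (L ord0)) (L \o lift ord0) (ext _ _ Er (R ord0)) (R \o lift ord0) x).
  apply: (@malg_linear_eq K _ _ (ctr2 El L Er R) (lext _ \o ctr2 _ _ _ _)) => i /=.
  rewrite /ctr2 !ctrU linearZ /= lextU !ffunE sumf_l sumf_r /ext !unlift_none scalerA.
  rewrite big_ord_recl /= mulrC; congr (_ *: << _ >>).
  apply/ffunP; elim/ord_sum_ind => a; by rewrite !ffunE !(sumf_l, sumf_r) liftK.
by move=> x0; rewrite E x0; apply: (linear0 (lext _)).
Qed.

Lemma frame_succ p k N (E : 'I_p -> 'I_N) (L : 'I_k.+1 -> 'I_N) : frame E L ->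
  frame (fun a : 'I_p.+1 => if unlift ord0 a is Some a' then E a' else L ord0) (L \o lift ord0).
Proof.
move=> [EI LI EL c]; split.
- move=> a b; case: (unliftP ord0 a) => [a' ->|->]; case: (unliftP ord0 b) => [b' ->|->] //.
  + by move=> /EI ->.
  + by move=> /eqP; rewrite (negPf (EL _ _)).
  + by move=> /esym/eqP; rewrite (negPf (EL _ _)).
- by move=> l l' /LI/lift_inj.
- move=> a l; case: (unliftP ord0 a) => [a' _|_]; first exact: EL.
  by rewrite /= (inj_eq LI) neq_lift.
- move=> x; have [[a ->]|[l ->]] := c x; first by left; exists (lift ord0 a); rewrite liftK.
  case: (unliftP ord0 l) => [l' ->|->]; first by right; exists l'.
  by left; exists ord0; rewrite unlift_none.
Qed.

Lemma frame_pred p k N (E : 'I_p.+1 -> 'I_N) (L : 'I_k -> 'I_N) a : frame E L ->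
  frame (E \o lift a) (fun l : 'I_k.+1 => if unlift ord0 l is Some l' then L l' else E a).
Proof.
move=> [EI LI EL c]; split.
- by move=> b b' /EI/lift_inj.
- move=> l l'; case: (unliftP ord0 l) => [m1 ->|->]; case: (unliftP ord0 l') => [m2 ->|->] //.
  + by move=> /LI ->.
  + by move=> /esym/eqP; rewrite (negPf (EL _ _)).
  + by move=> /eqP; rewrite (negPf (EL _ _)).
- move=> b l; case: (unliftP ord0 l) => [l' _|_]; first exact: EL.
  by rewrite /= (inj_eq EI) eq_sym neq_lift.
- move=> x; have [[b ->]|[l ->]] := c x; last by right; exists (lift ord0 l); rewrite liftK.
  case: (unliftP a b) => [b' ->|->]; first by left; exists b'.
  by right; exists ord0; rewrite unlift_none.
Qed.

(** Contracting two surviving positions, one on each side, after k cross contractions amounts to k +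
    1 cross contractions; the new pair is given the index 0. *)
Lemma ctr2_pred p k q (El : 'I_p.+1 -> 'I_n) (L : 'I_k -> 'I_n) (Er : 'I_q.+1 -> 'I_m) (R : 'I_k -> 'I_m) a b y y' x :
  let ext N (F : 'I_k -> 'I_N) z := fun l : 'I_k.+1 => if unlift ord0 l is Some l' then F l' else z in
  ctr2 (El \o lift a) (ext _ L (El a)) (Er \o lift b) (ext _ R (Er b)) x = 0 ->
  repl (lshift q.+1 a) (rshift p.+1 b) y y' (ctr2 El L Er R x) = 0.
Proof.
move=> ext; pose ins r (c : 'I_r.+1) z (w : 'I_r -> nat) := [ffun c' => if unlift c c' is Some c'' then w c'' else z].
pose g : tpow K nat (p + q) -> tpow K nat (p.+1 + q.+1) := lext (fun w : {ffun 'I_(p + q) -> nat} =>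
  << catw (ins _ a y (fun c => w (lshift q c))) (ins _ b y' (fun c => w (rshift p c))) >> : tpow K nat (p.+1 + q.+1)).
have E : forall x, repl (lshift q.+1 a) (rshift p.+1 b) y y' (ctr2 El L Er R x) =
    g (ctr2 (El \o lift a) (ext _ L (El a)) (Er \o lift b) (ext _ R (Er b)) x).
  apply: (@malg_linear_eq K _ _ (repl _ _ _ _ \o ctr2 El L Er R) (lext _ \o ctr2 _ _ _ _)) => i /=.
  rewrite /ctr2 !ctrU !linearZ /= lextU replU !ffunE sumf_l sumf_r scalerA.
  rewrite big_ord_recl /= /ext !unlift_none mulrC; congr (_ *: << _ >>).
    by congr (_ * _); apply: eq_bigr => l _; rewrite !liftK.
  apply/ffunP; elim/ord_sum_ind => c; rewrite ffunE ?catw_l ?catw_r !ffunE.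
    rewrite (inj_eq (@lshift_inj _ _)) eq_lrshift sumf_l; case: (unliftP a c) => [c' ->|->]; last by rewrite eqxx.
    by rewrite eq_sym (negPf (neq_lift _ _)) ffunE sumf_l.
  rewrite (inj_eq (@rshift_inj _ _)) sumf_r; case: (unliftP b c) => [c' ->|->]; last by rewrite eqxx eq_sym eq_lrshift.
  by rewrite [rshift _ _ == lshift _ _]eq_sym eq_lrshift eq_sym (negPf (neq_lift _ _)) ffunE sumf_r.
by move=> x0; rewrite E x0; apply: (linear0 (lext _)).
Qed.

End Frames.

Lemma replC (K : fieldType) n (p q : 'I_n) c c' (x : tpow K nat n) : p != q ->
  repl p q c c' x = repl q p c' c x.
Proof.
move=> pq; move: x; apply: (@malg_linear_eq K _ _ (repl p q c c') (repl q p c' c)) => i /=.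
rewrite !replU omegaC; congr (_ *: << _ >>); apply/ffunP => k; rewrite !ffunE.
by case: (eqVneq k p) => [->|_] //; rewrite (negPf pq).
Qed.

Lemma frame_perm p k n (E : 'I_p -> 'I_n) (L : 'I_k -> 'I_n) (s : 'S_n) :
  frame E L -> frame (s \o E) (s \o L).
Proof.
move=> [EI LI EL c]; split.
- by move=> a b /perm_inj/EI.
- by move=> a b /perm_inj/LI.
- by move=> a l; rewrite /= (inj_eq perm_inj).
- move=> x; have [[a xE]|[l xE]] := c (s^-1 x)%g; [left; exists a|right; exists l];
    by rewrite /= -xE permKV.
Qed.

Lemma frame_std p k : frame (@lshift p k) (@rshift p k).
Proof.
split; [exact: lshift_inj | exact: rshift_inj | by move=> a l; rewrite eq_lrshift |].
by elim/ord_sum_ind => a; [left | right]; exists a.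
Qed.

Lemma frame_card p k n (E : 'I_p -> 'I_n) (L : 'I_k -> 'I_n) : frame E L -> (p + k)%N = n.
Proof.
move=> [EI LI EL c]; pose f (x : 'I_p + 'I_k) := match x with inl a => E a | inr l => L l end.
have fI : injective f.
  move=> [a|a] [b|b] /=; [by move/EI-> | | | by move/LI->].
    by move=> /eqP; rewrite (negPf (EL _ _)).
  by move=> /esym/eqP; rewrite (negPf (EL _ _)).
have fT : codom f =i predT.
  by move=> x; apply/codomP; have [[a ->]|[l ->]] := c x; [exists (inl a) | exists (inr l)].
by have := card_codom fI; rewrite (eq_card fT) card_sum !card_ord.
Qed.

Lemma frame_stdP p k (E : 'I_p -> 'I_(p + k)) (L : 'I_k -> 'I_(p + k)) : frame E L ->
  exists s : 'S_(p + k), E = s \o @lshift p k /\ L = s \o @rshift p k.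
Proof.
move=> [EI LI EL c].
have fI : injective (fun x : 'I_(p + k) => match fintype.split x with inl a => E a | inr l => L l end).
  elim/ord_sum_ind => a; elim/ord_sum_ind => b; rewrite ?(unsplitK (inl _)) ?(unsplitK (inr _)).
  - by move/EI ->.
  - by move=> /eqP; rewrite (negPf (EL _ _)).
  - by move=> /esym/eqP; rewrite (negPf (EL _ _)).
  - by move/LI ->.
exists (perm fI); split; apply/funext => a; rewrite /= permE; first by rewrite (unsplitK (inl a)).
by rewrite (unsplitK (inr a)).
Qed.

Lemma ctr2_sact (K : fieldType) n m p k q (El : 'I_p -> 'I_n) (L : 'I_k -> 'I_n) (Er : 'I_q -> 'I_m)
    (R : 'I_k -> 'I_m) s t (x : tpow K nat (n + m)) :
  ctr2 El L Er R (sact (psum s t) x) = ctr2 (s \o El) (s \o L) (t \o Er) (t \o R) x.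
Proof.
have E1 : psum s t \o sumf El Er = sumf (s \o El) (t \o Er).
  apply/funext; elim/ord_sum_ind => c; rewrite [LHS]/=; first by rewrite !sumf_l psum_l.
  by rewrite !sumf_r psum_r.
have E2 : psum s t \o (@lshift n m \o L) = @lshift n m \o (s \o L) by apply/funext => l; apply: psum_l.
have E3 : psum s t \o (@rshift n m \o R) = @rshift n m \o (t \o R) by apply/funext => l; apply: psum_r.
by apply: etrans (ctr_sact _ _ _ _ _) _; rewrite E1 E2 E3; exact: erefl.
Qed.

Lemma ctr2_relabel (K : fieldType) n m p k q (El : 'I_p -> 'I_n) (L : 'I_k -> 'I_n) (Er : 'I_q -> 'I_m)
    (R : 'I_k -> 'I_m) (a : 'S_p) (b : 'S_k) (c : 'S_q) (x : tpow K nat (n + m)) :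
  ctr2 (El \o a) (L \o b) (Er \o c) (R \o b) x = sact (psum a c) (ctr2 El L Er R x).
Proof.
have E1 : sumf (El \o a) (Er \o c) = sumf El Er \o psum a c.
  apply/funext; elim/ord_sum_ind => d; rewrite [RHS]/=; first by rewrite psum_l !sumf_l.
  by rewrite psum_r !sumf_r.
by rewrite /ctr2 E1; exact: (ctr_relabel _ (@lshift n m \o L) (@rshift n m \o R)).
Qed.

(** The degrees n and m are free variables, so that they can be replaced by p + k and q + k.
    Surjectivity is asked only on words isotropic on each side, whose halves are traceless. *)
Record tensor_embedding (K : fieldType) (la mu : intpart) (n m : nat) (F : functor (Ocat K))
    (i0 : nattrans F (tensor_power (Ocat K) (n + m))) : Prop := TensorEmbedding {
  te_inj : forall X z, i0 X z = 0 -> z = 0;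
  te_idem : forall X z, pact (gtens (yidem K n la) (yidem K m mu)) (i0 X z) = i0 X z;
  te_left : forall X z a a' c c', a != a' -> repl (lshift m a) (lshift m a') c c' (i0 X z) = 0;
  te_right : forall X z b b' c c', b != b' -> repl (rshift n b) (rshift n b') c c' (i0 X z) = 0;
  te_surj : forall i : {ffun 'I_(n + m) -> nat},
    (forall a a', i (lshift m a') != prt (i (lshift m a))) ->
    (forall b b', i (rshift n b') != prt (i (rshift n b))) ->
    exists z : F tt, i0 tt z = pact (gtens (yidem K n la) (yidem K m mu)) << i >> }.

Section Filtration.
Variables (K : fieldType) (la mu : intpart) (n m : nat) (F : functor (Ocat K)).
Variable i0 : nattrans F (tensor_power (Ocat K) (n + m)).
Hypothesis te : tensor_embedding la mu i0.

(** Quantifying over p and q, although frames force p + k = n and q + k = m, spares casts between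
    the types of positions. *)
Definition frames_vanish k X (z : F X) := forall p q (El : 'I_p -> 'I_n) (L : 'I_k -> 'I_n)
  (Er : 'I_q -> 'I_m) (R : 'I_k -> 'I_m), frame El L -> frame Er R -> ctr2 El L Er R (i0 X z) = 0.

Lemma filt_ex k : exists C : subfunctor F, forall X z, (z \in C X) <-> frames_vanish k z.
Proof.
apply: subfunctor_of_prop.
- by move=> X p q El L Er R _ _; rewrite linear0; apply: (linear0 (ctr _ _ _)).
- move=> X a x y hx hy p q El L Er R fl fr; rewrite linearP; apply: etrans (linearP (ctr _ _ _) a _ _) _.
  apply: etrans (congr2 (fun u v => a *: u + v) (hx p q El L Er R fl fr) (hy p q El L Er R fl fr)) _.
  by rewrite scaler0 addr0.
- move=> X Y h x hx p q El L Er R fl fr; rewrite nt_nat.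
  rewrite [LHS](ctr2_tmap _ _ fl fr) hx //; exact: (linear0 (@tmap K nat nat (oinf_map h) (p + q))).
Qed.

Definition filt k : subfunctor F := sval (cid (filt_ex k)).

Lemma filtP k X z : (z \in filt k X) <-> frames_vanish k z.
Proof. exact: (svalP (cid (filt_ex k)) X z). Qed.

Lemma filt0 X z : z \in filt 0 X -> z = 0.
Proof.
have fr N : frame (@id 'I_N) (fun l : 'I_0 => widen_ord (leq0n N) l).
  by split=> // [[]|a []|x] //; left; exists x.
move=> /filtP h; apply: (te_inj te); have := h _ _ _ _ _ _ (fr n) (fr m).
have E : @ctr2 K n m n 0 m (@id 'I_n) (fun l : 'I_0 => widen_ord (leq0n n) l) (@id 'I_m) (fun l : 'I_0 => widen_ord (leq0n m) l) =1 idfun.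
  apply: (@malg_linear_eq K _ (tpow K nat (n + m)) (@ctr K _ _ _ _ _ _) idfun) => i; have := @ctrU K _ _ _ (sumf (@id (ordinal n)) (@id (ordinal m))) (@lshift n m \o fun l : (ordinal 0) => widen_ord (leq0n n) l) (@rshift n m \o fun l : (ordinal 0) => widen_ord (leq0n m) l) i; rewrite big_ord0 scale1r => E; apply: etrans E _; congr << _ >>.
  by apply/ffunP; elim/ord_sum_ind => a; rewrite ffunE !(sumf_l, sumf_r).
by rewrite E.
Qed.

Lemma filt_top X z : z \in filt (minn n m).+1 X.
Proof.
by apply/filtP => p q El L Er R /frame_card en /frame_card em; exfalso; move: en em; lia.
Qed.

Lemma filt_le k : sfle (filt k) (filt k.+1).
Proof.
move=> X z /filtP h; apply/filtP => p q El L Er R fl fr.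
by apply: ctr2_succ; apply: h; apply: frame_succ.
Qed.

(** A further contraction across the two sides is a contraction of k + 1 pairs, zero on this step of
    the filtration; one within a side vanishes because both factors are traceless. *)
Lemma filt_traceless k X (z : F X) p q (El : 'I_p -> 'I_n) (L : 'I_k -> 'I_n) (Er : 'I_q -> 'I_m)
    (R : 'I_k -> 'I_m) : z \in filt k.+1 X -> frame El L -> frame Er R ->
  ctr2 El L Er R (i0 X z) \in @traceless_pred K (p + q).
Proof.
move=> /filtP h fl fr; have [fI fL fR _] := frame_sum fl fr.
have across a b y y' : repl (lshift q a) (rshift p b) y y' (ctr2 El L Er R (i0 X z)) = 0.
  case: p q => [|p] [|q] in El Er fl fr fI fL fR a b *; [by case: a|by case: a|by case: b|].
  by apply: ctr2_pred; apply: h; apply: frame_pred.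
have [lI _ _ _] := fl; have [rI _ _ _] := fr.
apply/traceless_repl; elim/ord_sum_ind => c; elim/ord_sum_ind => c' y y' cc.
- rewrite /ctr2 ctr_repl // !sumf_l (te_left te); first exact: (linear0 (ctr _ _ _)).
  by move: cc; rewrite (inj_eq (@lshift_inj _ _)) (inj_eq lI).
- exact: across.
- by rewrite replC //; apply: across.
- rewrite /ctr2 ctr_repl // !sumf_r (te_right te); first exact: (linear0 (ctr _ _ _)).
  by move: cc; rewrite (inj_eq (@rshift_inj _ _)) (inj_eq rI).
Qed.

End Filtration.

Section StandardFrames.
Variables (K : fieldType) (p k q : nat).
Notation n := (p + k)%N.
Notation m := (q + k)%N.

Definition sctr : tpow K nat (n + m) -> tpow K nat (p + q) :=
  ctr2 (@lshift p k) (@rshift p k) (@lshift q k) (@rshift q k).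

HB.instance Definition _ := GRing.Linear.copy sctr
  (ctr (sumf (@lshift p k) (@lshift q k)) (@lshift n m \o @rshift p k) (@rshift n m \o @rshift q k)).

(** The same [b] acts on both members of the contracted pairs, which only reorders the
    contractions. *)
Lemma sctr_equiv (a : 'S_p) (b : 'S_k) (c : 'S_q) x :
  sctr (sact (psum (psum a b) (psum c b)) x) = sact (psum a c) (sctr x).
Proof.
have El r (s : 'S_r) (t : 'S_k) : psum s t \o @lshift r k = @lshift r k \o s by apply/funext => d; apply: psum_l.
have Er r (s : 'S_r) (t : 'S_k) : psum s t \o @rshift r k = @rshift r k \o t by apply/funext => d; apply: psum_r.
by rewrite /sctr ctr2_sact !El !Er; exact: ctr2_relabel.
Qed.

Variables (la mu : intpart) (F : functor (Ocat K)).
Variable i0 : nattrans F (tensor_power (Ocat K) (n + m)).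
Hypothesis te : tensor_embedding la mu i0.

(** Every frame is a permutation of the standard one, so these maps run through all contractions of
    k pairs. The repetitions among them are what [twisted] expresses. *)
Definition theta_fun (j : 'S_n * 'S_m) X (z : F X) : tpow K nat (p + q) :=
  sctr (sact (psum j.1 j.2) (i0 X z)).

Fact theta_linear j X : linear (@theta_fun j X).
Proof. by move=> a x y; rewrite /theta_fun !linearP. Qed.

HB.instance Definition _ j X := GRing.isLinear.Build K (F X) (tpow K nat (p + q)) *:%R
  (@theta_fun j X) (@theta_linear j X).

Fact theta_nat j X Y (h : bc_hom X Y) z :
  theta_fun j (fmap F h z) = fmap (tensor_power (Ocat K) (p + q)) h (theta_fun j z).
Proof.
rewrite /theta_fun nt_nat; apply: etrans (congr1 sctr (sact_tmap _ _ _)) _.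
exact: (ctr2_tmap _ _ (frame_std p k) (frame_std q k)).
Qed.

Definition theta j : nattrans F (tensor_power (Ocat K) (p + q)) :=
  @Nattrans K (Ocat K) F (tensor_power (Ocat K) (p + q)) (fun X => @theta_fun j X) (theta_nat j).

Lemma theta_traceless j X z : z \in filt i0 k.+1 X -> theta j X z \in traceless K (p + q) X.
Proof.
move=> zF; rewrite /= /theta_fun /sctr ctr2_sact.
by apply: (filt_traceless te zF); apply: frame_perm; apply: frame_std.
Qed.

Lemma theta_filt X z : z \in filt i0 k X <-> forall j, theta j X z = 0.
Proof.
split=> [/filtP h j|h].
  by rewrite /= /theta_fun /sctr ctr2_sact; apply: h; apply: frame_perm; apply: frame_std.
apply/filtP => p' q' El L Er R fl fr.
have ep : p' = p by apply: (@addIn k); apply: frame_card fl.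
have eq : q' = q by apply: (@addIn k); apply: frame_card fr.
subst p' q'; have [s [-> ->]] := frame_stdP fl; have [t [-> ->]] := frame_stdP fr.
by rewrite -ctr2_sact; apply: (h (s, t)).
Qed.

End StandardFrames.

(** * The space of a layer *)

Section TwistedDimension.
Variables (K : fieldType) (J H : finGroupType) (P : nat).
Variables (hJ : H -> J) (hP : H -> 'S_P) (e : J -> K) (x : {ffun 'S_P -> K^o}).
Notation V := {ffun J * 'S_P -> K^o}.
Hypothesis hJM : {morph hJ : a b / (a * b)%g}.
Hypothesis hPM : {morph hP : a b / (a * b)%g}.
Hypothesis ee : forall u, \sum_s e s * e (s^-1 * u)%g = e u.
Hypothesis xx : gm x x = x.

(* For the layers: J is the group acting on the positions of T_(n+m), H the
   subgroup preserving the contracted pairs, e a Young idempotent. *)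
Definition twisted (v : V) := forall h j, vj (hJ h * j)%g v = gm (fdelta K (hP h)) (vj j v).
Definition averaged (v : V) := forall j, \sum_s e s *: vj (j * s)%g v = vj j v.

Let T h (j : J) v := gm (gm (fdelta K (hP h)^-1%g) (vj j v)) x.
Let B (v : V) : V := vof (fun j => \sum_h \sum_s e s *: T h (hJ h * j * s)%g v).

Let TL h j : linear (T h j).
Proof. by move=> a u v; rewrite /T vj_linear gm_linearr gm_linearl. Qed.

Let Blin : linear B.
Proof.
move=> a u v; apply: vj_eq => j; rewrite vj_linear !vofK scaler_sumr -big_split.
apply: eq_bigr => h _; rewrite /= scaler_sumr -big_split; apply: eq_bigr => s _.
by rewrite TL scalerDr !scalerA mulrC.
Qed.

(** The operator [B] sums over H, over [e] and multiplies by [x]; it maps into [U] and is #|H| times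
    the identity there. Its trace in the basis of pairs of group elements is the left-hand side. *)
Lemma twisted_dim (U : {vspace V}) :
  (forall v, v \in U <-> [/\ twisted v, averaged v & forall j, gm (vj j v) x = vj j v]) ->
  \sum_h (\sum_j e (j^-1 * (hJ h)^-1 * j)%g) * chi x (hP h) = #|H|%:R * (\dim U)%:R.
Proof.
move=> UE; rewrite -(trace_dim (B := B)) //.
- transitivity (\sum_j \sum_r B (fdelta K (j, r)) (j, r)); last first.
    by rewrite pair_bigA; apply: eq_bigr => -[].
  transitivity (\sum_j \sum_r \sum_h \sum_s (e s * ((hJ h * j * s)%g == j)%:R) *
      gm (gm (fdelta K (hP h)^-1%g) (fdelta K r)) x r).
    transitivity (\sum_j \sum_h \sum_r \sum_s (e s * ((hJ h * j * s)%g == j)%:R) *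
        gm (gm (fdelta K (hP h)^-1%g) (fdelta K r)) x r); last first.
      by apply: eq_bigr => j _; rewrite exchange_big.
    rewrite exchange_big; apply: eq_bigr => h _ /=.
    have -> : chi x (hP h) = \sum_r gm (gm (fdelta K (hP h)^-1%g) (fdelta K r)) x r.
      rewrite trace_gm (bigD1 (hP h)^-1%g) //= ffunE eqxx mul1r invgK big1 ?addr0 // => s /negPf sh.
      by rewrite ffunE sh mul0r.
    rewrite mulr_suml; apply: eq_bigr => j _; rewrite mulr_sumr; apply: eq_bigr => r _.
    rewrite -mulr_suml; congr (_ * _); rewrite (bigD1 (j^-1 * (hJ h)^-1 * j)%g) //= big1 ?addr0.
      by rewrite !mulgA mulgK mulgV mul1g eqxx mulr1.
    move=> s sj; case: eqP => [E|_]; last by rewrite mulr0.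
    by case/eqP: sj; rewrite -{2}E !mulgA mulgKV mulVg mul1g.
  apply: eq_bigr => j _; apply: eq_bigr => r _; rewrite [RHS]ffunE sum_ffunE; apply: eq_bigr => h _.
  rewrite sum_ffunE; apply: eq_bigr => s _; rewrite [RHS]ffunE -mulrA; congr (_ * _).
  rewrite /T; have -> : vj (hJ h * j * s)%g (fdelta K (j, r)) = ((hJ h * j * s)%g == j)%:R *: fdelta K r.
    by apply/ffunP => t; rewrite !ffunE xpair_eqE; case: eqP => _; rewrite /= ?scale0r ?scale1r.
  by rewrite gmZr gmZl [RHS]ffunE.
- move=> v; apply/UE; split=> [h0 j|j|j].
  + rewrite !vofK gm_sumr [RHS](reindex_inj (mulIg h0)); apply: eq_bigr => h _.
    rewrite gm_sumr; apply: eq_bigr => s _; rewrite gmZr /T !gmA gm_delta !hJM hPM !mulgA invMg mulKVg.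
    by [].
  + rewrite !vofK; under eq_bigr => s' _ do rewrite vofK scaler_sumr.
    rewrite exchange_big; apply: eq_bigr => h _ /=.
    transitivity (\sum_u (\sum_s e s * e (s^-1 * u)%g) *: T h (hJ h * j * u)%g v).
      under [RHS]eq_bigr do rewrite scaler_suml.
      rewrite [RHS]exchange_big; apply: eq_bigr => s _ /=; rewrite scaler_sumr.
      rewrite [RHS](reindex_inj (mulgI s)); apply: eq_bigr => u _.
      by rewrite scalerA mulKg !mulgA.
    by apply: eq_bigr => u _; rewrite ee.
  + rewrite !vofK gm_suml; apply: eq_bigr => h _; rewrite gm_suml; apply: eq_bigr => s _.
    by rewrite gmZl /T -gmA xx.
- move=> v /UE[v1 v2 v3]; apply: vj_eq => j; rewrite vofK vjZ (eq_bigr (fun=> vj j v)).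
    by rewrite sumr_const -scaler_nat.
  move=> h _; transitivity (gm (gm (fdelta K (hP h)^-1%g) (\sum_s e s *: vj (hJ h * j * s)%g v)) x).
    by rewrite gm_sumr gm_suml; apply: eq_bigr => s _; rewrite gmZr gmZl.
  by rewrite v2 v1 gmA gm_delta mulVg gm1l v3.
Qed.

Lemma twisted0 : twisted 0.
Proof. by move=> h j; rewrite !linear0 gm0r. Qed.

Lemma twistedD a u v : twisted u -> twisted v -> twisted (a *: u + v).
Proof. by move=> tu tv h j; rewrite !vj_linear gm_linearr tu tv. Qed.

Lemma averaged0 : averaged 0.
Proof. by move=> j; rewrite linear0 big1 // => s _; rewrite linear0 scaler0. Qed.

Lemma averagedD a u v : averaged u -> averaged v -> averaged (a *: u + v).
Proof.
move=> hu hv j; rewrite vj_linear -[in RHS]hu -[in RHS]hv scaler_sumr -big_split; apply: eq_bigr => s _.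
by rewrite vj_linear scalerDr !scalerA mulrC.
Qed.

End TwistedDimension.

Section LayerSpace.
Variables (K : fieldType) (K0 : [pchar K] =i pred0) (p k q : nat) (la mu : intpart).
Notation n := (p + k)%N.
Notation m := (q + k)%N.
Notation P := (p + q)%N.
Notation H := ('S_p * 'S_k * 'S_q)%type.
Notation J := ('S_n * 'S_m)%type.
Notation ee := (gtens (yidem K n la) (yidem K m mu)).

Definition hJ (h : H) : J := (psum h.1.1 h.1.2, psum h.2 h.1.2).
Definition hP (h : H) : 'S_P := psum h.1.1 h.2.
Definition eJ (j : J) : K := (yidem K n la j.1 : K) * (yidem K m mu j.2 : K).

Lemma hJM : {morph hJ : a b / (a * b)%g}.
Proof. by move=> a b; rewrite /hJ /= -!psumM. Qed.

Lemma hPM : {morph hP : a b / (a * b)%g}.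
Proof. by move=> a b; rewrite /hP /= -!psumM. Qed.

Lemma pact_ee (x : tpow K nat (n + m)) : pact ee x = \sum_j eJ j *: sact (psum j.1 j.2) x.
Proof.
rewrite /gtens pact_sum; under eq_bigr do rewrite pact_sum.
by rewrite pair_bigA; apply: eq_bigr => j _; rewrite pactZ pact_delta.
Qed.

(* The positions to be contracted carry the hyperbolic pairs of letters
   (P + l).*2, (P + l).*2.+1, the others the isotropic letters of Oletter. *)
Definition insw (r : 'S_P) : {ffun 'I_(n + m) -> nat} := [ffun c => match fintype.split c with
  | inl a => match fintype.split a with inl u => Oletter (r (lshift q u)) | inr l => (P + l).*2 end
  | inr b => match fintype.split b with inl u => Oletter (r (rshift p u)) | inr l => (P + l).*2.+1 end end].

Lemma insw_ll r u : insw r (lshift m (lshift k u)) = (r (lshift q u)).*2.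
Proof. by rewrite ffunE (unsplitK (inl _)) (unsplitK (inl u)). Qed.

Lemma insw_lr r l : insw r (lshift m (rshift p l)) = (P + l).*2.
Proof. by rewrite ffunE (unsplitK (inl _)) (unsplitK (inr l)). Qed.

Lemma insw_rl r u : insw r (rshift n (lshift k u)) = (r (rshift p u)).*2.
Proof. by rewrite ffunE (unsplitK (inr _)) (unsplitK (inl u)). Qed.

Lemma insw_rr r l : insw r (rshift n (rshift q l)) = (P + l).*2.+1.
Proof. by rewrite ffunE (unsplitK (inr _)) (unsplitK (inr l)). Qed.

Lemma prt_double i : prt i.*2 = i.*2.+1.
Proof. by rewrite /prt odd_double. Qed.

(** In such a word a letter on the left is dual to a letter on the right only within one of the
    planted hyperbolic pairs. *)
Lemma ctr2_insw p' k' q' (El : 'I_p' -> 'I_n) (L : 'I_k' -> 'I_n) (Er : 'I_q' -> 'I_m) (R : 'I_k' -> 'I_m) r :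
  ctr2 El L Er R (<< insw r >> : tpow K nat (n + m)) <> 0 ->
  forall l, exists l0, L l = rshift p l0 /\ R l = rshift q l0.
Proof.
move=> h l; have : omega << insw r (lshift m (L l)) >> << insw r (rshift n (R l)) >> != 0 :> K.
  apply: contra_notN h => /eqP l0; rewrite /ctr2 ctrU (bigD1 l) //=.
  have -> : omega << insw r (lshift m (L l)) >> << insw r (rshift n (R l)) >> = 0 :> K by exact: l0.
  by rewrite mul0r scale0r.
rewrite omegaU; case: (_ =P prt _) => [+ _|_]; last by rewrite eqxx.
elim/ord_sum_ind: (L l) => u; elim/ord_sum_ind: (R l) => u';
  rewrite ?insw_ll ?insw_lr ?insw_rl ?insw_rr prt_double => E.
- by exfalso; lia.
- by exfalso; have := ltn_ord (r (lshift q u)); lia.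
- by exfalso; lia.
- by exists u; split=> //; congr rshift; case: E => /double_inj/addnI; apply: val_inj.
Qed.

Lemma insw_isotropic r (s : 'S_n) (t : 'S_m) : let i := [ffun c => insw r (psum s t c)] in
  (forall a a', i (lshift m a') != prt (i (lshift m a))) /\
  (forall b b', i (rshift n b') != prt (i (rshift n b))).
Proof.
move=> i; have iE c : i c = insw r (psum s t c) by rewrite [LHS]ffunE.
have l a : exists x, insw r (lshift m a) = x.*2.
  by elim/ord_sum_ind: a => u; rewrite ?insw_ll ?insw_lr; eexists.
have r2 b b' : insw r (rshift n b') <> prt (insw r (rshift n b)).
  elim/ord_sum_ind: b => u; elim/ord_sum_ind: b' => u'; rewrite ?insw_rl ?insw_rr ?prt_double.
  - by lia.
  - by have := ltn_ord (r (rshift p u)); lia.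
  - by rewrite /prt /= odd_double /=; have := ltn_ord (r (rshift p u')); lia.
  - by rewrite /prt /= odd_double /=; lia.
split=> a a'; rewrite !iE ?psum_l ?psum_r; last by apply/eqP; exact: r2.
have [x ->] := l (s a); have [y ->] := l (s a'); rewrite prt_double; apply/eqP; lia.
Qed.

Lemma perm_split r (s : 'S_(r + k)) (f : 'I_k -> 'I_k) : (forall l, s (rshift r l) = rshift r (f l)) ->
  exists (a : 'S_r) (b : 'S_k), s = psum a b /\ forall l, f l = b l.
Proof.
move=> sf; have fI : injective f.
  by move=> l l' E; apply: (@rshift_inj r); apply: (@perm_inj _ s); rewrite !sf E.
have gE u : exists v, s (lshift k u) = lshift k v.
  move E: (s (lshift k u)) => c; elim/ord_sum_ind: c E => [v E|l]; first by exists v.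
  rewrite -(permKV (perm fI) l) permE -sf => /perm_inj/eqP; by rewrite eq_lrshift.
have /fin_all_exists[g gE'] := gE.
have gI : injective g.
  by move=> u u' E; apply: (@lshift_inj r k); apply: (@perm_inj _ s); rewrite !gE' E.
exists (perm gI), (perm fI); split=> [|l]; last by rewrite permE.
by apply: psum_ext => u; rewrite ?psum_l ?psum_r permE.
Qed.

Definition Oword (r : 'S_P) : tpow K nat P := << [ffun j => Oletter (r j)] >>.

Lemma sctr_insw r : sctr (<< insw r >> : tpow K nat (n + m)) = Oword r.
Proof.
rewrite /sctr /ctr2 ctrU big1 ?scale1r => [|l _].
  congr << _ >>; apply/ffunP; elim/ord_sum_ind => u; rewrite !ffunE ?sumf_l ?sumf_r.
    by have := insw_ll r u; rewrite ffunE.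
  by have := insw_rl r u; rewrite ffunE.
have -> : insw r ((@lshift n m \o @rshift p k) l) = (P + l).*2 by exact: insw_lr.
have -> : insw r ((@rshift n m \o @rshift q k) l) = (P + l).*2.+1 by exact: insw_rr.
by rewrite omegaU prt_double eqxx.
Qed.

Variables (F : functor (Ocat K)) (i0 : nattrans F (tensor_power (Ocat K) (n + m))).
Hypothesis te : tensor_embedding la mu i0.

Let Oinj : injective (@Oletter P).
Proof. by move=> a b /double_inj; apply: val_inj. Qed.

Lemma theta_avg j X (x : F X) : theta_fun i0 j x = \sum_s eJ s *: theta_fun i0 (j * s)%g x.
Proof.
rewrite /theta_fun -{1}(te_idem te) pact_ee (linear_sum (@sact K nat (n + m) (psum j.1 j.2))) linear_sum.
apply: eq_bigr => s _; rewrite linearZ linearZ /= sactM psumM; exact: erefl.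
Qed.

Notation Wk := (@W K (Ocat K) (fun=> tt) (fun n => @Oletter n) F P _ (theta i0) (filt i0 k.+1) (full_subfunctor F)).
Notation V := {ffun J * 'S_P -> K^o}.

Lemma W_twisted (v : V) : Wk v -> twisted hJ hP v /\ averaged eJ v.
Proof.
move=> [x [_ _ xE]]; have xE' j : wv (@Oletter P) (vj j v) = theta_fun i0 j x by rewrite -xE.
split=> [h j|j]; apply: (wv_inj Oinj).
  by rewrite -sact_wv !xE' /theta_fun /= -psumM -sactM; exact: sctr_equiv.
rewrite linear_sum xE' theta_avg; apply: eq_bigr => s _.
by rewrite linearZ; congr (_ *: _); exact: xE'.
Qed.

(** After a permutation g of the positions, the standard contraction of a planted word is nonzero
    only if g preserves the pairs, that is, comes from H; by [twisted] each such g contributes the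
    same vector. *)
Lemma twisted_sum (v : V) (j : J) : twisted hJ hP v ->
  \sum_s \sum_r v (s, r) *: sctr (sact (psum (j.1 * s.1^-1)%g (j.2 * s.2^-1)%g) (<< insw r >> : tpow K nat (n + m))) =
  #|[set hJ h | h : H]|%:R *: wv (@Oletter P) (vj j v).
Proof.
move=> tv.
transitivity (\sum_(g : J) \sum_r v ((g^-1 * j)%g, r) *: sctr (sact (psum g.1 g.2) (<< insw r >> : tpow K nat (n + m)))).
  have gI : injective (fun g : J => (g^-1 * j)%g) by move=> g g' /mulIg/invg_inj.
  rewrite [LHS](reindex_inj gI); apply: eq_bigr => g _; apply: eq_bigr => r _.
  by rewrite /= !invMg !invgK !mulKVg.
rewrite (bigID (mem [set hJ h | h : H])) /= [X in _ + X]big1 ?addr0 => [|g gH].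
  rewrite -sum1_card natr_sum scaler_suml; apply: eq_bigr => _ /imsetP[h _ ->].
  have := tv h (hJ h^-1 * j)%g; rewrite mulgA -hJM mulgV.
  have hJ1 : hJ 1%g = 1%g by apply: (mulgI (hJ 1%g)); rewrite -hJM !mulg1.
  have hJV : hJ h^-1%g = (hJ h)^-1%g by apply: (mulgI (hJ h)); rewrite -hJM !mulgV hJ1.
  rewrite hJ1 mul1g scale1r hJV => ->; rewrite -sact_wv /wv linear_sum; apply: eq_bigr => r _.
  have -> : sctr (sact (psum (hJ h).1 (hJ h).2) (<< insw r >> : tpow K nat (n + m))) = sact (hP h) (Oword r).
    by rewrite -(sctr_insw r); exact: sctr_equiv.
  rewrite [RHS]linearZ; congr (_ *: _); rewrite [RHS]ffunE; exact: erefl.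
apply: big1 => r _; have [->|/eqP h] := eqVneq (sctr (sact (psum g.1 g.2) (<< insw r >> : tpow K nat (n + m)))) 0.
  by rewrite scaler0.
rewrite /sctr ctr2_sact in h; have /fin_all_exists[f fE] := ctr2_insw h.
have [a [b [gE fb]]] := perm_split (fun l => (fE l).1).
have [c [b' [gE' fb']]] := perm_split (fun l => (fE l).2).
case/negP: gH; apply/imsetP; exists (a, b, c) => //.
rewrite /hJ /= -gE; have -> : b = b' by apply/permP => l; rewrite -fb fb'.
by rewrite -gE' -surjective_pairing.
Qed.

(** The preimage is a combination of planted words moved by c^-1 and projected by the Young
    idempotents, divided by the number [N] of position permutations preserving the pairs. It is
    killed by k + 1 contractions, since a word carries only k hyperbolic pairs. *)
Lemma twisted_W (v : V) : twisted hJ hP v -> averaged eJ v -> Wk v.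
Proof.
move=> tv av; pose N : K := #|[set hJ h | h : H]|%:R.
have N0 : N != 0.
  by apply: natr_neq0 => //; apply/card_gt0P; exists (hJ 1%g); apply/imsetP; exists 1%g.
have /choice[z zE] : forall c : J * 'S_P, exists z : F tt,
    i0 tt z = pact ee (sact (psum (c.1.1)^-1%g (c.1.2)^-1%g) << insw c.2 >>).
  move=> c; have [i1 i2] := insw_isotropic c.2 (c.1.1)^-1%g (c.1.2)^-1%g.
  by have [z zE] := te_surj te i1 i2; exists z; rewrite zE sactU.
pose x := N^-1 *: \sum_(c : J * 'S_P) (v c : K) *: z c.
have xE : (i0 tt x : tpow K nat (n + m)) = \sum_(c : J * 'S_P) \sum_(s : J) (N^-1 * v c * eJ s) *:
    sact (psum (s.1 * c.1.1^-1)%g (s.2 * c.1.2^-1)%g) << insw c.2 >>.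
  transitivity (N^-1 *: \sum_(c : J * 'S_P) (v c : K) *: (i0 tt (z c) : tpow K nat (n + m))).
    rewrite /x [LHS]linearZ (linear_sum (i0 tt)); congr (_ *: _); apply: eq_bigr => c _; exact: linearZ.
  apply: etrans (scaler_sumr _ _ _ _) _; apply: eq_bigr => c _.
  rewrite zE pact_ee; apply: etrans (congr1 _ (scaler_sumr _ _ _ _)) _.
  apply: etrans (scaler_sumr _ _ _ _) _; apply: eq_bigr => s _.
  by rewrite !scalerA sactM psumM.
exists x; split=> //.
  apply/filtP => p' q' El L Er R fl fr; rewrite xE.
  rewrite /ctr2; apply: etrans (linear_sum (ctr _ _ _) _ _ _) _; apply: big1 => c _.
  apply: etrans (linear_sum (ctr _ _ _) _ _ _) _; apply: big1 => s _.
  apply: etrans (ctrZ _ _ _ _ _) _; apply/eqP; rewrite scaler_eq0; apply/orP; right; apply/eqP.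
  apply: contrapT => h; have h' : ctr2 El L Er R (sact (psum (s.1 * c.1.1^-1)%g (s.2 * c.1.2^-1)%g) (<< insw c.2 >> : tpow K nat (n + m))) <> 0 by exact: h.
  rewrite ctr2_sact in h'; have /fin_all_exists[f fE] := ctr2_insw h'.
  have [_ LI _ _] := fl; have fI : injective f.
    by move=> l l' E; apply: LI; apply: (@perm_inj _ (s.1 * c.1.1^-1)%g); have [] := fE l; have [] := fE l'; rewrite /= => -> _ -> _; rewrite E.
  by have := leq_card f fI; rewrite !card_ord ltnn.
move=> j; rewrite /= /theta_fun xE.
transitivity (N^-1 *: \sum_(s : J) eJ s *: (N *: wv (@Oletter P) (vj (j * s)%g v))); last first.
  have -> : wv (@Oletter P) (vj j v) = \sum_(s : J) eJ s *: wv (@Oletter P) (vj (j * s)%g v).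
    by rewrite -[in LHS](av j) [LHS]linear_sum; apply: eq_bigr => s _; rewrite linearZ.
  apply: etrans (scaler_sumr _ _ _ _) _; apply: eq_bigr => s _.
  by rewrite !scalerA [eJ s * N]mulrC mulrA mulVf // mul1r.
rewrite exchange_big (linear_sum (@sact K nat (n + m) (psum j.1 j.2))) linear_sum scaler_sumr.
apply: eq_bigr => s _; rewrite -(twisted_sum (j * s)%g tv) pair_bigA scalerA scaler_sumr.
rewrite (linear_sum (@sact K nat (n + m) (psum j.1 j.2))) linear_sum; apply: eq_bigr => -[c r] _.
rewrite linearZ linearZ /= scalerA sactM psumM !mulgA; congr (_ *: _).
by rewrite mulrAC.
Qed.

End LayerSpace.

Section LayerDimension.
Variables (K : fieldType) (K0 : [pchar K] =i pred0) (la mu nu : intpart).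

Lemma eJ_idem p k q : (p + k)%N = sumn la -> (q + k)%N = sumn mu ->
  forall u, \sum_s @eJ K p k q la mu s * eJ K la mu (s^-1 * u)%g = eJ K la mu u.
Proof.
move=> nla mmu u; have e1 := yidemK K0 nla; have e2 := yidemK K0 mmu.
rewrite /eJ -[in RHS]e1 -[in RHS]e2 [in RHS]ffunE [X in _ = _ * X]ffunE.
rewrite [RHS]big_distrlr /= pair_bigA; apply: eq_bigr => s _; by rewrite mulrACA.
Qed.

Lemma eJ_char p k q (j : 'S_(p + k) * 'S_(q + k)) :
  \sum_i @eJ K p k q la mu (i^-1 * j^-1 * i)%g = ychar K la j.1 * ychar K mu j.2.
Proof.
rewrite -(ycharV _ la) -(ycharV _ mu) /ychar /chi big_distrlr /= pair_bigA.
by apply: eq_bigr => i _.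
Qed.

Lemma layer_dim p k q (F : functor (Ocat K)) (i0 : nattrans F (tensor_power (Ocat K) ((p + k) + (q + k)))) :
  tensor_embedding la mu i0 ->
  (p + k)%N = sumn la -> (q + k)%N = sumn mu -> (p + q)%N = sumn nu ->
  exists U : {vspace {ffun ('S_(p + k) * 'S_(q + k)) * 'S_(p + q) -> K^o}},
  (forall v, v \in U <-> @W K (Ocat K) (fun=> tt) (fun n => @Oletter n) F (p + q) _ (theta i0) (filt i0 k.+1) (full_subfunctor F) v /\
     yfix nu v) /\
  \sum_(a : 'S_p) \sum_(b : 'S_k) \sum_(c : 'S_q)
    ychar K la (psum a b) * ychar K mu (psum c b) * ychar K nu (psum a c) =
  (p`! * k`! * q`!)%:R * (\dim U)%:R.
Proof.
move=> te nla mmu Pnu; pose x := yidem K (p + q) nu.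
have xx : gm x x = x by apply: yidemK.
have [||U UE] := @vspace_of_pred K {ffun ('S_(p + k) * 'S_(q + k)) * 'S_(p + q) -> K^o}
  (fun v => [/\ twisted (@hJ p k q) (@hP p k q) v, averaged (@eJ K p k q la mu) v & yfix nu v]).
- by split; [apply: twisted0 | apply: averaged0 | apply: yfix0].
- by move=> a u v [u1 u2 u3] [v1 v2 v3]; split; [apply: twistedD | apply: averagedD | apply: yfixD].
exists U; split=> [v|].
  rewrite UE; split=> [[v1 v2 v3]|[Wv v3]]; first by split=> //; exact: (twisted_W K0 te v1 v2).
  by have [] := W_twisted te Wv.
have := twisted_dim (@hJM p k q) (@hPM p k q) (eJ_idem nla mmu) xx UE.
rewrite !card_prod !card_Sn => <-.
rewrite pair_bigA pair_bigA; apply: eq_bigr => -[[a b] c] _.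
by rewrite eJ_char.
Qed.

(** States the results on a layer for arbitrary n and m, so that all layers of one filtration share
    the same index set. *)
Lemma theta_ex p k q n m (F : functor (Ocat K)) (i0 : nattrans F (tensor_power (Ocat K) (n + m))) :
  tensor_embedding la mu i0 -> n = (p + k)%N -> m = (q + k)%N -> n = sumn la -> m = sumn mu ->
  exists th : 'S_n * 'S_m -> nattrans F (tensor_power (Ocat K) (p + q)),
  [/\ forall j X z, z \in filt i0 k.+1 X -> th j X z \in traceless K (p + q) X,
     forall X z, z \in filt i0 k X <-> forall j, th j X z = 0 &
     (p + q)%N = sumn nu ->
  exists U : {vspace {ffun ('S_n * 'S_m) * 'S_(p + q) -> K^o}},
  (forall v, v \in U <-> @W K (Ocat K) (fun=> tt) (fun n => @Oletter n) F (p + q) _ th (filt i0 k.+1) (full_subfunctor F) v /\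
     yfix nu v) /\
  \sum_(a : 'S_p) \sum_(b : 'S_k) \sum_(c : 'S_q)
    ychar K la (psum a b) * ychar K mu (psum c b) * ychar K nu (psum a c) =
  (p`! * k`! * q`!)%:R * (\dim U)%:R].
Proof.
move=> te en em; subst n m => nla mmu; exists (theta i0); split.
- by move=> j X z; apply: (theta_traceless te).
- by move=> X z; apply: theta_filt.
- by move=> Pnu; apply: layer_dim.
Qed.

End LayerDimension.

Section Embedding.
Variables (K : fieldType) (K0 : [pchar K] =i pred0) (la mu : intpart).
Notation n := (sumn la).
Notation m := (sumn mu).

Lemma tcatZl N M c (x : tpow K nat N) (y : tpow K nat M) : tcat (c *: x) y = c *: tcat x y.
Proof. by apply/malgP => z; rewrite mcoeffZ !mcoeff_tcat mcoeffZ mulrA. Qed.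

Lemma repl_tcat_l N M a a' c c' (x : tpow K nat N) (y : tpow K nat M) :
  repl (lshift M a) (lshift M a') c c' (tcat x y) = tcat (repl a a' c c' x) y.
Proof.
move: x; apply: (@malg_linear_eq K _ _ (repl (lshift M a) (lshift M a') c c' \o tcatr y) (tcatr y \o repl a a' c c')) => i /=.
rewrite /tcatr; move: y; apply: (@malg_linear_eq K _ _ (repl (lshift M a) (lshift M a') c c' \o tcat _) (tcat _)) => j /=.
rewrite tcatU !replU tcatZl tcatU !catw_l; congr (_ *: << _ >>); apply/ffunP; elim/ord_sum_ind => u; rewrite ffunE ?catw_l ?catw_r.
  by rewrite !(inj_eq (@lshift_inj _ _)) ffunE.
by rewrite !eq_rlshift.
Qed.

Lemma repl_tcat_r N M b b' c c' (x : tpow K nat N) (y : tpow K nat M) :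
  repl (rshift N b) (rshift N b') c c' (tcat x y) = tcat x (repl b b' c c' y).
Proof.
move: x; apply: (@malg_linear_eq K _ _ (repl (rshift N b) (rshift N b') c c' \o tcatr y) (tcatr _)) => i /=.
rewrite /tcatr; move: y; apply: (@malg_linear_eq K _ _ (repl (rshift N b) (rshift N b') c c' \o tcat _) (tcat _ \o repl b b' c c')) => j /=.
rewrite tcatU !replU [RHS]linearZ /= tcatU !catw_r; congr (_ *: << _ >>).
apply/ffunP; elim/ord_sum_ind => u; rewrite ffunE ?catw_l ?catw_r.
  by rewrite !eq_lrshift.
by rewrite !(inj_eq (@rshift_inj _ _)) ffunE.
Qed.

Lemma isotropic_traceless N (i : {ffun 'I_N -> nat}) : (forall a a', i a' != prt (i a)) ->
  (<< i >> : tpow K nat N) \in @traceless_pred K N.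
Proof.
move=> iso; apply/traceless_repl => a a' c c' _.
by rewrite replU omegaU (negPf (iso _ _)) scale0r.
Qed.

Lemma temb_embedding : tensor_embedding la mu (@temb K (Ocat K) (fun n => traceless K n) la mu).
Proof.
split.
- by move=> X z; apply: temb_eq0.
- by move=> X z; apply: temb_idem.
- move=> X z a a' c c' aa; move: z.
  apply: tensor_ind => [|x y xE yE|f g]; first by rewrite /= linear0; apply: (linear0 (repl _ _ _ _)).
    rewrite /= (linearD (@temb_fun K (Ocat K) (fun n => traceless K n) la mu X)).
    apply: etrans (linearD (repl _ _ _ _) _ _) _.
    by apply: etrans (congr2 +%R xE yE) _; rewrite addr0.
  rewrite /= temb_ptens; apply: etrans (repl_tcat_l _ _ _ _ _ _) _.
  have -> : repl a a' c c' (ev f) = 0 by apply: (proj1 (traceless_repl _) (ev_in f)).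
  exact: (linear0 (tcatr (ev g))).
- move=> X z a a' c c' aa; move: z.
  apply: tensor_ind => [|x y xE yE|f g]; first by rewrite /= linear0; apply: (linear0 (repl _ _ _ _)).
    rewrite /= (linearD (@temb_fun K (Ocat K) (fun n => traceless K n) la mu X)).
    apply: etrans (linearD (repl _ _ _ _) _ _) _.
    by apply: etrans (congr2 +%R xE yE) _; rewrite addr0.
  rewrite /= temb_ptens; apply: etrans (repl_tcat_r _ _ _ _ _ _) _.
  have -> : repl a a' c c' (ev g) = 0 by apply: (proj1 (traceless_repl _) (ev_in g)).
  exact: (linear0 (tcat (ev f))).
- move=> i il ir.
  have A N X s (t : tpow K (bc_basis (b := Ocat K) X) N) : t \in traceless K N X -> sact s t \in traceless K N X.
    exact: traceless_sact.
  have zE : << i >> = tcat << leftw i >> << rightw i >> :> tpow K nat (n + m).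
    by rewrite tcatU; congr << _ >>; apply/esym/eqP; rewrite catw_eqP !eqxx.
  have lt : (<< leftw i >> : tpow K nat n) \in traceless K n tt.
    by apply: isotropic_traceless => a a'; rewrite !ffunE.
  have rt : (<< rightw i >> : tpow K nat m) \in traceless K m tt.
    by apply: isotropic_traceless => a a'; rewrite !ffunE.
  have [f fE] : exists f : Osimple K la tt, ev f = pact (yidem K n la) << leftw i >>.
    apply: (ev_surj (A _)); first exact: (pact_mem (A _) _ lt).
    by rewrite pactM (yidemK K0).
  have [g gE] : exists g : Osimple K mu tt, ev g = pact (yidem K m mu) << rightw i >>.
    apply: (ev_surj (A _)); first exact: (pact_mem (A _) _ rt).
    by rewrite pactM (yidemK K0).
  exists (ptens f g); rewrite zE pact_tcat -fE -gE; exact: temb_ptens.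
Qed.

End Embedding.

(** * The multiplicity formula *)

Section TripleSum.
Variables (K : fieldType) (K0 : [pchar K] =i pred0).

Lemma ychar_cast n n' (e : n = n') la (s : 'S_n) : ychar K la (cast_perm e s) = ychar K la s.
Proof. by case: _ / e; rewrite cast_perm_id. Qed.

(** The two permutations are conjugate by the exchange of the blocks, up to the cast along q + k = k
    + q. *)
Lemma ychar_psumC q k la (c : 'S_q) (b : 'S_k) : ychar K la (psum c b) = ychar K la (psum b c).
Proof.
pose e := addnC q k.
pose f (x : 'I_(k + q)) : 'I_(k + q) := match fintype.split x with
  inl l => cast_ord e (rshift q l) | inr u => cast_ord e (lshift k u) end.
have fI : injective f.
  elim/ord_sum_ind => x; elim/ord_sum_ind => y; rewrite /f ?(unsplitK (inl _)) ?(unsplitK (inr _)).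
  - by move=> /cast_ord_inj/rshift_inj ->.
  - by move=> /cast_ord_inj/eqP; rewrite eq_rlshift.
  - by move=> /cast_ord_inj/eqP; rewrite eq_lrshift.
  - by move=> /cast_ord_inj/lshift_inj ->.
pose w := perm fI.
have wl l : w (lshift q l) = cast_ord e (rshift q l) by rewrite permE /f (unsplitK (inl l)).
have wr u : w (rshift k u) = cast_ord e (lshift k u) by rewrite permE /f (unsplitK (inr u)).
rewrite -(ychar_cast e) -[RHS](ycharJ K la _ w); congr (ychar K la _).
apply: (mulgI w); rewrite !mulgA mulgV mul1g; apply: psum_ext => x; rewrite !permM.
  by rewrite wl -cast_ord_permE psum_r psum_l wl.
by rewrite wr -cast_ord_permE psum_l psum_r wr.
Qed.

Lemma ychar_parseval n (f g : 'S_n -> K) : (forall s u, f (u^-1 * s * u)%g = f s) ->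
  \sum_(al <- all_types n) (\sum_s f s * ychar K al s) * (\sum_s g s * ychar K al s) =
  n`!%:R * \sum_s f s * g s.
Proof.
move=> fJ; transitivity (\sum_(al <- all_types n) \sum_t g t * ((\sum_s f s * ychar K al s) * ychar K al t)).
  by apply: eq_bigr => al _; rewrite mulr_sumr; apply: eq_bigr => t _; rewrite mulrCA.
rewrite exchange_big mulr_sumr; apply: eq_bigr => t _ /=.
by rewrite -mulr_sumr (ychar_complete K0 t fJ) mulrCA [g t * _]mulrC.
Qed.

Lemma LR_char_sum p k (al be nu : intpart) : sumn al = p -> sumn be = k -> sumn nu = (p + k)%N ->
  p`!%:R * k`!%:R * (LR K nu al be)%:R =
  \sum_(s : 'S_p) (\sum_(t : 'S_k) ychar K nu (psum s t) * ychar K be t) * ychar K al s.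
Proof.
move=> <- <- /(LR_char K0) ->; apply: eq_bigr => s _; rewrite mulr_suml; apply: eq_bigr => t _.
by ring.
Qed.

(** Multiplying once more by c = p! k! q! turns all three coefficients into character sums. The sums
    over [al], [be] and [ga] are then removed in turn by [ychar_parseval], which gives back p!, k!
    and q!. *)
Lemma LR_triple p k q (la mu nu : intpart) :
  sumn la = (p + k)%N -> sumn mu = (k + q)%N -> sumn nu = (p + q)%N ->
  (p`! * k`! * q`!)%:R * (\sum_(al <- all_types p) \sum_(be <- all_types k) \sum_(ga <- all_types q)
     (LR K la al be * LR K mu be ga * LR K nu al ga)%N)%:R =
  \sum_(a : 'S_p) \sum_(b : 'S_k) \sum_(c : 'S_q)
    ychar K la (psum a b) * ychar K mu (psum c b) * ychar K nu (psum a c).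
Proof.
move=> ela emu enu; set c : K := (p`! * k`! * q`!)%:R.
have c0 : c != 0 by apply: natr_neq0 => //; rewrite !muln_gt0 !fact_gt0.
pose A1 be (s : 'S_p) := \sum_(t : 'S_k) ychar K la (psum s t) * ychar K be t.
pose B1 ga (t : 'S_k) := \sum_(u : 'S_q) ychar K mu (psum t u) * ychar K ga u.
pose C1 ga (s : 'S_p) := \sum_(u : 'S_q) ychar K nu (psum s u) * ychar K ga u.
apply: (mulfI c0).
transitivity (\sum_(al <- all_types p) \sum_(be <- all_types k) \sum_(ga <- all_types q)
   ((\sum_(s : 'S_p) A1 be s * ychar K al s) * (\sum_(t : 'S_k) B1 ga t * ychar K be t)) * (\sum_(s : 'S_p) C1 ga s * ychar K al s)).
  rewrite mulrA natr_sum mulr_sumr big_seq [RHS]big_seq; apply: eq_bigr => al; rewrite (all_typesP K0) => /eqP al_p.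
  rewrite natr_sum mulr_sumr big_seq [RHS]big_seq; apply: eq_bigr => be; rewrite (all_typesP K0) => /eqP be_k.
  rewrite natr_sum mulr_sumr big_seq [RHS]big_seq; apply: eq_bigr => ga; rewrite (all_typesP K0) => /eqP ga_q.
  rewrite -(LR_char_sum (esym al_p) (esym be_k) ela) -(LR_char_sum (esym be_k) (esym ga_q) emu) -(LR_char_sum (esym al_p) (esym ga_q) enu).
  by rewrite /c !natrM; ring.
transitivity (\sum_(be <- all_types k) \sum_(ga <- all_types q) p`!%:R * \sum_(s : 'S_p) A1 be s * C1 ga s * (\sum_(t : 'S_k) B1 ga t * ychar K be t)).
  rewrite exchange_big; apply: eq_bigr => be _; rewrite exchange_big; apply: eq_bigr => ga _ /=.
  rewrite -mulr_suml mulrA -(ychar_parseval (f := A1 be) (C1 ga)) => [|s u].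
    by rewrite mulr_suml; apply: eq_bigr => al _; rewrite mulrAC.
  by apply: eq_bigr => t _; rewrite class_psum_l //; exact: ycharJ.
transitivity (p`!%:R * \sum_(s : 'S_p) \sum_(ga <- all_types q) C1 ga s * (k`!%:R * \sum_(t : 'S_k) ychar K la (psum s t) * B1 ga t)).
  under eq_bigr do rewrite -mulr_sumr.
  rewrite -mulr_sumr; congr (_ * _); rewrite exchange_big /=.
  under eq_bigr do rewrite exchange_big.
  rewrite exchange_big; apply: eq_bigr => s _ /=; apply: eq_bigr => ga _.
  rewrite -(ychar_parseval (f := fun t => ychar K la (psum s t)) (B1 ga)) => [|t u].
    by rewrite mulr_sumr; apply: eq_bigr => be _; rewrite mulrA [C1 ga s * _]mulrC.
  by rewrite class_psum_r //; exact: ycharJ.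
have -> : c = p`!%:R * (k`!%:R * q`!%:R) by rewrite /c !natrM mulrA.
rewrite -mulrA; congr (_ * _); rewrite mulr_sumr; apply: eq_bigr => s _.
transitivity (\sum_(t : 'S_k) k`!%:R * (ychar K la (psum s t) * \sum_(ga <- all_types q) C1 ga s * B1 ga t)).
  transitivity (\sum_(ga <- all_types q) \sum_(t : 'S_k) k`!%:R * (ychar K la (psum s t) * (C1 ga s * B1 ga t))).
    by apply: eq_bigr => ga _; rewrite mulrCA !mulr_sumr; apply: eq_bigr => t _; rewrite [C1 _ _ * (_ * _)]mulrCA.
  by rewrite exchange_big; apply: eq_bigr => t _; rewrite !mulr_sumr.
rewrite mulr_sumr; apply: eq_bigr => t _.
rewrite (ychar_parseval (f := fun u => ychar K nu (psum s u)) (fun u => ychar K mu (psum t u))) => [|u v]; last first.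
  by rewrite class_psum_r //; exact: ycharJ.
rewrite !mulr_sumr; apply: eq_bigr => u _; rewrite (ychar_psumC mu u t); ring.
Qed.

Lemma fsbig_types (f : intpart -> nat) p : (forall al : intpart, sumn al <> p -> f al = 0%N) ->
  (\sum_(al \in [set: intpart]) f al = \sum_(al <- all_types p) f al)%N.
Proof.
move=> f0; rewrite (fsbigTE [fset al in all_types p]%fset) => [|al]; last first.
  by rewrite inE /= (all_typesP K0) => /eqP h; apply: f0 => E; apply: h.
apply: perm_big; rewrite uniq_perm ?enum_fset_uniq ?undup_uniq // => al.
by rewrite inE.
Qed.

Lemma LR_prod0 (la mu nu al be ga : intpart) : (LR K la al be * LR K mu be ga * LR K nu al ga)%N <> 0%N ->
  [/\ sumn la = (sumn al + sumn be)%N, sumn mu = (sumn be + sumn ga)%N & sumn nu = (sumn al + sumn ga)%N].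
Proof.
by move=> h; split; apply: contrapT => /(LR_eq0 K0) E; apply: h; rewrite E ?mul0n ?muln0.
Qed.

Lemma natr_injective a b : a%:R = b%:R :> K -> a = b.
Proof.
wlog ab : a b / (a <= b)%N => [W E|E].
  by case/orP: (leq_total a b) => /W; [apply | move=> /(_ (esym E))].
apply/eqP; rewrite eqn_leq ab -subn_eq0; apply/eqP; case d: (b - a)%N => [//|r].
by have := natr_neq0 K0 (ltn0Sn r); rewrite -d natrB // E subrr eqxx.
Qed.

Lemma tensor_multiplicity (la mu nu : intpart) :
  multiplicity (tensor (Osimple K la) (Osimple K mu)) (Osimple K nu)
    (\sum_(al \in [set: intpart]) \sum_(be \in [set: intpart]) \sum_(ga \in [set: intpart])
       (LR K la al be * LR K mu be ga * LR K nu al ga)%N)%N.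
Proof.
pose n := sumn la; pose m := sumn mu; pose F := tensor (Osimple K la) (Osimple K mu).
pose i0 : nattrans F (tensor_power (Ocat K) (n + m)) := @temb K (Ocat K) (fun n => traceless K n) la mu.
have te : tensor_embedding la mu i0 by apply: temb_embedding.
pose L := (minn n m).+1; pose P k := ((n - k) + (m - k))%N.
have th_ex k : exists th : 'S_n * 'S_m -> nattrans F (tensor_power (Ocat K) (P k)), (k < L)%N ->
  [/\ forall j X z, z \in filt i0 k.+1 X -> th j X z \in traceless K (P k) X,
     forall X z, z \in filt i0 k X <-> forall j, th j X z = 0 &
     P k = sumn nu ->
  exists U : {vspace {ffun ('S_n * 'S_m) * 'S_(P k) -> K^o}},
  (forall v, v \in U <-> @W K (Ocat K) (fun=> tt) (fun n => @Oletter n) F (P k) _ th (filt i0 k.+1) (full_subfunctor F) v /\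
     yfix nu v) /\
  \sum_(a : 'S_(n - k)) \sum_(b : 'S_k) \sum_(c : 'S_(m - k))
    ychar K la (psum a b) * ychar K mu (psum c b) * ychar K nu (psum a c) =
  ((n - k)`! * k`! * (m - k)`!)%:R * (\dim U)%:R].
  have [kL|kL] := ltnP k L; last first.
    (* The maps have to be given for every k; from [L] on the zero transformation serves as
       default. *)
    have zn X Y (h : bc_hom X Y) (x : F X) : \0 (fmap F h x) = fmap (tensor_power (Ocat K) (P k)) h (\0 x).
      by rewrite /= linear0.
    by exists (fun _ => Nattrans zn).
  have kn : (k <= n)%N by move: kL; rewrite /L; lia.
  have km : (k <= m)%N by move: kL; rewrite /L; lia.
  have [th thP] := theta_ex K0 nu te (esym (subnK kn)) (esym (subnK km)) (erefl _) (erefl _).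
  by exists th.
pose th k := sval (cid (th_ex k)); have thP k := svalP (cid (th_ex k)).
have P_inj k l : (k < L)%N -> (l < L)%N -> P k = P l -> k = l by rewrite /P /L; lia.
have Fs0 X (x : F X) : x \in filt i0 0 X -> x = 0 by apply: (filt0 te).
have FsL X (x : F X) : x \in filt i0 L X by apply: filt_top.
have Fs_le k : sfle (filt i0 k) (filt i0 k.+1) by apply: filt_le.
have th_in k : (k < L)%N -> forall X x, x \in filt i0 k.+1 X -> forall j, th k j X x \in traceless K (P k) X.
  by move=> kL X x xk j; have [h _ _] := thP k kL; apply: h.
have th_ker k : (k < L)%N -> forall X x, x \in filt i0 k.+1 X -> (forall j, th k j X x = 0) -> x \in filt i0 k X.
  by move=> kL X x _ x0; have [_ h _] := thP k kL; apply/h.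
have lo_ker k : (k < L)%N -> forall X x, x \in filt i0 k X -> forall j, th k j X x = 0.
  by move=> kL X x xk; have [_ h _] := thP k kL; apply/h.
have pz := O_polarizable K0.
have [[k [kL Pk]]|nk] := pselect (exists k, (k < L)%N /\ P k = sumn nu); last first.
  have -> : (\sum_(al \in [set: intpart]) \sum_(be \in [set: intpart]) \sum_(ga \in [set: intpart])
       (LR K la al be * LR K mu be ga * LR K nu al ga)%N)%N = 0%N.
    apply: fsbig1 => al _; apply: fsbig1 => be _; apply: fsbig1 => ga _.
    (* A nonzero term would determine the sizes of the three partitions and make the size of [be]
       the index of a layer of degree |nu|. *)
    apply: contrapT => /LR_prod0[e1 e2 e3]; apply: nk; exists (sumn be).
    by rewrite /L /P /n /m e1 e2 e3; lia.
  apply: (multiplicity_no_layer (P := P) pz Fs0 FsL Fs_le th_in th_ker lo_ker) => k kL Pk.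
  by apply: nk; exists k.
have [_ _ /(_ Pk)[U [UE Udim]]] := thP k kL.
have ela : sumn la = ((n - k) + k)%N by rewrite -/n; move: kL; rewrite /L; lia.
have emu : sumn mu = (k + (m - k))%N by rewrite -/m; move: kL; rewrite /L; lia.
(* The three size equations of a nonzero term have a unique solution, so the sums over all
   partitions reduce to those of sizes n - k, k and m - k. *)
have sizes al be ga : (LR K la al be * LR K mu be ga * LR K nu al ga)%N <> 0%N ->
    [/\ sumn al = (n - k)%N, sumn be = k & sumn ga = (m - k)%N].
  by move=> /LR_prod0[e1 e2 e3]; move: kL Pk; rewrite /L /P /n /m e1 e2 e3; split; lia.
have -> : (\sum_(al \in [set: intpart]) \sum_(be \in [set: intpart]) \sum_(ga \in [set: intpart])
       (LR K la al be * LR K mu be ga * LR K nu al ga)%N)%N = \dim U.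
  rewrite (@fsbig_types _ (n - k)%N) => [|al alp]; last first.
    apply: fsbig1 => be _; apply: fsbig1 => ga _; apply: contrapT => /sizes[E _ _]; exact: (alp E).
  under eq_bigr => al _.
    rewrite (@fsbig_types _ k) => [|be bek]; last first.
      by apply: fsbig1 => ga _; apply: contrapT => /sizes[_ E _]; exact: (bek E).
    under eq_bigr => be _.
      rewrite (@fsbig_types _ (m - k)%N) => [|ga gaq]; last first.
        by apply: contrapT => /sizes[_ _ E]; exact: (gaq E).
      over.
    over.
  apply: natr_injective; have := LR_triple ela emu (esym Pk); rewrite Udim => /mulfI; apply.
  by apply: natr_neq0 => //; rewrite !muln_gt0 !fact_gt0.
exact: (multiplicity_layer (P := P) K0 pz Fs0 FsL Fs_le th_in th_ker lo_ker P_inj kL Pk UE).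
Qed.

End TripleSum.

(* [complex] turns [i] between brackets into a keyword. *)
From mathcomp Require Import complex reals.

Local Open Scope complex_scope.

Theorem mainTheorem20 (R : realType) (la mu nu : intpart) :
  RepO_multiplicity
    (tensor (Osimple R[i] la) (Osimple R[i] mu)) (Osimple R[i] nu)
    (\sum_(al \in [set: intpart]) \sum_(be \in [set: intpart])
       \sum_(ga \in [set: intpart])
         (LR R[i] la al be * LR R[i] mu be ga * LR R[i] nu al ga)%N).
Proof.
have K0 := Num.Theory.pchar_num R[i].
split; [exact: in_RepO_tensor | exact: in_RepO_Osimple | exact: tensor_multiplicity].
Qed.
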